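(* Let $1<p<\infty$ where $p\ne2$. Then (a) $X_p\overset{c}{\hookrightarrow}D_p$; (b) $\left(\sum^{\oplus}\ell^2\right)_{\ell^p}\overset{c}{\hookrightarrow}D_p$; (c) $\left(\sum^{\oplus}\ell^2\right)_{\ell^p}\oplus X_p\overset{c}{\hookrightarrow}D_p$.
   Context: $X\overset{c}{\hookrightarrow}Y$ means $X$ is isomorphic to a complemented subspace of $Y$ (the range of a bounded linear projection on $Y$). $\left(\sum^{\oplus}X\right)_{\ell^p}$ is the $\ell^p$-sum of countably infinitely many copies of $X$. Condition $( * )$ for a sequence $w=\{w_n\}$ of positive scalars (with $2<p<\infty$ fixed): for each $\epsilon>0$, $\sum_{w_n<\epsilon}w_n^{2p/(p-2)}=\infty$. The space $X_p$: for $2<p<\infty$ and $w$ a sequence of positive scalars, $X_{p,w}$ is the Banach space of scalar sequences with finite norm $\max\{(\sum|x_n|^p)^{1/p},(\sum|w_nx_n|^2)^{1/2}\}$. All $X_{p,w}$ with $w$ satisfying $( * )$ are isomorphic, and $X_p$ denotes any of them. The space $D_p$: let $2<p<\infty$, let $\Omega=\prod_{i=1}^\infty[0,1]$ with product Lebesgue measure, $\pi_i:\Omega\to[0,1]$ the $i$-th coordinate map, and let $\{r_n\}$ be the Rademacher functions on $[0,1]$, $r_n(t)=\operatorname{sgn}\sin(2^n\pi t)$. Given a sequence $w=\{w_i\}$ from $(0,1]$, put $k_i=w_i^{2p/(p-2)}$ and define $T_i:L^p[0,1]\to L^p[0,1]$ by $T_i(f)(s)=k_i^{-1/p}f(s/k_i)$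 for $0\le s\le k_i$ and $T_i(f)(s)=0$ for $k_i<s\le1$. Let $\tilde y_{i,n}=T_i(r_n)\circ\pi_i\in L^p(\Omega)$. Then $D_p$ is (the isomorphism type of) the closed linear span of $\{\tilde y_{i,n}:i,n\in\mathbb N\}$ in $L^p(\Omega)$ for any sequence $w$ from $(0,1]$ satisfying $( * )$ (the isomorphism type does not depend on the choice of such $w$). For $1<q<2$ with conjugate index $p$, $X_q$ and $D_q$ are the duals of $X_p$ and $D_p$. *)

(* Defs.v *)
From HB Require Import structures.
From mathcomp Require Import all_boot all_order all_algebra.
From mathcomp Require Import generic_quotient ring_quotient.
From mathcomp Require Import all_classical all_reals all_analysis.
From mathcomp Require Import measurable_realfun.

Set Implicit Arguments.
Unset Strict Implicit.
Unset Printing Implicit Defensive.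

Import Order.TTheory GRing.Theory Num.Theory.
Import numFieldNormedType.Exports.

Local Open Scope classical_set_scope.
Local Open Scope ring_scope.

Section linear_subspace.
Context {R : realType} {V : normedModType R}.
Implicit Types A : set V.

Definition linear_subspace A :=
  A 0 /\ forall (a : R) x y, A x -> A y -> A (a *: x + y).

Lemma linear_subspace_closure A : linear_subspace A ->
  linear_subspace (closure A).
Proof.
move=> [A0 AD]; split; first exact: subset_closure.
move=> a x y Ax Ay B Bz.
have cont : (fun u : V * V => a *: u.1 + u.2) @ (x, y) --> a *: x + y.
  apply: cvgD; last exact: cvg_snd.
  by apply: cvgZl_tmp; exact: cvg_fst.
have [[B1 B2]/= [B1x B2y] BB] := cont _ Bz.
have [x' [Ax' Bx']] := Ax _ B1x; have [y' [Ay' By']] := Ay _ B2y.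
exists (a *: x' + y'); split; first exact: AD.
exact: (BB (x', y')).
Qed.

Definition subsp_pred A (hA : linear_subspace A) : {pred V} :=
  fun x => x \in A.

Definition subsp A (hA : linear_subspace A) := {x : V | subsp_pred hA x}.

End linear_subspace.

Section subsp_instances.
Context {R : realType} {V : normedModType R} (A : set V)
  (hA : linear_subspace A).

Let subsp_submod_closed : submod_closed (subsp_pred hA).
Proof.
by split => [|a x y]; rewrite !inE; [exact: hA.1|exact: hA.2].
Qed.

HB.instance Definition _ :=
  GRing.isSubmodClosed.Build R V (subsp_pred hA) subsp_submod_closed.
HB.instance Definition _ := SubChoice.on (subsp hA).
HB.instance Definition _ := [SubChoice_isSubLmodule of subsp hA by <:].

Let subsp_norm (x : subsp hA) : R := `|val x|.

Let subsp_normD x y : subsp_norm (x + y) <= subsp_norm x + subsp_norm y.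
Proof. exact: ler_normD. Qed.

Let subsp_normZ (a : R) x : subsp_norm (a *: x) = `|a| * subsp_norm x.
Proof. exact: normrZ. Qed.

Let subsp_norm0_eq0 x : subsp_norm x = 0 -> x = 0.
Proof. by move=> /normr0_eq0 x0; exact: val_inj. Qed.

HB.instance Definition _ := Lmodule_isNormed.Build R (subsp hA)
  subsp_normD subsp_normZ subsp_norm0_eq0.

End subsp_instances.

Section complemented.
Context {R : realType}.
Implicit Types U V : normedModType R.

Lemma linear_subspace_range U V (f : {linear U -> V}) :
  linear_subspace (range f).
Proof.
split; first by exists 0; rewrite ?linear0.
by move=> a _ _ [x _ <-] [y _ <-]; exists (a *: x + y); rewrite ?linearP.
Qed.

Definition isomorphic U V := exists (f : {linear U -> V}) (g : {linear V -> U}),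
  [/\ continuous f, continuous g, cancel f g & cancel g f].

Definition complemented_embeds U V := exists Q : {linear V -> V},
  [/\ continuous Q, forall x, Q (Q x) = Q x &
      isomorphic U (subsp (linear_subspace_range Q))].

End complemented.

Section closed_span.
Context {R : realType} {V : normedModType R}.

Definition linear_span (A : set V) : set V :=
  [set x | exists n (c : 'I_n -> R) (g : 'I_n -> V),
    (forall i, A (g i)) /\ x = \sum_(i < n) c i *: g i].

Lemma linear_subspace_span A : linear_subspace (linear_span A).
Proof.
split.
  by exists 0, (fun=> 0), (fun=> 0); split => [[]//|]; rewrite big_ord0.
move=> a _ _ [n [c [g [gA ->]]]] [m [d [h [hA ->]]]].
exists (n + m)%N.
exists (fun i : 'I_(n + m) =>
  match fintype.split i with inl j => a * c j | inr j => d j end).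
exists (fun i : 'I_(n + m) =>
  match fintype.split i with inl j => g j | inr j => h j end); split.
  by move=> i; case: (fintype.split i).
rewrite big_split_ord/= scaler_sumr; congr +%R; apply: eq_bigr => i _.
  by rewrite (unsplitK (inl i)) scalerA.
by rewrite (unsplitK (inr i)).
Qed.

Definition closed_span (A : set V) :=
  subsp (linear_subspace_closure (linear_subspace_span A)).

End closed_span.

Section dual.
Context {R : realType} (U : normedModType R).

Definition dual_pred : {pred U -> R^o} :=
  fun f => `[< linear f /\ continuous f >].

Definition dual_space := {f : U -> R^o | dual_pred f}.

Lemma dual_submod_closed : submod_closed dual_pred.
Proof.
split.
  apply/asboolP; split => [a x y|x].
    by rewrite /GRing.zero/= scaler0 addr0.
  exact: cst_continuous.
move=> a f g /asboolP[lf cf] /asboolP[lg cg]; apply/asboolP; split.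
  move=> b x y.
  change (a *: f (b *: x + y) + g (b *: x + y) =
          b *: (a *: f x + g x) + (a *: f y + g y)).
  rewrite lf lg !scalerDr !scalerA (mulrC a b) -!addrA; congr +%R.
  by rewrite addrCA.
move=> x; apply: cvgD; last exact: cg.
by apply: cvgZl_tmp; exact: cf.
Qed.

HB.instance Definition _ :=
  GRing.isSubmodClosed.Build R _ dual_pred dual_submod_closed.
HB.instance Definition _ := SubChoice.on dual_space.
HB.instance Definition _ := [SubChoice_isSubLmodule of dual_space by <:].

Definition dual_norm (f : dual_space) : R :=
  sup [set `|val f x| | x in [set x : U | `|x| <= 1]].

Let dual_has_sup (f : dual_space) :
  has_sup [set `|val f x| | x in [set x : U | `|x| <= 1]].
Proof.
split; first by exists `|val f 0|, 0 => //=; rewrite normr0.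
have /asboolP[lf cf] := valP f.
pose g := HB.pack_for {linear U -> R^o} (val f : U -> R^o)
  (GRing.isLinear.Build R U R^o *:%R (val f) lf).
have /linear_bounded_continuous/linear_boundedP/pinfty_ex_gt0[M M0 fM] :
  continuous g by exact: cf.
exists M => _ [x x1 <-]; apply: le_trans (fM x) _.
by rewrite ler_piMr// ltW.
Qed.

Let dual_linear (f : dual_space) : linear (val f : U -> R^o).
Proof. by have /asboolP[] := valP f. Qed.

Let dual_norm_ub (f : dual_space) x : `|x| <= 1 -> `|val f x| <= dual_norm f.
Proof.
by move=> x1; apply: ub_le_sup; [exact: (dual_has_sup f).2|exists x].
Qed.

Let dual_normD f g : dual_norm (f + g) <= dual_norm f + dual_norm g.
Proof.
apply: ge_sup; first exact: (dual_has_sup (f + g)).1.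
move=> _ [x x1 <-]; apply: le_trans (ler_normD _ _) _.
by apply: lerD; exact: dual_norm_ub.
Qed.

Let dual_norm_ge0 f : 0 <= dual_norm f.
Proof. by apply: le_trans (dual_norm_ub f (x := 0) _); rewrite ?normr0. Qed.

Let dual_normZ_le (a : R) f : dual_norm (a *: f) <= `|a| * dual_norm f.
Proof.
apply: ge_sup; first exact: (dual_has_sup (a *: f)).1.
move=> _ [x x1 <-].
have -> : val (a *: f) x = a * val f x by [].
by rewrite normrM ler_wpM2l// dual_norm_ub.
Qed.

Let dual_normZ (a : R) f : dual_norm (a *: f) = `|a| * dual_norm f.
Proof.
apply/eqP; rewrite eq_le dual_normZ_le/=.
have [->|a0] := eqVneq a 0; first by rewrite normr0 mul0r.
rewrite -[X in dual_norm X](scalerK a0 f).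
apply: le_trans (ler_wpM2l (normr_ge0 a) (dual_normZ_le _ _)) _.
by rewrite normfV mulrA divff ?normr_eq0// mul1r.
Qed.

Let dual_norm0_eq0 f : dual_norm f = 0 -> f = 0.
Proof.
move=> f0; apply/val_inj/funext => x /=.
have linf (a : R) y : val f (a *: y) = a * val f y.
  have := dual_linear f a y 0; rewrite addr0 => ->.
  have := dual_linear f 1 0 0; rewrite !scale1r addr0.
  by move/eqP; rewrite -subr_eq0 opprD addNKr oppr_eq0 => /eqP ->; rewrite addr0.
have [->|x0] := eqVneq x 0; first by rewrite -(scale0r 0) linf mul0r.
have /dual_norm_ub : `| `|x|^-1 *: x| <= 1 by rewrite normfZV.
move=> /(_ f); rewrite f0 normr_le0 linf mulf_eq0 invr_eq0 normr_eq0.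
by rewrite (negPf x0) => /eqP.
Qed.

HB.instance Definition _ := Lmodule_isNormed.Build R dual_space
  dual_normD dual_normZ dual_norm0_eq0.

End dual.


Section extended_norm.
Context {R : realType} {V : lmodType R}.
Local Open Scope ereal_scope.

(* N may take the value +oo; the Banach space it defines is {x | N x < +oo}. *)
Definition extended_norm (N : V -> \bar R) :=
  [/\ forall x, 0 <= N x,
      forall x y, N (x + y)%R <= N x + N y,
      forall (a : R) x, N (a *: x)%R = `|a|%:E * N x &
      forall x, N x = 0 -> x = 0%R].

Definition finite_norm_pred N (hN : extended_norm N) : {pred V} :=
  fun x => N x < +oo.

Definition finite_norm_space N (hN : extended_norm N) := {x : V | finite_norm_pred hN x}.

End extended_norm.

Section finite_space_instances.
Context {R : realType} {V : lmodType R} (N : V -> \bar R)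
  (hN : extended_norm N).

Let finite_submod_closed : submod_closed (finite_norm_pred hN).
Proof.
have [N0 ND NZ _] := hN; split=> [|a x y]; rewrite !unfold_in.
  by rewrite -(scale0r 0) NZ normr0 mul0e.
move=> xoo yoo; apply: le_lt_trans (ND _ _) _.
rewrite lte_add_pinfty// NZ lte_mul_pinfty ?lee_fin//.
Qed.

HB.instance Definition _ :=
  GRing.isSubmodClosed.Build R V (finite_norm_pred hN) finite_submod_closed.
HB.instance Definition _ := SubChoice.on (finite_norm_space hN).
HB.instance Definition _ := [SubChoice_isSubLmodule of finite_norm_space hN by <:].

Let fnorm (x : finite_norm_space hN) : R := fine (N (val x)).

Let fnormE x : (fnorm x)%:E = N (val x).
Proof.
have [N0 _ _ _] := hN; rewrite /fnorm fineK// ge0_fin_numE//.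
exact: (valP x).
Qed.

Let fnormD x y : fnorm (x + y) <= fnorm x + fnorm y.
Proof. have [_ ND _ _] := hN; rewrite -lee_fin EFinD !fnormE; exact: ND. Qed.

Let fnormZ (a : R) x : fnorm (a *: x) = `|a| * fnorm x.
Proof. have [_ _ NZ _] := hN; apply: EFin_inj; rewrite EFinM !fnormE; exact: NZ. Qed.

Let fnorm0_eq0 x : fnorm x = 0 -> x = 0.
Proof.
have [_ _ _ N0] := hN.
move=> x0; apply: val_inj; apply: N0.
by rewrite -fnormE x0.
Qed.

HB.instance Definition _ := Lmodule_isNormed.Build R (finite_norm_space hN)
  fnormD fnormZ fnorm0_eq0.

End finite_space_instances.

Section sequence_spaces.
Context {R : realType}.
Local Open Scope ereal_scope.

Let le_poweR (r : R) (x y : \bar R) : (0 <= r)%R -> 0 <= x -> x <= y ->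
  x `^ r <= y `^ r.
Proof.
move=> r0 x0 xy; apply: gt0_ler_poweR => //; rewrite in_itv/= leey andbT//.
exact: le_trans xy.
Qed.

Let Lnorm_ext (p : R) (p1 : (1 <= p)%R) :
  extended_norm (fun x : nat -> R => 'N[counting]_p%:E[EFin \o x]).
Proof.
have p0 : (0 < p)%R by exact: lt_le_trans p1.
split=> [x|x y|a x|x].
- exact: Lnorm_ge0.
- by apply: eminkowski; rewrite ?lee_fin.
- rewrite !Lnorm_counting//.
  rewrite (@eq_eseriesr _ _ (fun k => (`|a| `^ p)%:E * `|(EFin \o x) k| `^ p)).
    rewrite nneseriesZl; last by move=> *; exact: poweR_ge0.
    rewrite poweRM ?lee_fin ?powR_ge0//; last first.
      by apply: nneseries_ge0 => *; exact: poweR_ge0.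
    by rewrite poweR_EFin -powRrM mulfV ?gt_eqF// powRr1.
  by move=> k _; rewrite -poweR_EFin -poweRM ?lee_fin//= -?EFinM -?normrM.
- rewrite Lnorm_counting// => /poweR_eq0_eq0 sum0; apply/funext => n.
  have xp0 k : 0 <= `|(EFin \o x) k| `^ p by exact: poweR_ge0.
  have : `|(EFin \o x) n| `^ p <= 0.
    rewrite -[leRHS]sum0 ?nneseries_ge0// (nneseriesD1 (n := n))//.
    by rewrite leeDl// nneseries_ge0.
  move=> xn0.
  have /(poweR_eq0_eq0 (abse_ge0 _)) : `|(EFin \o x) n| `^ p = 0.
    by apply/eqP; rewrite eq_le xn0 xp0.
  by move=> [] /normr0_eq0.
Qed.

Definition lp_sum_norm (p : R) (V : normedModType R) (x : nat -> V) : \bar R :=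
  'N[counting]_p%:E[EFin \o (fun n => `|x n|)%R].

Lemma extended_norm_lp_sum (p : R) (V : normedModType R) : (1 <= p)%R ->
  extended_norm (@lp_sum_norm p V).
Proof.
move=> p1; have p0 : (0 < p)%R by exact: lt_le_trans p1.
case: (Lnorm_ext p1) => N0 ND NZ Neq0; split => [x|x y|a x|x].
- exact: N0.
- apply: le_trans (ND (fun n => `|x n|%R) (fun n => `|y n|%R)).
  rewrite /lp_sum_norm !Lnorm_counting//.
  apply: le_poweR; first by rewrite invr_ge0 ltW.
    by apply: nneseries_ge0 => *; exact: poweR_ge0.
  apply: lee_nneseries => [k _ _|k _]; first exact: poweR_ge0.
  apply: le_poweR; rewrite ?(ltW p0) ?lee_fin//=.
  by rewrite [leRHS]ger0_norm ?addr_ge0// normr_id ler_normD.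
- rewrite /lp_sum_norm -(normr_id a) -NZ; apply: eq_Lnorm => n /=.
  by rewrite normrZ.
- move=> /Neq0 x0; apply/funext => n; apply/eqP.
  by rewrite -normr_eq0; have /= -> := congr1 (@^~ n) x0.
Qed.

Definition lp_sum (p : R) (p1 : (1 <= p)%R) (V : normedModType R) :=
  finite_norm_space (extended_norm_lp_sum V p1).

Definition Xpw_norm (p : R) (w x : nat -> R) : \bar R :=
  maxe 'N[counting]_p%:E[EFin \o x]
       'N[counting]_2%:E[EFin \o (fun n => w n * x n)%R].

Lemma extended_norm_Xpw (p : R) (w : nat -> R) : (1 <= p)%R ->
  extended_norm (Xpw_norm p w).
Proof.
move=> p1.
case: (Lnorm_ext p1) => N0 ND NZ Neq0.
case: (Lnorm_ext (ler1n R 2)) => N'0 N'D N'Z N'eq0.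
split => [x|x y|a x|x].
- by rewrite /Xpw_norm le_max N0.
- rewrite /Xpw_norm ge_max; apply/andP; split.
    apply: le_trans (ND _ _) _; apply: leeD; rewrite le_max lexx//.
  have -> : (fun n => w n * (x + y) n)%R =
    ((fun n => w n * x n) + (fun n => w n * y n))%R :> (nat -> R).
    by apply/funext => n /=; rewrite mulrDr.
  by apply: le_trans (N'D _ _) _; apply: leeD; rewrite le_max lexx orbT.
- rewrite /Xpw_norm NZ.
  have -> : (fun n => w n * (a *: x) n)%R =
    (a *: (fun n => w n * x n : R))%R :> (nat -> R).
    by apply/funext => n /=; rewrite mulrCA.
  by rewrite N'Z maxeMr.
- move=> x0; apply: Neq0; apply/eqP; rewrite eq_le N0 andbT -x0.
  by rewrite /Xpw_norm le_max lexx.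
Qed.

Definition Xpw (p : R) (p1 : (1 <= p)%R) (w : nat -> R) :=
  finite_norm_space (extended_norm_Xpw w p1).

End sequence_spaces.

Lemma ereal_ge1 {R : realType} (p : R) : 1 <= p -> (1 <= p%:E)%E.
Proof. by rewrite lee_fin. Qed.

Section Lp.
Context d {T : measurableType d} {R : realType}.
Variables (mu : {measure set T -> \bar R}) (p : R) (p1 : 1 <= p).
Local Notation Lfun := (LfunType mu (ereal_ge1 p1)).
Local Open Scope quotient_scope.

(* Lp is the quotient of the p-integrable functions by the a.e. null ones. *)
Definition ae_zero : {pred Lfun} :=
  fun f => `[< f = cst 0 %[ae mu] >].

Let ae_zero_submod_closed : submod_closed ae_zero.
Proof.
split; first by apply/asboolP; apply: nearW => x _.
move=> a f g /asboolP f0 /asboolP g0; apply/asboolP.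
move: f0 g0; apply: filterS2 => x fx gx _.
by rewrite -[LHS]/(a * f x + g x) fx// gx// addr0 mulr0.
Qed.

HB.instance Definition _ :=
  GRing.isSubmodClosed.Build R _ ae_zero ae_zero_submod_closed.

Definition Lp := Quotient.quot ae_zero.
HB.instance Definition _ := GRing.Zmodule.on Lp.
HB.instance Definition _ := EqQuotient.on Lp.

Definition Lp_class (f : Lfun) : Lp := \pi_Lp f.

Lemma Lp_classP f g : Lp_class f = Lp_class g <-> f - g \in ae_zero.
Proof. by rewrite Quotient.idealrBE; split => /eqP. Qed.

Lemma Lp_classB f g : Lp_class (f - g) = Lp_class f - Lp_class g.
Proof. by rewrite /Lp_class !piE. Qed.

Definition Lp_scale (a : R) (x : Lp) : Lp := Lp_class (a *: repr x).

Lemma Lp_scaleE a f : Lp_scale a (Lp_class f) = Lp_class (a *: f).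
Proof.
apply/Lp_classP; rewrite -scalerBr rpredZ//.
by apply/Lp_classP; rewrite /Lp_class reprK.
Qed.

Lemma Lp_classD f g : Lp_class (f + g) = Lp_class f + Lp_class g.
Proof. by rewrite /Lp_class !piE. Qed.

Lemma Lp_class_repr x : Lp_class (repr x) = x.
Proof. exact: reprK. Qed.

Let scaleA a b x : Lp_scale a (Lp_scale b x) = Lp_scale (a * b) x.
Proof. by rewrite -[x]Lp_class_repr !Lp_scaleE scalerA. Qed.

Let scale1 : left_id 1 Lp_scale.
Proof. by move=> x; rewrite -[x]Lp_class_repr Lp_scaleE scale1r. Qed.

Let scaleDr : right_distributive Lp_scale +%R.
Proof.
move=> a x y; rewrite -[x]Lp_class_repr -[y]Lp_class_repr.
by rewrite -Lp_classD !Lp_scaleE -Lp_classD scalerDr.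
Qed.

Let scaleDl x : {morph Lp_scale^~ x : a b / a + b}.
Proof.
move=> a b; rewrite -[x]Lp_class_repr !Lp_scaleE.
by rewrite -Lp_classD scalerDl.
Qed.

HB.instance Definition _ := GRing.Zmodule_isLmodule.Build R Lp
  scaleA scale1 scaleDr scaleDl.

Definition Lp_norm (x : Lp) : R := fine 'N[mu]_p%:E[EFin \o repr x]%E.

Lemma Lnorm_ae_zero f : f \in ae_zero -> 'N[mu]_p%:E[EFin \o f]%E = 0%E.
Proof.
move=> /asboolP f0; rewrite unlock /Lnorm.
rewrite (ae_eq_integral (cst 0%E))//.
- by rewrite integral0 poweR0r// invr_neq0// gt_eqF// (lt_le_trans ltr01).
- apply/measurable_EFinP => /=.
  apply: (@measurableT_comp _ _ _ _ _ _ (@powR R ^~ p)) => //.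
  exact: measurableT_comp.
- apply: filterS f0 => x /= /(_ I) -> _.
  by rewrite normr0 powR0// gt_eqF// (lt_le_trans ltr01).
Qed.

Lemma Lp_normE f : Lp_norm (Lp_class f) = fine 'N[mu]_p%:E[EFin \o f]%E.
Proof.
rewrite /Lp_norm.
pose nm (f : Lfun) := fine 'N[mu]_p%:E[EFin \o f]%E.
have h f1 f2 : Lp_class f1 = Lp_class f2 -> nm f1 <= nm f2.
  move=> /Lp_classP f12; rewrite -[in leLHS](subrK f2 f1).
  apply: le_trans (ler_LnormD _ _) _.
  by rewrite (Lnorm_ae_zero f12) add0r.
by apply/eqP; rewrite eq_le; apply/andP; split; apply: h; rewrite Lp_class_repr.
Qed.

Let Lp_normD x y : Lp_norm (x + y) <= Lp_norm x + Lp_norm y.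
Proof.
rewrite -[x]Lp_class_repr -[y]Lp_class_repr -Lp_classD !Lp_normE.
exact: ler_LnormD.
Qed.

Let Lp_normZ (a : R) x : Lp_norm (a *: x) = `|a| * Lp_norm x.
Proof.
rewrite -[x]Lp_class_repr [a *: _]Lp_scaleE !Lp_normE.
by apply: EFin_inj; rewrite EFinM !finite_norm_fine LnormZ.
Qed.

Let Lp_norm0_eq0 x : Lp_norm x = 0 -> x = 0.
Proof.
rewrite -[x]Lp_class_repr Lp_normE => /fine_Lnormr_eq0 x0.
rewrite -(subrr (Lp_class 0)) -Lp_classB; apply/Lp_classP; rewrite !subr0.
exact/asboolP.
Qed.

HB.instance Definition _ := Lmodule_isNormed.Build R Lp
  Lp_normD Lp_normZ Lp_norm0_eq0.

End Lp.

Section cube.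
Variable R : realType.

Definition unit_interval := {x : R | 0 <= x <= 1}.

Let zero_in : 0 <= (0 : R) <= 1. Proof. by rewrite lexx ler01. Qed.

HB.instance Definition _ := SubChoice.on unit_interval.
HB.instance Definition _ := isPointed.Build unit_interval (Sub 0 zero_in).
HB.instance Definition _ := Measurable.copy unit_interval
  (g_sigma_algebra_preimageType (val : unit_interval -> measurableTypeR R)).

Definition cube := nat -> unit_interval.

HB.instance Definition _ := Pointed.on cube.

Definition cylinders : set (set cube) :=
  [set C | exists i (A : set unit_interval),
     measurable A /\ C = [set x | A (x i)]].

HB.instance Definition _ := Measurable.copy cube (g_sigma_algebraType cylinders).

(* The values on finite-dimensional measurable boxes determine P, so P is the
   product Lebesgue measure on the cube. *)
Definition product_lebesgue (P : probability cube R) :=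
  forall n (A : nat -> set unit_interval), (forall i, measurable (A i)) ->
  P [set x | forall i, (i < n)%N -> A i (x i)] =
  (\prod_(i < n) lebesgue_measure [set val t | t in A i])%E.

End cube.

Section generators.
Context {R : realType}.

Definition rademacher (n : nat) (t : R) : R := Num.sg (sin (2 ^+ n * pi * t)).

Definition dilate (p k : R) (f : R -> R) (s : R) : R :=
  if 0 <= s <= k then k `^ (- p^-1) * f (s / k) else 0.

Definition weight_power (p : R) (w : nat -> R) (i : nat) : R :=
  w i `^ (2 * p / (p - 2)).

(* The Rademacher functions r_1, r_2, ... are indexed from 1 (r_0 would be 1
   almost everywhere), whence the shift n.+1; the shift of i is immaterial. *)
Definition generator (p : R) (w : nat -> R) (i n : nat) (x : cube R) : R :=
  dilate p (weight_power p w i) (rademacher n.+1) (val (x i)).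

Lemma measurable_val : measurable_fun setT (val : unit_interval R -> R).
Proof. by move=> _ B mB; exists B. Qed.

Lemma measurable_coord i : measurable_fun setT (fun x : cube R => x i).
Proof.
by move=> _ B mB; rewrite setTI; apply: sub_sigma_algebra; exists i, B.
Qed.

Lemma measurable_rademacher n : measurable_fun setT (rademacher n).
Proof.
apply: (@measurableT_comp _ _ _ _ _ _ (@Num.sg R)).
  apply: measurable_fun_ifT; first exact: measurable_fun_eqr.
    exact: measurable_cst.
  apply: measurable_fun_ifT; first exact: measurable_fun_ltr.
    exact: measurable_cst.
  exact: measurable_cst.
apply: (@measurableT_comp _ _ _ _ _ _ sin).
  by apply: continuous_measurable_fun; exact: continuous_sin.
exact: measurable_funM.
Qed.

Lemma measurable_dilate p k f : measurable_fun setT f ->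
  measurable_fun setT (dilate p k f).
Proof.
move=> mf; apply: measurable_fun_ifT.
- by apply: measurable_and; exact: measurable_fun_ler.
- apply: measurable_funM => //.
  apply: (@measurableT_comp _ _ _ _ _ _ f) => //.
  exact: measurable_funM.
- exact: measurable_cst.
Qed.

Lemma measurable_generator p w i n : measurable_fun setT (generator p w i n).
Proof.
apply: (@measurableT_comp _ _ _ _ _ _
  (dilate p (weight_power p w i) (rademacher n.+1))).
  by apply: measurable_dilate; exact: measurable_rademacher.
apply: (@measurableT_comp _ _ _ _ _ _ (val : unit_interval R -> R)).
  exact: measurable_val.
exact: measurable_coord.
Qed.

Lemma generator_bounded p w i n x :
  `|generator p w i n x| <= weight_power p w i `^ (- p^-1).
Proof.
rewrite /generator /dilate; case: ifP => _; last by rewrite normr0 powR_ge0.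
rewrite normrM ger0_norm ?powR_ge0// ler_piMr ?powR_ge0//.
by rewrite normr_sg lern1 leq_b1.
Qed.

Lemma generator_Lfun (P : probability (cube R) R) (p q : R) w i n : 1 <= q ->
  generator p w i n \in Lfun P q%:E.
Proof.
move=> q1; have q0 : 0 < q by exact: lt_le_trans q1.
have mg := measurable_generator p w i n.
apply/andP; split; rewrite inE //=.
apply: (@lty_poweRy _ _ q); first by rewrite gt_eqF.
rewrite poweR_Lnorm ?gt_eqF//.
set c := weight_power p w i `^ (- p^-1).
apply: (@le_lt_trans _ _ (\int[P]_x ((c `^ q)%:E))%E).
  apply: ge0_le_integral => //.
  - by move=> x _; exact: poweR_ge0.
  - apply/measurable_EFinP.
    apply: (@measurableT_comp _ _ _ _ _ _ (@powR R ^~ q)) => //.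
    exact: measurableT_comp.
  - move=> x _; rewrite lee_fin; apply: ge0_ler_powR.
    + exact: ltW.
    + by rewrite nnegrE normr_ge0.
    + by rewrite nnegrE powR_ge0.
    + exact: generator_bounded.
rewrite integral_cst// lte_mul_pinfty ?lee_fin ?powR_ge0//.
by rewrite (le_lt_trans (probability_le1 P measurableT))// ltry.
Qed.

End generators.

Section spaces.
Context {R : realType}.

Definition conjugate (p : R) : R := p / (p - 1).

Lemma conjugate_gt1 (p : R) : 1 < p -> 1 < conjugate p.
Proof. by move=> p1; rewrite ltr_pdivlMr ?subr_gt0// mul1r ltrBlDr ltrDl ltr01. Qed.

Definition exponent_ge2 (p : R) : R := if p < 2 then conjugate p else p.

Definition condition_star (p : R) (w : nat -> R) := forall e : R, 0 < e ->
  (\sum_(0 <= n <oo | (w n < e)%R) (weight_power p w n)%:E = +oo)%E.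

Definition generator_class (P : probability (cube R) R) (p : R) (p1 : 1 <= p)
    (w : nat -> R) (i n : nat) : Lp P p1 :=
  Lp_class (Lfun_Sub (ereal_ge1 p1) (generator_Lfun P p w i n p1)).

Definition Dpw (P : probability (cube R) R) (p : R) (p1 : 1 <= p)
    (w : nat -> R) :=
  closed_span [set y | exists i n, y = generator_class P p1 w i n].

(* For 1 < p < 2 these are the duals of the spaces of the conjugate exponent;
   the value at p = 2 is irrelevant. *)
Definition X_space (p : R) (p1 : 1 < p) (w : nat -> R) : normedModType R :=
  if p < 2 then (dual_space (Xpw (ltW (conjugate_gt1 p1)) w) : normedModType R)
  else (Xpw (ltW p1) w : normedModType R).

Definition D_space (P : probability (cube R) R) (p : R) (p1 : 1 < p)
    (w : nat -> R) : normedModType R :=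
  if p < 2 then (dual_space (Dpw P (ltW (conjugate_gt1 p1)) w) : normedModType R)
  else (Dpw P (ltW p1) w : normedModType R).


End spaces.

Definition ell2 (R : realType) : normedModType R := lp_sum (ler1n R 2) R^o.

(* Main.v *)
(* For p > 2 the coordinates of the cube are independent and each generator is
   symmetric, so by the inequalities of Khintchine and Rosenthal the norm of
   sum a_in y_in in L^p is equivalent to
     max ((sum_i |a_i|^p)^(1/p), (sum_i w_i^2 |a_i|^2)^(1/2)),
   where |a_i| is the l2 norm of (a_in)_n. Integration against the y_in projects
   onto the closed span in this norm, so the l2-valued version of X_p with weight
   w is a retract of D_p. By (star), w has disjoint blocks which realise any
   prescribed positive weights u, up to constants and complementably: in place
   of w one may take weights that are summable on the even indices and equal to
   v on the odd ones. The even part is then the l^p sum of copies of l2, and the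
   first coordinates of the odd part form X_p with weight v. The case p < 2
   follows by duality. *)
Require Import Defs.
From HB Require Import structures.
From mathcomp Require Import all_boot all_order all_algebra.
From mathcomp Require Import generic_quotient.
From mathcomp Require Import all_classical all_reals all_analysis.
From mathcomp Require Import measurable_realfun.
From mathcomp Require Import ring lra.
Import Order.TTheory GRing.Theory Num.Theory.
Import numFieldNormedType.Exports.
Local Open Scope classical_set_scope.
Local Open Scope ring_scope.

Set Implicit Arguments.
Unset Strict Implicit.
Unset Printing Implicit Defensive.

(** * Inequalities for real powers *)

(** All steps are phrased with retracts, that is, bounded linear J and K with K J = id. They compose
    and pass to products and duals, so no space has to be identified up to isomorphism; for p < 2 it
    suffices that l^p(l2) is a retract of the dual of l^q(l2), q conjugate to p. J sums a series of
    generators, which takes the upper Rosenthal bound and completeness of the closed span. K reads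
    off coefficients; the lower bounds control it on the closed span itself, so no projection of the
    whole of L^p is constructed. The moment inequalities come from removing one summand at a time: a
    measure preserving map of the cube flips that summand and fixes the remaining ones, so that
    two-point inequalities for |a + b|^p + |a - b|^p can be integrated. A half-period shift of one
    coordinate serves for a single generator, a reflection for all generators of a coordinate. The
    exponent in k_i = w_i^(2p/(p-2)) gives k_i^(1-2/p) = w_i^2. Hence a generator has p-th moment 1
    and second moment w_i^2, and merging weights into a block adds up their k_i. *)

Section powers.
Context {R : realType}.
Implicit Types a b x y r p : R.

Lemma ge0_lerP r x y : 0 <= r -> 0 <= x -> x <= y -> x `^ r <= y `^ r.
Proof.
move=> r0 x0 xy; apply: ge0_ler_powR => //; rewrite nnegrE//; exact: le_trans xy.
Qed.

Lemma powR_sqr x r : (x ^+ 2) `^ (r / 2) = `|x| `^ r.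
Proof.
by rewrite -real_normK ?num_real// -powR_mulrn// -powRrM mulrCA divff ?mulr1.
Qed.

(** Young's inequality for x and y^(r-1) with exponents r and r/(r-1). This tangent line replaces
    derivatives and convexity in every later estimate on powers. *)
Lemma powR_tangent r x y : 1 <= r -> 0 <= x -> 0 <= y ->
  y `^ r + r * y `^ (r - 1) * (x - y) <= x `^ r.
Proof.
rewrite le_eqVlt => /predU1P[<- x0 y0|r1 x0 y0].
  by rewrite subrr powRr0 !powRr1// !mul1r addrC subrK.
have r0 : 0 < r by lra.
have r10 : 0 < r - 1 by lra.
have q0 : 0 < r / (r - 1) by rewrite divr_gt0.
have := @conjugate_powR _ x (y `^ (r - 1)) r (r / (r - 1)) x0 (powR_ge0 _ _)
  r0 q0.
rewrite -powRrM mulrCA divff ?gt_eqF// mulr1 invf_div.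
have -> : r^-1 + (r - 1) / r = 1 by field; rewrite gt_eqF.
move=> /(_ erefl) h.
have : r * (x * y `^ (r - 1)) <= x `^ r + (r - 1) * y `^ r.
  have -> : x `^ r + (r - 1) * y `^ r =
    r * (x `^ r / r + y `^ r * ((r - 1) / r)) by field; rewrite gt_eqF.
  by rewrite ler_pM2l.
have := mulr_powRB1 y0 r0.
set A := y `^ (r - 1); set B := y `^ r; set X := x `^ r => e.
rewrite -e; lra.
Qed.

(** The tangent at the mean m is averaged with weights q; its linear term vanishes. *)
Lemma powR_jensen r (I : eqType) (s : seq I) (q t : I -> R) : 1 <= r ->
  (forall i, i \in s -> 0 <= q i) -> (forall i, i \in s -> 0 <= t i) ->
  \sum_(i <- s) q i = 1 ->
  (\sum_(i <- s) q i * t i) `^ r <= \sum_(i <- s) q i * t i `^ r.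
Proof.
move=> r1 q0 t0 q1; set m := \sum_(i <- s) _.
have m0 : 0 <= m by rewrite /m big_seq; apply: sumr_ge0 => i si; rewrite mulr_ge0 ?q0 ?t0.
have -> : m `^ r =
    \sum_(i <- s) q i * (m `^ r + r * m `^ (r - 1) * (t i - m)).
  under eq_bigr => i _ do rewrite mulrDr mulrCA mulrBr.
  rewrite big_split/= -mulr_suml q1 mul1r -mulr_sumr big_split/= -/m.
  by rewrite sumrN -mulr_suml q1 mul1r subrr mulr0 addr0.
rewrite big_seq [leRHS]big_seq; apply: ler_sum => i si.
by rewrite ler_wpM2l ?q0// powR_tangent ?t0.
Qed.

(** Write x^r as x * x^(r-1) and enlarge the second factor to (x + y)^(r-1). *)
Lemma powR_superadditive r x y : 1 <= r -> 0 <= x -> 0 <= y ->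
  x `^ r + y `^ r <= (x + y) `^ r.
Proof.
move=> r1 x0 y0; have r0 : 0 < r by lra.
rewrite -!(@mulr_powRB1 _ _ r) ?addr_ge0// mulrDl.
by apply: lerD; rewrite ler_wpM2l// ge0_lerP ?subr_ge0// ?lerDl ?lerDr.
Qed.

(** With r = p/2 and m = a^2 + b^2 one has (a ± b)^2 = m ± 2ab. The tangents of t^r at m add up to 2
    m^r, and superadditivity splits m^r. *)
Lemma parallelogram_ge p a b : 2 <= p ->
  2 * `|a| `^ p + 2 * `|b| `^ p <= `|a + b| `^ p + `|a - b| `^ p.
Proof.
move=> p2; rewrite -!powR_sqr.
have r1 : 1 <= p / 2 by lra.
set r := p / 2 in r1 *; set m := a ^+ 2 + b ^+ 2.
have m0 : 0 <= m by rewrite addr_ge0 ?sqr_ge0.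
have := powR_superadditive r1 (sqr_ge0 a) (sqr_ge0 b); rewrite -/m.
have := powR_tangent r1 (sqr_ge0 (a + b)) m0.
have := powR_tangent r1 (sqr_ge0 (a - b)) m0.
have -> : (a + b) ^+ 2 - m = 2 * a * b by rewrite /m; ring.
have -> : (a - b) ^+ 2 - m = - (2 * a * b) by rewrite /m; ring.
rewrite mulrN; lra.
Qed.

(** The first summand serves the case |a| < |b|, where both powers are at most (2|b|)^p; the second
    bounds the second difference of t^p when |b| <= |a|. *)
Definition step_const p : R := 2 * 2 `^ p + 2 * p * (p - 1) * 2 `^ (p - 2).

Lemma step_const_ge0 p : 2 <= p -> 0 <= step_const p.
Proof.
move=> p2; rewrite addr_ge0// ?mulr_ge0 ?powR_ge0//; lra.
Qed.

(** For b <= a, the tangents of t^p at a + b and a - b reduce the second difference to a difference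
    of (p-1)-th powers. The tangent of t^(p-1) at a + b bounds that in turn, and a + b <= 2a removes
    the sum. *)
Let parallelogram_le_ge0 p a b : 2 <= p -> 0 <= a -> 0 <= b ->
  (a + b) `^ p + `|a - b| `^ p <=
  2 * a `^ p + step_const p * (a `^ (p - 2) * b ^+ 2 + b `^ p).
Proof.
move=> p2 a0 b0.
have p0 : 0 < p by lra.
have c2 : 0 <= 2 * p * (p - 1) * 2 `^ (p - 2).
  by rewrite !mulr_ge0 ?powR_ge0//; lra.
have [ba|ab] := leP b a; last first.
  have h x : 0 <= x -> x <= 2 * b -> x `^ p <= 2 `^ p * b `^ p.
    by move=> x0 x2; rewrite -powRM//; apply: ge0_lerP; lra.
  have h1 : (a + b) `^ p <= 2 `^ p * b `^ p by apply: h; lra.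
  have h2 : `|a - b| `^ p <= 2 `^ p * b `^ p.
    by apply: h => //; rewrite ler_norml; lra.
  apply: (@le_trans _ _ (2 * 2 `^ p * b `^ p)); first lra.
  rewrite /step_const; set A := 2 * 2 `^ p; set B := 2 * p * (p - 1) * _.
  have A0 : 0 <= A by rewrite mulr_ge0 ?powR_ge0.
  have B0 : 0 <= B by [].
  have := mulr_ge0 A0 (mulr_ge0 (powR_ge0 a (p - 2)) (sqr_ge0 b)).
  have := mulr_ge0 B0 (mulr_ge0 (powR_ge0 a (p - 2)) (sqr_ge0 b)).
  have := mulr_ge0 B0 (powR_ge0 b p).
  have := powR_ge0 a p.
  set x := b `^ p; set y := a `^ _ * _; set z := a `^ p => *.
  rewrite !mulrDl !mulrDr; lra.
rewrite ger0_norm ?subr_ge0//.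
have p1 : 1 <= p by lra.
have p11 : 1 <= p - 1 by lra.
have h1 := powR_tangent p1 a0 (addr_ge0 a0 b0).
have h2 : 0 <= a - b by rewrite subr_ge0.
have h3 := powR_tangent p1 a0 h2.
have h4 := powR_tangent p11 h2 (addr_ge0 a0 b0).
rewrite (_ : p - 1 - 1 = p - 2) in h4; last by ring.
have h5 : (a + b) `^ (p - 2) <= 2 `^ (p - 2) * a `^ (p - 2).
  by rewrite -powRM//; apply: ge0_lerP; lra.
have e1 : (a + b) `^ p + (a - b) `^ p - 2 * a `^ p <=
    p * b * ((a + b) `^ (p - 1) - (a - b) `^ (p - 1)).
  move: h1 h3; set A := (a + b) `^ p; set B := (a - b) `^ p.
  set A1 := (a + b) `^ (p - 1); set B1 := (a - b) `^ (p - 1).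
  have -> : a - (a + b) = - b by ring.
  have -> : a - (a - b) = b by ring.
  by move=> h1 h3; lra.
have e2 : (a + b) `^ (p - 1) - (a - b) `^ (p - 1) <=
    (p - 1) * (2 `^ (p - 2) * a `^ (p - 2)) * (2 * b).
  apply: (@le_trans _ _ ((p - 1) * (a + b) `^ (p - 2) * (2 * b))).
    move: h4; have -> : a - b - (a + b) = - (2 * b) by ring.
    by move=> h4; lra.
  by rewrite ler_wpM2r ?ler_wpM2l//; lra.
have e3 : (a + b) `^ p + (a - b) `^ p - 2 * a `^ p <=
    2 * p * (p - 1) * 2 `^ (p - 2) * (a `^ (p - 2) * b ^+ 2).
  apply: le_trans e1 _.
  apply: le_trans (_ : _ <= p * b * ((p - 1) * (2 `^ (p - 2) * a `^ (p - 2)) * (2 * b))) _.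
    by rewrite ler_wpM2l ?mulr_ge0// ltW.
  by rewrite le_eqVlt; apply/orP; left; apply/eqP; ring.
rewrite /step_const.
have g1 : 0 <= 2 * 2 `^ p * (a `^ (p - 2) * b ^+ 2 + b `^ p).
  by rewrite !(mulr_ge0, addr_ge0, powR_ge0, sqr_ge0).
have g2 : 0 <= 2 * p * (p - 1) * 2 `^ (p - 2) * b `^ p.
  by rewrite mulr_ge0 ?powR_ge0.
move: e3 g1 g2; set u := 2 * 2 `^ p; set c := 2 * p * (p - 1) * _.
set y := a `^ _ * _; set z := b `^ p => *.
rewrite (mulrDl u c) (mulrDr c); lra.
Qed.

Lemma parallelogram_le p a b : 2 <= p ->
  `|a + b| `^ p + `|a - b| `^ p <=
  2 * `|a| `^ p + step_const p * (`|a| `^ (p - 2) * b ^+ 2 + `|b| `^ p).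
Proof.
move=> p2; rewrite -(real_normK (num_real b)).
apply: le_trans (@parallelogram_le_ge0 p `|a| `|b| p2 _ _) => //.
(* Passing to absolute values keeps or exchanges the two terms on the left, according to the signs
   of a and b. *)
have [[-> ->]|[-> ->]] : (`|a + b| = `|a| + `|b| /\ `|a - b| = `| `|a| - `|b| |) \/
    (`|a + b| = `| `|a| - `|b| | /\ `|a - b| = `|a| + `|b|).
  have [a0|a0] := ger0P a; have [b0|b0] := ger0P b; [left|right|right|left];
    split; repeat (match goal with |- context [`|?x|] => case: (ger0P x) => ? end); lra.
- by [].
- by rewrite addrC.
Qed.

(** Either the term with B is at most M/2 and is absorbed on the left, or M^(2/p) < 2B. *)
Lemma absorb_le p M A B : 2 < p -> 0 <= M -> 0 <= A -> 0 <= B ->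
  M <= B * M `^ ((p - 2) / p) + A -> M <= 2 * A + (2 * B) `^ (p / 2).
Proof.
move=> p2 M0 A0 B0 h.
have p0 : 0 < p by lra.
have [MB|MB] := leP (B * M `^ ((p - 2) / p)) (M / 2).
  have := powR_ge0 (2 * B) (p / 2); lra.
have M1 : 0 < M.
  rewrite lt_neqAle M0 andbT eq_sym; apply/eqP => M00.
  move: MB; rewrite M00 powR0 ?mulr0 ?mul0r ?ltxx// mulf_neq0 ?invr_eq0 ?gt_eqF//.
  lra.
suff MB2 : M <= (2 * B) `^ (p / 2) by lra.
have -> : M = (M `^ (2 / p)) `^ (p / 2).
  rewrite -powRrM (_ : 2 / p * (p / 2) = 1) ?powRr1//; field; lra.
apply: ge0_lerP; rewrite ?powR_ge0//; first lra.
have -> : 2 / p = 1 - (p - 2) / p by field; lra.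
rewrite powRB ?(gt_eqF M1) ?implybT// powRr1//.
by rewrite ler_pdivrMr ?powR_gt0//; lra.
Qed.

End powers.

(** * The product measure on the cube *)

Section cube_measure.
Context {R : realType}.

Definition box n (A : nat -> set (unit_interval R)) : set (cube R) :=
  [set x | forall i, (i < n)%N -> A i (x i)].

Lemma measurable_box n A : (forall i, measurable (A i)) -> measurable (box n A).
Proof.
move=> mA; rewrite (_ : box n A =
    \bigcap_(i in [set i | (i < n)%N]) [set x | A i (x i)]); last first.
  by apply/seteqP; split => x /=.
apply: bigcap_measurableType.
move=> i /= _; rewrite -[X in measurable X]setTI.
exact: (@measurable_coord R i measurableT).
Qed.

(** Boxes are stable under intersection, as full sides may be added to reach a common length, and
    every cylinder is a box; so uniqueness on a generating pi-system applies. *)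
Lemma cube_measure_unique (m1 m2 : {measure set (cube R) -> \bar R}) :
  (m1 setT < +oo)%E ->
  (forall n A, (forall i, measurable (A i)) -> m1 (box n A) = m2 (box n A)) ->
  forall E, measurable E -> m1 E = m2 E.
Proof.
move=> m1T m12 E mE.
pose G : set (set (cube R)) :=
  [set C | exists n A, (forall i, measurable (A i)) /\ C = box n A].
have mG : G `<=` measurable by move=> _ [n [A [mA ->]]]; exact: measurable_box.
have GT : G setT.
  by exists 0%N, (fun=> setT); split=> //; apply/seteqP; split => x.
apply: (@g_sigma_algebra_measure_unique _ R _ G mG (fun=> setT)) => //.
- by rewrite bigcup_const//; exists 0%N.
- move=> _ _ [n [A [mA ->]]] [m [B [mB ->]]].
  exists (maxn n m), (fun i => (if (i < n)%N then A i else setT) `&`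
    (if (i < m)%N then B i else setT)); split.
    by move=> i; apply: measurableI; case: ifP.
  apply/seteqP; split => x /=.
    by move=> [xA xB] i _; split; case: ifPn => // im; [exact: xA|exact: xB].
  move=> xAB; split => i im.
    have /xAB[] : (i < maxn n m)%N by rewrite leq_max im.
    by rewrite im.
  have /xAB[] : (i < maxn n m)%N by rewrite leq_max im orbT.
  by rewrite im.
- by move=> _ [n [A [mA ->]]]; exact: m12.
- apply: (sub_sigma_algebra2 (M := @cylinders R)) mE => _ [i [A [mA ->]]].
  exists i.+1, (fun j => if j == i then A else setT); split.
    by move=> j; case: ifP.
  apply/seteqP; split => x /=.
    by move=> Ax j _; case: eqP => // ->.
  by move=> /(_ i (ltnSn _)); rewrite eqxx.
Qed.

Lemma measurable_cube d (T : measurableType d) (f : T -> cube R) :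
  (forall i, measurable_fun setT (fun t => f t i)) -> measurable_fun setT f.
Proof.
move=> mf; apply: (@measurability _ _ _ _ _ _ (@cylinders R)) => //.
move=> _ [_ [i [A [mA ->]]] <-].
by apply: mf.
Qed.

End cube_measure.

Section interval_measure.
Context {R : realType}.
Notation mu := (@lebesgue_measure R).

Lemma measurable_translate (c : R) (A : set R) : measurable A ->
  measurable [set x | A (x + c)].
Proof.
move=> mA; have mh : measurable_fun setT (fun x : R => x + c).
  exact: measurable_funD.
by rewrite -[X in measurable X]setTI; exact: mh.
Qed.

Lemma lebesgue_measure_translate (c : R) (A : set R) : measurable A ->
  mu [set x | A (x + c)] = mu A.
Proof.
move=> mA.
pose h : measurableTypeR R -> measurableTypeR R := fun x => x + c.
have mh : measurable_fun setT h by exact: measurable_funD.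
rewrite -[LHS]/(pushforward mu h A).
apply/esym/lebesgue_measure_unique => //= _ [[a b]] _ <-.
rewrite /pushforward/=.
have -> : h @^-1` `]a, b] = [set` `](a - c), (b - c)]].
  apply/seteqP; split => x /=; rewrite /h !in_itv/= => /andP[ax xb].
    by rewrite ltrBlDr lerBrDr ax.
  by rewrite -ltrBlDr -lerBrDr ax.
by rewrite !lebesgue_measure_itv/= !lte_fin ltrD2r; case: ifP => // _; rewrite -!EFinB; congr EFin; ring.
Qed.

Lemma lebesgue_measure_reflect (c : R) (A : set R) : measurable A ->
  mu [set x | A (c - x)] = mu A.
Proof.
move=> mA.
have mB := measurable_translate c mA.
rewrite -[RHS](lebesgue_measure_translate c mA) -(lebesgue_measureN mB).
by congr (mu _); apply/seteqP; split => x /=; rewrite addrC.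
Qed.

Definition unit_val (t : unit_interval R) : R := val t.

Lemma unit_val_itv t : 0 <= unit_val t <= 1.
Proof. exact: (valP t). Qed.

Definition unit_measure (A : set (unit_interval R)) := mu [set val t | t in A].

Lemma measurable_unitP (A : set (unit_interval R)) : measurable A ->
  exists2 B : set R, measurable B & A = val @^-1` B.
Proof. by move=> [B mB <-]; exists B => //; rewrite setTI. Qed.

Lemma unit_measureE (B : set R) : unit_measure (val @^-1` B) = mu (`[0, 1] `&` B).
Proof.
congr (mu _); apply/seteqP; split => [_ [t Bt <-]|x [/=]].
  by split => //=; rewrite in_itv/=; exact: (valP t).
by rewrite in_itv/= => x01 Bx; exists (exist _ x x01).
Qed.

Lemma unit_measureT : unit_measure setT = 1%E.
Proof.
rewrite -(preimage_setT val) unit_measureE setIT lebesgue_measure_itv/=.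
by rewrite lte_fin ltr01 -EFinB subr0.
Qed.

Lemma unit_measure0 : unit_measure set0 = 0%E.
Proof. by rewrite /unit_measure image_set0 measure0. Qed.

Definition unit_preserving (g : unit_interval R -> unit_interval R) :=
  measurable_fun setT g /\
  forall A, measurable A -> unit_measure (g @^-1` A) = unit_measure A.

(** Lets the two symmetries of the unit interval be given by real formulas and checked against
    Lebesgue measure on the line. *)
Lemma unit_preserving_lift (h : R -> R) : measurable_fun setT h ->
  (forall x, 0 <= x <= 1 -> 0 <= h x <= 1) ->
  (forall B, measurable B -> mu (`[0, 1] `&` h @^-1` B) = mu (`[0, 1] `&` B)) ->
  exists2 g, unit_preserving g & forall t, unit_val (g t) = h (unit_val t).
Proof.
move=> mh h01 hmu.
pose g (t : unit_interval R) : unit_interval R := exist _ (h (val t)) (h01 _ (valP t)).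
exists g => //; split.
  move=> _ _ [B mB <-]; rewrite !setTI.
  exists (h @^-1` B); last by rewrite setTI.
  by rewrite -[X in measurable X]setTI; exact: mh.
move=> _ /measurable_unitP[B mB ->].
rewrite (_ : g @^-1` _ = val @^-1` (h @^-1` B)); last by apply/seteqP; split.
by rewrite !unit_measureE hmu.
Qed.

(** A preimage splits at k into a reflected piece and an unchanged one. The generators of a
    coordinate live on an initial segment [0, k], which this map turns round. *)
Lemma reflection (k : R) : 0 <= k <= 1 -> exists2 g, unit_preserving g &
  forall t, unit_val (g t) = if unit_val t <= k then k - unit_val t
    else unit_val t.
Proof.
move=> k01; apply: (@unit_preserving_lift (fun x => if x <= k then k - x else x)).
- apply: measurable_fun_ifT => //; first exact: measurable_fun_ler.
  exact: measurable_funB.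
- by move=> x; case: ifPn; lra.
move=> B mB.
have mI : measurable (`[0, k] `&` B : set R) by exact: measurableI.
have e (X : set R) : `[0, 1] `&` X = (`[0, k] `&` X) `|` (`]k, 1] `&` X).
  rewrite -setIUl; congr (_ `&` _); apply/seteqP; split => x /=; rewrite !in_itv/=.
    by move=> ?; case: (leP x k) => ?; [left|right]; lra.
  by move=> []; lra.
have disj (X Y : set R) : (`[0, k] `&` X) `&` (`]k, 1] `&` Y) = set0.
  by apply/seteqP; split => x //= [] [+ _] [+ _]; rewrite !in_itv/=; lra.
rewrite !e (_ : `[0, k] `&` _ = [set x | (`[0, k] `&` B) (k - x)]); last first.
  apply/seteqP; split => x /=; rewrite !in_itv/=.
    by move=> [x0k]; case: ifPn => ?; [split => //|]; lra.
  by move=> [? ?]; case: ifPn => ?; [split => //|]; lra.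
rewrite (_ : `]k, 1] `&` _ = `]k, 1] `&` B); last first.
  apply/seteqP; split => x /=; rewrite !in_itv/= => -[?]; case: ifPn => ? ?;
  by [split => //|lra].
have mI' : measurable [set x | (`[0, k] `&` B) (k - x)].
  have mh : measurable_fun setT (fun x : R => k - x) by exact: measurable_funB.
  by rewrite -[X in measurable X]setTI; exact: mh.
rewrite !measureU//; try exact: measurableI.
- by congr (_ + _)%E; exact: lebesgue_measure_reflect.
- apply/seteqP; split => x //= [] [+ _] [+ _]; rewrite !in_itv/=; lra.
Qed.

(** The preimage is cut at k - s and at k, the target at s and at k. The first two pieces are
    translates of each other in exchanged order, and the third is fixed. *)
Lemma cyclic_shift (s k : R) : 0 <= s <= k -> k <= 1 ->
  exists2 g, unit_preserving g & forall t, unit_val (g t) =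
    if unit_val t < k then
      (if unit_val t + s < k then unit_val t + s else unit_val t + s - k)
    else unit_val t.
Proof.
move=> sk k1; apply: (@unit_preserving_lift (fun x =>
  if x < k then (if x + s < k then x + s else x + s - k) else x)).
- have ms : measurable_fun setT (fun x : R => x + s) by exact: measurable_funD.
  apply: measurable_fun_ifT => //; first exact: measurable_fun_ltr.
  apply: measurable_fun_ifT => //; first exact: measurable_fun_ltr.
  exact: measurable_funB.
- by move=> x; case: ifPn => ?; [case: ifPn|]; lra.
move=> B mB.
have e (c : R) (X : set R) : 0 <= c <= k -> `[0, 1] `&` X =
    (`[0, c[ `&` X) `|` ((`[c, k[ `&` X) `|` (`[k, 1] `&` X)).
  move=> ck; rewrite -!setIUl; congr (_ `&` _).
  apply/seteqP; split => x /=; rewrite !in_itv/=.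
    move=> ?; case: (ltP x c) => ?; [left; lra|right].
    by case: (ltP x k) => ?; [left|right]; lra.
  by move=> [|[]]; lra.
have mue (c : R) (X : set R) : 0 <= c <= k ->
    measurable (`[0, c[ `&` X) -> measurable (`[c, k[ `&` X) ->
    measurable (`[k, 1] `&` X) ->
    mu (`[0, 1] `&` X) = (mu (`[0%R, c[ `&` X) +
      (mu (`[c, k[ `&` X) + mu (`[k, 1%R] `&` X)))%E.
  move=> ck m1 m2 m3; rewrite (e c)// !measureU//; try exact: measurableU.
    by apply/seteqP; split => x //= [] [+ _] [+ _]; rewrite !in_itv/=; lra.
  apply/seteqP; split => x //= [] [+ _] [[]|[]]; rewrite !in_itv/=; lra.
have mI (a b : itv_bound R) : measurable ([set` Interval a b] `&` B).
  exact: measurableI.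
have e1 : `[0, (k - s)[ `&` (fun x : R =>
    if x < k then (if x + s < k then x + s else x + s - k) else x) @^-1` B =
    [set x | (`[s, k[ `&` B) (x + s)].
  apply/seteqP; split => x /=; rewrite !in_itv/=.
    by move=> [?]; case: ifPn => ?; [case: ifPn => ?; [split => //|]|]; lra.
  by move=> [? ?]; case: ifPn => ?; [case: ifPn => ?; [split => //|]|]; lra.
have e2 : `[(k - s), k[ `&` (fun x : R =>
    if x < k then (if x + s < k then x + s else x + s - k) else x) @^-1` B =
    [set x | (`[0, s[ `&` B) (x + (s - k))].
  apply/seteqP; split => x /=; rewrite !in_itv/=.
    move=> [?]; case: ifPn => ?; [case: ifPn => ?; [lra|]|lra].
    by rewrite -addrA => ?; split => //; lra.
  move=> [? ?]; case: ifPn => ?; [case: ifPn => ?; [lra|]|lra].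
  by rewrite -addrA => //; split => //; lra.
have e3 : `[k, 1] `&` (fun x : R =>
    if x < k then (if x + s < k then x + s else x + s - k) else x) @^-1` B =
    `[k, 1] `&` B.
  apply/seteqP; split => x /=; rewrite !in_itv/= => -[?]; case: ifPn => ? ?;
  by [split => //|lra].
rewrite (mue (k - s)); [|lra|rewrite e1; apply: measurable_translate; exact: mI
  |rewrite e2; apply: measurable_translate; exact: mI|rewrite e3; exact: mI].
rewrite (mue s); [|lra|exact: mI|exact: mI|exact: mI].
rewrite e1 e2 e3 addeCA; congr (_ + (_ + _))%E.
- apply: lebesgue_measure_translate; exact: mI.
- apply: lebesgue_measure_translate; exact: mI.
Qed.

End interval_measure.

Section cube_transformations.
Context {R : realType} (P : probability (cube R) R) (hP : product_lebesgue P).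

Definition on_coord i (g : unit_interval R -> unit_interval R) (x : cube R)
  : cube R := fun j => if j == i then g (x j) else x j.

Lemma measurable_on_coord i g : measurable_fun setT g ->
  measurable_fun setT (on_coord i g).
Proof.
move=> mg; apply: measurable_cube => j; rewrite /on_coord.
case: eqP => _; last exact: measurable_coord.
by apply: measurableT_comp => //; exact: measurable_coord.
Qed.

Lemma product_lebesgue_box n A : (forall i, measurable (A i)) ->
  P (box n A) = (\prod_(i < n) unit_measure (A i))%E.
Proof. exact: hP. Qed.

Lemma on_coord_box i g n A : on_coord i g @^-1` box n A =
  box n (fun j => if j == i then g @^-1` A j else A j).
Proof.
apply/seteqP; split => x /= H j jn; have := H j jn; rewrite /on_coord/=;
  by case: eqP.
Qed.

(** By uniqueness it is enough to look at boxes, of which only the side i changes. *)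
Lemma on_coord_preserving i g : unit_preserving g ->
  forall E, measurable E -> P (on_coord i g @^-1` E) = P E.
Proof.
move=> [mg gE] E mE.
have mT := measurable_on_coord i mg.
rewrite -[LHS]/(pushforward P (on_coord i g) E).
apply: cube_measure_unique mE => //=.
  by rewrite /pushforward preimage_setT probability_setT ltry.
move=> n A mA; rewrite /pushforward on_coord_box !product_lebesgue_box//.
  by apply: eq_bigr => j _; case: eqP => // _; exact: gE.
move=> j; case: eqP => // _.
by rewrite -[X in measurable X]setTI; exact: mg.
Qed.

Lemma box_widen n m A : (n <= m)%N ->
  box n A = box m (fun i => if (i < n)%N then A i else setT) :> set (cube R).
Proof.
move=> nm; apply/seteqP; split => x /= H i im.
  by case: ifPn => // /H.
by have := H i (leq_trans im nm); rewrite im.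
Qed.

(* Freezing the coordinate i maps the restriction of P to {x_i \in B} to a
   multiple of the image of P, by uniqueness on boxes. *)
Lemma coord_indep i (t0 : unit_interval R) (B : set (unit_interval R))
    (E : set (cube R)) : measurable B -> measurable E ->
  P ((on_coord i (cst t0) @^-1` E) `&` [set x | B (x i)]) =
  (unit_measure B * P (on_coord i (cst t0) @^-1` E))%E.
Proof.
move=> mB mE.
have mT : measurable_fun setT (on_coord i (cst t0)).
  exact: measurable_on_coord.
have mD : measurable [set x : cube R | B (x i)].
  rewrite -[X in measurable X]setTI; exact: (@measurable_coord R i measurableT).
have mU A : (forall j, measurable (A j)) ->
    forall j, measurable (if j == i then A j `&` B else A j).
  by move=> mA j; case: eqP => // _; exact: measurableI.
have BE : (unit_measure B = P [set x | B (x i)])%E.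
  rewrite (_ : [set x | _] = box i.+1 (fun j => if j == i then B else setT)).
    rewrite product_lebesgue_box => [|j]; last by case: eqP.
    rewrite big_ord_recr/= eqxx big1 ?mul1e// => j _.
    by rewrite ltn_eqF// unit_measureT.
  apply/seteqP; split => x /= H.
    by move=> j _; case: eqP => // ->.
  by have := H i (ltnSn _); rewrite eqxx.
have B_fin : unit_measure B \is a fin_num by rewrite BE fin_num_measure.
have B0 : 0 <= fine (unit_measure B) by rewrite fine_ge0// BE.
rewrite -[LHS]/(pushforward (mrestr P mD) (on_coord i (cst t0)) E).
rewrite -[RHS](_ : mscale (NngNum B0)
  (pushforward P (on_coord i (cst t0))) E = _); last first.
  by rewrite /mscale/= fineK.
apply: cube_measure_unique mE => //=.
  rewrite /pushforward preimage_setT /mrestr setTI.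
  by rewrite (le_lt_trans (probability_le1 _ _))// ltry.
move=> n A mA.
(* The box is widened so that the coordinate i is among its sides. *)
have [m im [A' mA' ->]] : exists2 m, (i < m)%N & exists2 A',
    (forall j, measurable (A' j)) & box n A = box m A' :> set (cube R).
  exists (maxn n i.+1); first by rewrite leq_maxr.
  exists (fun i => if (i < n)%N then A i else setT).
    by move=> j; case: ifP.
  by apply: box_widen; rewrite leq_maxl.
rewrite /mscale/= /pushforward on_coord_box /mrestr fineK//.
pose A2 j := if j == i then cst t0 @^-1` A' j else A' j.
rewrite -/A2.
have mA2 j : measurable (A2 j).
  rewrite /A2; case: eqP => // _; rewrite preimage_cst.
  by case: ifP.
have -> : box m A2 `&` [set x | B (x i)] =
    box m (fun j => if j == i then A2 j `&` B else A2 j).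
  apply/seteqP; split => x /=.
    by move=> [H Bx] j jm; case: eqP => [ji|_]; [split; [|rewrite ji]|]; try exact: H.
  move=> H; split; last by have := H i im; rewrite eqxx => -[].
  by move=> j /H; case: eqP => // _ [].
rewrite !product_lebesgue_box//; last exact: mU.
rewrite (bigD1 (Ordinal im))//=.
rewrite [X in _ = (_ * X)%E](bigD1 (Ordinal im))//= eqxx muleA; congr (_ * _)%E; last first.
  by apply: eq_bigr => j; rewrite -val_eqE/= => /negPf ->.
rewrite /A2 eqxx preimage_cst; case: ifP => _.
  by rewrite setTI unit_measureT mule1.
by rewrite set0I unit_measure0 mule0.
Qed.

End cube_transformations.

(** * Means of bounded measurable functions *)

Section bounded_measurable.
Context d (T : measurableType d) (R : realType) (P : probability T R).
Implicit Types f g : T -> R.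

(** This class is closed under all operations used below and integrable for a probability, so that
    means can be manipulated algebraically. *)
Definition bounded_measurable f :=
  measurable_fun setT f /\ exists M, forall x, `|f x| <= M.

Lemma bounded_measurable_integrable f : bounded_measurable f ->
  P.-integrable setT (EFin \o f).
Proof.
move=> [mf [M fM]]; apply: measurable_bounded_integrable => //.
  by rewrite (le_lt_trans (probability_le1 P measurableT))// ltry.
exists M; split; first by rewrite num_real.
by move=> N MN x _; exact: le_trans (fM x) (ltW MN).
Qed.

Lemma bounded_measurable_cst c : bounded_measurable (fun=> c).
Proof. by split => //; exists `|c|. Qed.

Lemma bounded_measurableD f g : bounded_measurable f -> bounded_measurable g ->
  bounded_measurable (fun x => f x + g x).
Proof.
move=> [mf [M fM]] [mg [N gN]]; split; first exact: measurable_funD.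
by exists (M + N) => x; rewrite (le_trans (ler_normD _ _))// lerD.
Qed.

Lemma bounded_measurableN f : bounded_measurable f ->
  bounded_measurable (fun x => - f x).
Proof.
move=> [mf [M fM]]; split; first exact: measurableT_comp.
by exists M => x; rewrite normrN.
Qed.

Lemma bounded_measurableM f g : bounded_measurable f -> bounded_measurable g ->
  bounded_measurable (fun x => f x * g x).
Proof.
move=> [mf [M fM]] [mg [N gN]]; split; first exact: measurable_funM.
by exists (M * N) => x; rewrite normrM ler_pM.
Qed.

Lemma bounded_measurable_sum I (s : seq I) (f : I -> T -> R) :
  (forall i, bounded_measurable (f i)) ->
  bounded_measurable (fun x => \sum_(i <- s) f i x).
Proof.
move=> hf; elim: s => [|i s IH].
  under [X in bounded_measurable X]eq_fun => x do rewrite big_nil.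
  exact: bounded_measurable_cst.
under [X in bounded_measurable X]eq_fun => x do rewrite big_cons.
exact: bounded_measurableD.
Qed.

Lemma bounded_measurable_abs_powR f r : 0 <= r -> bounded_measurable f ->
  bounded_measurable (fun x => `|f x| `^ r).
Proof.
move=> r0 [mf [M fM]]; split.
  apply: (@measurableT_comp _ _ _ _ _ _ (@powR R ^~ r)) => //.
  exact: measurableT_comp.
exists (M `^ r) => x; rewrite ger0_norm ?powR_ge0//.
by apply: ge0_lerP => //; exact: fM.
Qed.

Lemma bounded_measurableX f n : bounded_measurable f ->
  bounded_measurable (fun x => f x ^+ n).
Proof.
move=> hf; elim: n => [|n IH]; first exact: bounded_measurable_cst.
under [X in bounded_measurable X]eq_fun => x do rewrite exprS.
exact: bounded_measurableM.
Qed.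

Lemma bounded_measurable_comp (h : T -> T) f : measurable_fun setT h ->
  bounded_measurable f -> bounded_measurable (f \o h).
Proof.
by move=> mh [mf [M fM]]; split; [exact: measurableT_comp|exists M => x; exact: fM].
Qed.

Definition mean f : R := \int[P]_x f x.

Lemma eq_mean f g : f =1 g -> mean f = mean g.
Proof. by move=> fg; apply: eq_Rintegral => x _; exact: fg. Qed.

Lemma meanD f g : bounded_measurable f -> bounded_measurable g ->
  mean (fun x => f x + g x) = mean f + mean g.
Proof. by move=> hf hg; apply: RintegralD => //; exact: bounded_measurable_integrable. Qed.

Lemma meanZ c f : bounded_measurable f -> mean (fun x => c * f x) = c * mean f.
Proof. by move=> hf; apply: RintegralZl => //; exact: bounded_measurable_integrable. Qed.

Lemma meanN f : bounded_measurable f -> mean (fun x => - f x) = - mean f.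
Proof.
by move=> hf; rewrite -mulN1r -meanZ//; apply: eq_mean => x; rewrite mulN1r.
Qed.

Lemma mean_cst c : mean (fun=> c) = c.
Proof.
rewrite /mean Rintegral_cst// -[RHS]mulr1; congr (_ * _).
rewrite (_ : 1 = fine 1%E)//; congr fine; exact: probability_setT.
Qed.

Lemma ler_mean f g : bounded_measurable f -> bounded_measurable g ->
  (forall x, f x <= g x) -> mean f <= mean g.
Proof.
by move=> hf hg fg; apply: le_Rintegral => //; exact: bounded_measurable_integrable.
Qed.

Lemma mean_ge0 f : (forall x, 0 <= f x) -> 0 <= mean f.
Proof. by move=> f0; apply: Rintegral_ge0 => x _; exact: f0. Qed.

Lemma mean_preserving (h : T -> T) f : measurable_fun setT h ->
  (forall E, measurable E -> P (h @^-1` E) = P E) ->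
  bounded_measurable f -> mean (f \o h) = mean f.
Proof.
move=> mh hh hf; rewrite /mean /Rintegral; congr fine.
rewrite -[LHS](@integral_pushforward _ _ _ _ _ _ mh P setT (EFin \o f))//.
- by apply: eq_measure_integral => A mA _ /=; rewrite /pushforward hh.
- by apply/measurable_EFinP; case: hf.
- by apply: bounded_measurable_integrable; exact: bounded_measurable_comp.
Qed.

(** Jensen's inequality: the tangent of t^r at the mean of f is integrated. *)
Lemma mean_powR_gt0_le f r : 1 <= r -> bounded_measurable f ->
  (forall x, 0 <= f x) -> mean f `^ r <= mean (fun x => f x `^ r).
Proof.
move=> r1 hf f0; set m := mean f.
have m0 : 0 <= m by exact: mean_ge0.
have hb : bounded_measurable (fun x => r * m `^ (r - 1) * (f x - m)).
  apply: bounded_measurableM; first exact: bounded_measurable_cst.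
  by apply: bounded_measurableD => //; exact: bounded_measurable_cst.
have -> : m `^ r = mean (fun x => m `^ r + r * m `^ (r - 1) * (f x - m)).
  rewrite meanD//; last exact: bounded_measurable_cst.
  rewrite meanZ; last first.
    by apply: bounded_measurableD => //; exact: bounded_measurable_cst.
  rewrite meanD//; last exact: bounded_measurable_cst.
  by rewrite !mean_cst subrr mulr0 addr0.
apply: ler_mean.
- by apply: bounded_measurableD => //; exact: bounded_measurable_cst.
- rewrite (_ : (fun x => f x `^ r) = (fun x => `|f x| `^ r)).
    by apply: bounded_measurable_abs_powR => //; lra.
  by apply/funext => x; rewrite ger0_norm.
- by move=> x; exact: powR_tangent.
Qed.

End bounded_measurable.

(** * Symmetries and moments of the generators *)

Section generator_symmetries.
Context {R : realType} (p : R) (w : nat -> R) (p2 : 2 < p)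
  (w01 : forall n, 0 < w n <= 1).
Notation k := (weight_power p w).
Notation y := (generator p w).

Lemma weight_power_gt0 i : 0 < k i.
Proof. by rewrite powR_gt0//; have := w01 i; lra. Qed.

Lemma weight_power_le1 i : k i <= 1.
Proof.
have e0 : 0 <= 2 * p / (p - 2) by have := p2 => ?; rewrite divr_ge0//; lra.
have := @ge0_lerP R _ (w i) 1 e0; rewrite powR1; apply; have := w01 i; lra.
Qed.

Lemma sinD_natpi (v : R) n : sin (v + (2 ^+ n.+1 * pi)) = sin v.
Proof.
have -> : 2 ^+ n.+1 * pi = (pi *+ 2) *+ (2 ^ n) :> R.
  by rewrite -mulrnA -expnS -[RHS]mulr_natl natrX.
exact: (periodicn (@sinD2pi R)).
Qed.

Lemma sin_natpi n : sin (2 ^+ n.+1 * pi) = 0 :> R.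
Proof. by rewrite -[X in sin X]add0r sinD_natpi sin0. Qed.

Lemma rademacher_reflect n (u : R) :
  rademacher n.+1 (1 - u) = - rademacher n.+1 u.
Proof.
rewrite /rademacher mulrBr mulr1 addrC sinD_natpi sinN sgrN //.
Qed.

Lemma rademacherD1 n (u : R) : rademacher n.+1 (u + 1) = rademacher n.+1 u.
Proof. by rewrite /rademacher mulrDr mulr1 sinD_natpi. Qed.

Lemma rademacher1 n : rademacher n.+1 (1 : R) = 0.
Proof. by rewrite /rademacher mulr1 sin_natpi sgr0. Qed.

Lemma rademacher_shift n (u : R) :
  rademacher n.+1 (u + 2 ^- n.+1) = - rademacher n.+1 u.
Proof.
rewrite /rademacher mulrDr [X in sin (_ + X)](mulrAC _ pi) divff ?expf_neq0// mul1r.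
by rewrite sinDpi sgrN.
Qed.

(** The argument of the sine grows by 2^(m-n) pi, a multiple of 2 pi since n < m. *)
Lemma rademacher_shift_lt n m (u : R) : (n < m)%N ->
  rademacher m.+1 (u + 2 ^- n.+1) = rademacher m.+1 u.
Proof.
move=> nm; rewrite /rademacher mulrDr [X in sin (_ + X)](mulrAC _ pi).
rewrite -exprB ?unitfE//; last by rewrite ltnW.
by rewrite subSS -(subnSK nm) sinD_natpi.
Qed.

Lemma generatorE i n x :
  y i n x = dilate p (k i) (rademacher n.+1) (unit_val (x i)).
Proof. by []. Qed.

Lemma generator_on_coord_neq i j n g x : j != i ->
  y j n (on_coord i g x) = y j n x.
Proof. by move=> /negPf ji; rewrite /generator /on_coord ji. Qed.

(** Rademacher functions are odd about 1/2, so one reflection of [0, k_i] changes the sign of all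
    generators of the coordinate at once. *)
Lemma generator_reflection i : exists2 g, unit_preserving g &
  forall n x, y i n (on_coord i g x) = - y i n x.
Proof.
have k0 := weight_power_gt0 i.
have k01 : 0 <= k i <= 1 by rewrite weight_power_le1 ltW.
have [g gP gE] := reflection k01; exists g => // n x.
rewrite !generatorE /on_coord eqxx gE /dilate.
have /andP[x0 _] := unit_val_itv (x i); rewrite x0/=.
case: (leP (unit_val (x i)) (k i)) => xk; last first.
  by rewrite x0/= leNgt xk oppr0.
rewrite (_ : 0 <= k i - unit_val (x i) <= k i); last by lra.
by rewrite mulrBl divff ?gt_eqF// rademacher_reflect mulrN.
Qed.

(* Shift [0, k_i] cyclically by half a period of r_(n+1), which is a multiple
   of the period of each later Rademacher function. *)
Lemma generator_shift i n : exists2 g, unit_preserving g &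
  (forall x, y i n (on_coord i g x) = - y i n x) /\
  (forall m x, (n < m)%N -> y i m (on_coord i g x) = y i m x).
Proof.
have k0 := weight_power_gt0 i.
have s2 : 0 < (2 : R) ^- n.+1 <= 1.
  apply/andP; split; first by rewrite invr_gt0 exprn_gt0.
  by rewrite invf_le1 ?exprn_gt0//; apply: exprn_ege1; exact: ler1n.
have s0 : 0 <= k i * (2 : R) ^- n.+1 <= k i.
  by rewrite mulr_ge0 ?ler_piMr//; lra.
have [g gP gE] := cyclic_shift s0 (weight_power_le1 i); exists g => //.
pose r (m : nat) (u : R) := rademacher m.+1 u.
(* The shift acts on the half-open interval [0, k_i[ while [dilate] lives on the closed one; at the
   end point the generator is 0 because the Rademacher function vanishes at 1. *)
have yE m x : y i m x =
    if unit_val (x i) < k i then k i `^ (- p^-1) * r m (unit_val (x i) / k i) else 0.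
  rewrite generatorE /dilate; have /andP[x0 _] := unit_val_itv (x i); rewrite x0/=.
  case: (ltgtP (unit_val (x i)) (k i)) => // ->.
  by rewrite divff ?gt_eqF// rademacher1 mulr0.
have yg m x : y i m (on_coord i g x) = if unit_val (x i) < k i then
    k i `^ (- p^-1) * r m (unit_val (x i) / k i + 2 ^- n.+1) else 0.
  rewrite yE /on_coord eqxx gE.
  case: (ltP (unit_val (x i)) (k i)) => xk; last by rewrite ltNge xk.
  have /andP[x0 _] := unit_val_itv (x i).
  case: (ltP (unit_val (x i) + k i * 2 ^- n.+1) (k i)) => xs.
    by rewrite xs mulrDl (mulrAC (k i)) divff ?gt_eqF// mul1r.
  rewrite (_ : _ - k i < k i); last by lra.
  congr (_ * _); rewrite /r -[in LHS]rademacherD1 mulrBl divff ?gt_eqF// subrK.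
  by rewrite mulrDl (mulrAC (k i)) divff ?gt_eqF// mul1r.
split=> [x|m x nm]; rewrite yg yE; case: ifPn => _; rewrite ?oppr0//.
  by rewrite /r rademacher_shift mulrN.
by rewrite /r rademacher_shift_lt.
Qed.

(** Take m as the integer part of x / pi; the sine is positive on ]0, pi[, so the remainder is 0. *)
Lemma sin0_natpi (x : R) : 0 <= x -> sin x = 0 -> exists m : nat, x = m%:R * pi.
Proof.
move=> x0 sx.
have pi0 := @pi_gt0 R.
have [m /andP[m1 m2]] : exists m : nat, m%:R <= x / pi < m.+1%:R.
  exists (Num.truncn (x / pi)); apply: truncn_itv.
  by rewrite divr_ge0// ltW.
exists m.
have sy : sin (x - m%:R * pi) = 0.
  have : sin ((x - m%:R * pi) + m%:R * pi) = 0 by rewrite subrK.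
  move: (x - m%:R * pi) => u.
  clear; elim: m => [|m IH]; first by rewrite mul0r addr0.
  by rewrite -natr1 mulrDl mul1r addrA sinDpi => /eqP; rewrite oppr_eq0 => /eqP.
apply/eqP; rewrite -subr_eq0; apply/eqP/le_anti/andP; split; last first.
  by rewrite subr_ge0 -ler_pdivlMr.
rewrite leNgt; apply/negP => h.
have hp : x - m%:R * pi < pi.
  by move: m2; rewrite ltr_pdivrMr// -natr1 mulrDl mul1r ltrBlDl.
by have := @sin_gt0_pi R (x - m%:R * pi); rewrite h hp sy ltxx => /(_ isT).
Qed.

Section moments.
Variables (P : probability (cube R) R) (hP : product_lebesgue P).

Lemma coord_measure i (B : set (unit_interval R)) : measurable B ->
  P [set x : cube R | B (x i)] = unit_measure B.
Proof.
move=> mB; have := coord_indep hP i point mB measurableT.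
by rewrite preimage_setT setTI probability_setT mule1.
Qed.

(** The support of the generators of coordinate i, up to a null set; its measure is k_i. *)
Definition coord_le i : set (cube R) := [set x | unit_val (x i) <= k i].

Lemma measurable_coord_le i : measurable (coord_le i).
Proof.
pose B : set (unit_interval R) := val @^-1` `]-oo, k i].
have mB : measurable B by exists `]-oo, k i]%classic => //; rewrite setTI.
rewrite (_ : coord_le i = (fun x : cube R => x i) @^-1` B).
  by rewrite -[X in measurable X]setTI; apply: measurable_coord.
by apply/seteqP; split => x /=; rewrite /B/= in_itv.
Qed.

Lemma bounded_measurable_indic (E : set (cube R)) : measurable E ->
  bounded_measurable (\1_E : cube R -> R).
Proof.
move=> mE; split; first exact: measurable_indic.
by exists 1 => x; rewrite indicE; case: (_ \in _); rewrite ?normr1 ?normr0.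
Qed.

Lemma bounded_measurable_generator i n : bounded_measurable (y i n).
Proof.
split; first exact: measurable_generator.
by exists (k i `^ (- p^-1)) => x; exact: generator_bounded.
Qed.

(** The sign of 0 is 0, so the square of a Rademacher function is 1 only off the zeros of the sine.
    These confine x_i to a countable set. *)
Lemma zero_coord_null (i n : nat) :
  P.-negligible [set x : cube R | unit_val (x i) <= k i /\
    rademacher n.+1 (unit_val (x i) / k i) = 0].
Proof.
have k0 := weight_power_gt0 i.
pose C : set R := range (fun m : nat => m%:R / 2 ^+ n.+1 * k i).
have cC : countable C by exact: card_image_le.
have mC : measurable C by apply: countable_measurable.
exists [set x | (val @^-1` C) (x i)]; split.
- rewrite -[X in measurable X]setTI; apply: measurable_coord => //.
  by exists C => //; rewrite setTI.
- rewrite coord_measure; last by exists C => //; rewrite setTI.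
  rewrite unit_measureE; apply/eqP; rewrite eq_le measure_ge0 andbT.
  rewrite -[leRHS](countable_lebesgue_measure0 cC).
  by apply: le_measure; rewrite ?inE//; exact: measurableI.
move=> x /= [xk] /eqP; rewrite /rademacher sgr_eq0 => /eqP s0.
have /andP[x0 _] := unit_val_itv (x i).
have /sin0_natpi : 0 <= 2 ^+ n.+1 * pi * (unit_val (x i) / k i).
  by rewrite !mulr_ge0 ?invr_ge0 ?exprn_ge0 ?pi_ge0// ltW.
move=> /(_ s0)[m e]; exists m => //.
have pi0 : pi != 0 :> R by rewrite gt_eqF// pi_gt0.
have p20 : 2 ^+ n.+1 != 0 :> R by rewrite expf_neq0.
move: p20 e; set t := 2 ^+ n.+1 => p20 e; rewrite -[RHS]/(unit_val (x i)).
have : t * unit_val (x i) * pi = m%:R * k i * pi.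
  transitivity ((t * pi * (unit_val (x i) / k i)) * k i).
    by field; rewrite gt_eqF.
  by rewrite e; ring.
move=> /(mulIf pi0) e2.
transitivity (m%:R * k i / t); first by rewrite mulrAC.
by rewrite -e2 mulrAC divff// mul1r.
Qed.

Lemma generator_sqrE i n x : y i n x ^+ 2 = k i `^ (- p^-1) ^+ 2 *
  (\1_(coord_le i) x * (rademacher n.+1 (unit_val (x i) / k i) != 0)%:R).
Proof.
rewrite generatorE /dilate indicE /coord_le.
have /andP[-> _] /= := unit_val_itv (x i).
case: ifPn => xk; last by rewrite memNset /=; [rewrite mul0r mulr0 expr0n|exact/negP].
rewrite mem_set//= mul1r exprMn; congr (_ * _).
by rewrite /rademacher sqr_sg sgr_eq0.
Qed.

Lemma generator_sqr_le i n x :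
  y i n x ^+ 2 <= k i `^ (- p^-1) ^+ 2 * \1_(coord_le i) x.
Proof.
rewrite generator_sqrE ler_wpM2l ?sqr_ge0// indicE.
by case: (_ \in _); case: (_ != 0); rewrite ?mulr1 ?mulr0 ?lexx.
Qed.

(** Almost everywhere the square of a generator is a constant multiple of the indicator of
    [coord_le], whatever n is. *)
Lemma mean_generator_sqr i n (h : cube R -> R) : bounded_measurable h ->
  mean P (fun x => h x * y i n x ^+ 2) =
  k i `^ (- p^-1) ^+ 2 * mean P (fun x => h x * \1_(coord_le i) x).
Proof.
move=> hh.
have hi : bounded_measurable (fun x => h x * \1_(coord_le i) x).
  apply: bounded_measurableM => //; apply: bounded_measurable_indic.
  exact: measurable_coord_le.
rewrite -meanZ//; congr fine; apply: ae_eq_integral => //.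
- apply/measurable_EFinP; apply: (bounded_measurableM hh _).1.
  exact: bounded_measurableX (bounded_measurable_generator i n).
- apply/measurable_EFinP.
  by apply: measurable_funM; [exact: measurable_cst|case: hi].
apply: negligibleS (zero_coord_null i n) => x /= /not_implyP[_ hx].
rewrite /rademacher; apply: contra_notP hx => hx; congr EFin.
rewrite generator_sqrE mulrCA; congr (_ * (_ * _)).
rewrite indicE /coord_le; have [xk|xk] := boolP (unit_val (x i) <= k i).
  rewrite mem_set//= mul1r; case: eqP => // e; exfalso; exact: hx.
by rewrite memNset ?mul0r//=; exact/negP.
Qed.

(** As h does not see the coordinate i, it factors through freezing that coordinate. By
    [coord_indep], restricting P to [coord_le] multiplies the image measure by k_i. *)
Lemma mean_coord_le i (h : cube R -> R) : bounded_measurable h ->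
  (forall x, 0 <= h x) ->
  (forall g x, h (on_coord i g x) = h x) ->
  mean P (fun x => h x * \1_(coord_le i) x) = k i * mean P h.
Proof.
move=> hh h0 hi; have [mh _] := hh.
have mD := measurable_coord_le i.
have mZ : measurable_fun setT (on_coord i (cst (point : unit_interval R))).
  exact: measurable_on_coord.
set Z := on_coord _ _ in mZ.
have mEh : measurable_fun setT (EFin \o h) by exact/measurable_EFinP.
have hZ : (EFin \o h) \o Z = EFin \o h by apply/funext => x /=; rewrite hi.
have k0 := weight_power_gt0 i.
rewrite /mean /Rintegral -[k i]/(fine (k i)%:E).
suff -> : (\int[P]_x (h x * \1_(coord_le i) x)%:E =
    (k i)%:E * \int[P]_x (h x)%:E)%E.
  rewrite fineM//.
  by apply: integrable_fin_num => //; exact: bounded_measurable_integrable.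
pose B : set (unit_interval R) := val @^-1` `]-oo, k i].
have mB : measurable B by exists `]-oo, k i]%classic => //; rewrite setTI.
have BE : unit_measure B = (k i)%:E.
  rewrite unit_measureE (_ : _ `&` _ = `[0, k i]%classic).
    by rewrite lebesgue_measure_itv/= lte_fin k0 sube0.
  apply/seteqP; split => x /=; rewrite !in_itv/=; have := weight_power_le1 i; lra.
transitivity (\int[P]_(x in coord_le i) (h x)%:E)%E.
  rewrite [RHS]integral_mkcond; apply: eq_integral => x _.
  by rewrite patchE indicE; case: ifPn => _; rewrite ?mulr1 ?mulr0.
transitivity (\int[mrestr P mD]_(x in coord_le i) (h x)%:E)%E.
  apply: eq_measure_integral => A mA AD.
  by rewrite -[RHS]/(P (A `&` coord_le i)) setIidl.
transitivity (\int[mrestr P mD]_x (h x)%:E)%E.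
  rewrite [RHS](@ge0_negligible_integral _ _ _ _ _ (~` coord_le i))//=.
  - by rewrite setTD setCK.
  - exact: measurableC.
  - by move=> x _; rewrite lee_fin.
  - by rewrite -[LHS]/(P (~` coord_le i `&` coord_le i)) setICl measure0.
transitivity (\int[mrestr P mD]_x ((EFin \o h) \o Z) x)%E.
  by rewrite hZ.
rewrite -[LHS](@ge0_integral_pushforward _ _ _ _ _ _ mZ (mrestr P mD) setT)//=; last first.
  by move=> x _; rewrite lee_fin.
rewrite (@eq_measure_integral _ _ _ _ (mscale (NngNum (ltW k0)) (pushforward P Z))).
  rewrite ge0_integral_mscale//= ?ge0_integral_pushforward//=.
  + by congr (_ * _)%E; apply: eq_integral => x _; rewrite hi.
  + by move=> x _; rewrite lee_fin.
  + by move=> x _; rewrite lee_fin.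
move=> A mA _.
rewrite -[LHS]/(P (Z @^-1` A `&` coord_le i)).
rewrite -[RHS]/((k i)%:E * P (Z @^-1` A))%E.
have := coord_indep hP i point mB mA; rewrite BE => <-.
by congr (P (_ `&` _)); apply/seteqP; split => x /=; rewrite /B/= in_itv.
Qed.

End moments.
End generator_symmetries.

(** * Moments of a sum with a symmetric increment *)

Section flips.
Context d (T : measurableType d) (R : realType) (P : probability T R).
Implicit Types f g h S : T -> R.

Lemma Lnorm_mean f r : 0 < r -> bounded_measurable f ->
  'N[P]_r%:E[EFin \o f]%E = ((mean P (fun x => `|f x| `^ r)) `^ r^-1)%:E.
Proof.
move=> r0 hf; rewrite unlock /mean /Rintegral -poweR_EFin fineK//.
apply: integrable_fin_num => //; apply: bounded_measurable_integrable.
by apply: bounded_measurable_abs_powR => //; exact: ltW.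
Qed.

Lemma mean_hoelder f g r s : 0 < r -> 0 < s -> r^-1 + s^-1 = 1 ->
  bounded_measurable f -> bounded_measurable g ->
  (forall x, 0 <= f x) -> (forall x, 0 <= g x) ->
  mean P (fun x => f x * g x) <=
  mean P (fun x => f x `^ r) `^ r^-1 * mean P (fun x => g x `^ s) `^ s^-1.
Proof.
move=> r0 s0 rs hf hg f0 g0.
have := @hoelder _ _ _ P f g r s (proj1 hf) (proj1 hg) r0 s0 rs.
have hfg := bounded_measurableM hf hg.
rewrite (Lnorm_mean r0 hf) (Lnorm_mean s0 hg) -EFinM (Lnorm_mean ltr01 hfg) lee_fin.
have e (u : T -> R) t : (forall x, 0 <= u x) ->
    mean P (fun x => `|u x| `^ t) = mean P (fun x => u x `^ t).
  by move=> u0; apply: eq_mean => x; rewrite ger0_norm.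
rewrite !e//; last by move=> x; rewrite mulr_ge0.
rewrite invr1 powRr1; last by apply: mean_ge0 => x; exact: powR_ge0.
by rewrite (eq_mean P (g := fun x => f x * g x))// => x; rewrite powRr1// mulr_ge0.
Qed.

(* A symmetry of P which fixes S and changes the sign of g replaces
   independence in all the moment estimates below. *)
Definition flips (U : T -> T) S g :=
  [/\ measurable_fun setT U, forall E, measurable E -> P (U @^-1` E) = P E,
      forall x, S (U x) = S x & forall x, g (U x) = - g x].

Section flip.
Variables (U : T -> T) (S g : T -> R).
Hypotheses (hU : flips U S g) (hS : bounded_measurable S)
  (hg : bounded_measurable g).

Lemma mean_flip0 : mean P (fun x => S x * g x) = 0.
Proof.
have [mU PU US Ug] := hU; have hSg := bounded_measurableM hS hg.
have := mean_preserving mU PU hSg.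
rewrite (_ : _ \o U = fun x => - (S x * g x)); last first.
  by apply/funext => x /=; rewrite US Ug mulrN.
rewrite meanN//; set m := mean _ _; lra.
Qed.

(** The symmetry exchanges S + g and S - g, which makes pointwise two-point inequalities
    applicable. *)
Lemma mean_flip r : 0 <= r -> 2 * mean P (fun x => `|S x + g x| `^ r) =
  mean P (fun x => `|S x + g x| `^ r + `|S x - g x| `^ r).
Proof.
move=> r0; have [mU PU US Ug] := hU.
have h1 : bounded_measurable (fun x => `|S x + g x| `^ r).
  by apply: bounded_measurable_abs_powR => //; exact: bounded_measurableD.
have h2 : bounded_measurable (fun x => `|S x - g x| `^ r).
  apply: bounded_measurable_abs_powR => //; apply: bounded_measurableD => //.
  exact: bounded_measurableN.
rewrite meanD// mulrDl mul1r; congr (_ + _).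
rewrite -(mean_preserving mU PU h1); apply: eq_mean => x /=.
by rewrite US Ug.
Qed.

Lemma mean_flip_ge r : 2 <= r ->
  mean P (fun x => `|S x| `^ r) + mean P (fun x => `|g x| `^ r) <=
  mean P (fun x => `|S x + g x| `^ r).
Proof.
move=> r2; have r0 : 0 <= r by lra.
have hSr := bounded_measurable_abs_powR r0 hS.
have hgr := bounded_measurable_abs_powR r0 hg.
rewrite -(@ler_pM2l _ 2)// mean_flip// -meanD// -meanZ; last first.
  exact: bounded_measurableD.
apply: ler_mean.
- apply: bounded_measurableM; first exact: bounded_measurable_cst.
  exact: bounded_measurableD.
- apply: bounded_measurableD; apply: bounded_measurable_abs_powR => //.
    exact: bounded_measurableD.
  by apply: bounded_measurableD => //; exact: bounded_measurableN.
- by move=> x; rewrite mulrDr parallelogram_ge.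
Qed.

Lemma mean_flip_le r : 2 <= r ->
  mean P (fun x => `|S x + g x| `^ r) <= mean P (fun x => `|S x| `^ r) +
  step_const r * (mean P (fun x => `|S x| `^ (r - 2) * g x ^+ 2) +
                  mean P (fun x => `|g x| `^ r)).
Proof.
move=> r2; have r0 : 0 <= r by lra.
have r20 : 0 <= r - 2 by lra.
have hSr := bounded_measurable_abs_powR r0 hS.
have hgr := bounded_measurable_abs_powR r0 hg.
have hSg : bounded_measurable (fun x => `|S x| `^ (r - 2) * g x ^+ 2).
  apply: bounded_measurableM; last exact: bounded_measurableX.
  exact: bounded_measurable_abs_powR.
have hC := @bounded_measurable_cst _ T R (step_const r).
have h2 := @bounded_measurable_cst _ T R 2.
have hSum := bounded_measurableD hSg hgr.
(* The two-point inequality bounds twice the mean; halving would halve the error term too, and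
   keeping all of it is harmless as it is nonnegative. *)
suff : 2 * mean P (fun x => `|S x + g x| `^ r) <=
    2 * mean P (fun x => `|S x| `^ r) +
    step_const r * (mean P (fun x => `|S x| `^ (r - 2) * g x ^+ 2) +
                  mean P (fun x => `|g x| `^ r)).
  set X := step_const r * _ => h.
  suff : 0 <= X by lra.
  rewrite mulr_ge0 ?step_const_ge0// addr_ge0//; apply: mean_ge0 => x.
    by rewrite mulr_ge0 ?powR_ge0 ?sqr_ge0.
  exact: powR_ge0.
rewrite mean_flip// -(meanD _ hSg hgr) -(meanZ _ _ hSum) -(meanZ _ 2 hSr).
rewrite -meanD; [|exact: bounded_measurableM|exact: bounded_measurableM].
apply: ler_mean.
- apply: bounded_measurableD; apply: bounded_measurable_abs_powR => //.
    exact: bounded_measurableD.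
  by apply: bounded_measurableD => //; exact: bounded_measurableN.
- by apply: bounded_measurableD; apply: bounded_measurableM.
- by move=> x; exact: parallelogram_le.
Qed.

End flip.

(** Jensen's inequality for |f|^r with the exponent s / r. *)
Lemma mean_powR_mono f r s : 0 < r -> r <= s -> bounded_measurable f ->
  mean P (fun x => `|f x| `^ r) <= mean P (fun x => `|f x| `^ s) `^ (r / s).
Proof.
move=> r0 rs hf; have s0 : 0 < s by lra.
have h := bounded_measurable_abs_powR (ltW r0) hf.
have sr : 1 <= s / r by rewrite ler_pdivlMr// mul1r.
have := mean_powR_gt0_le P sr h (fun x => powR_ge0 _ _).
rewrite [X in _ <= X](eq_mean P (g := fun x => `|f x| `^ s)); last first.
  by move=> x; rewrite -powRrM mulrCA divff ?gt_eqF// mulr1.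
set m := mean _ _; have m0 : 0 <= m by apply: mean_ge0 => x; exact: powR_ge0.
have rs0 : 0 <= r / s by rewrite divr_ge0// ltW.
move=> /(ge0_lerP rs0 (powR_ge0 _ _)).
by rewrite -powRrM (_ : s / r * (r / s) = 1) ?powRr1//; field; rewrite !gt_eqF.
Qed.

End flips.

(** M m stands for the p-th moment of the sum from m on. Since M decreases, each M m.+1 in the error
    terms may be replaced by M 0; the recursion then telescopes to an inequality which [absorb_le]
    solves for M 0. *)
Lemma moment_recursion (R : realType) (r D : R) (M b c : nat -> R) N :
  2 < r -> 0 <= D -> (forall m, 0 <= M m) -> (forall m, 0 <= b m) ->
  (forall m, 0 <= c m) -> M N = 0 ->
  (forall m, (m < N)%N -> M m.+1 <= M m) ->
  (forall m, (m < N)%N ->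
    M m <= M m.+1 + D * (b m * M m.+1 `^ ((r - 2) / r) + c m)) ->
  M 0%N <= 2 * (D * \sum_(0 <= m < N) c m) +
           (2 * (D * \sum_(0 <= m < N) b m)) `^ (r / 2).
Proof.
move=> r2 D0 M0 b0 c0 MN Mdec Mrec.
have r20 : 0 <= (r - 2) / r by rewrite divr_ge0//; lra.
have Mle m : (m <= N)%N -> M m <= M 0%N.
  elim: m => // m IH mN; exact: le_trans (Mdec m mN) (IH (ltnW mN)).
have H m : (m <= N)%N -> M 0%N <= M m +
    D * ((\sum_(0 <= j < m) b j) * M 0%N `^ ((r - 2) / r) + \sum_(0 <= j < m) c j).
  elim: m => [_|m IH mN]; first by rewrite !big_nil mul0r addr0 mulr0 addr0.
  apply: le_trans (IH (ltnW mN)) _; rewrite !big_nat_recr//=.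
  have h1 := Mrec m mN.
  have h2 : D * (b m * M m.+1 `^ ((r - 2) / r)) <= D * (b m * M 0%N `^ ((r - 2) / r)).
    by rewrite ler_wpM2l// ler_wpM2l// ge0_lerP// Mle.
  move: h1 h2; set X := \sum_(0 <= _ < m) b _; set Y := \sum_(0 <= _ < m) c _.
  by set u := M m.+1 `^ _; set v := M 0%N `^ _; lra.
apply: absorb_le => //; rewrite ?mulr_ge0 ?sumr_ge0//.
by have := H N (leqnn N); rewrite MN add0r mulrDr mulrA.
Qed.

Lemma sum_powR_le (R : realType) (I : Type) (s : seq I) (t : I -> R) r :
  1 <= r -> (forall i, 0 <= t i) ->
  \sum_(i <- s) t i `^ r <= (\sum_(i <- s) t i) `^ r.
Proof.
move=> r1 t0; elim: s => [|i s IH].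
  by rewrite !big_nil powR0// gt_eqF//; lra.
rewrite !big_cons; apply: le_trans (powR_superadditive r1 (t0 i) _).
  by rewrite lerD2l.
exact: sumr_ge0.
Qed.

(** * Khintchine's inequality within one coordinate *)

Section blocks.
Context {R : realType} (P : probability (cube R) R) (hP : product_lebesgue P).
Variables (p : R) (w : nat -> R) (p2 : 2 < p) (w01 : forall n, 0 < w n <= 1).
Notation k := (weight_power p w).
Notation y := (generator p w).
Implicit Types (a : nat -> R) (h : cube R -> R).

Let p_neq0 : p != 0. Proof. by have := p2 => ?; rewrite gt_eqF//; lra. Qed.
Let p2_neq0 : p - 2 != 0.
Proof. by have := p2 => ?; rewrite gt_eqF//; lra. Qed.
Let w_ge0 i : 0 <= w i. Proof. by have /andP[/ltW] := w01 i. Qed.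
Let k_gt0 i : 0 < k i. Proof. exact: weight_power_gt0. Qed.

Lemma weight_powerE i r : k i `^ r = w i `^ (2 * p / (p - 2) * r).
Proof. by rewrite /weight_power -powRrM. Qed.

Lemma weight_sqr i : k i `^ (1 - 2 / p) = w i ^+ 2.
Proof.
rewrite weight_powerE -powR_mulrn//; congr (_ `^ _).
by field; rewrite p_neq0 p2_neq0.
Qed.

(** A generator has modulus k^(-1/p) on an event of measure k: this is its second moment, and the
    next lemma its p-th moment. *)
Lemma generator_scale_sqr i : k i `^ (- p^-1) ^+ 2 * k i = w i ^+ 2.
Proof.
rewrite -weight_sqr -powR_mulrn ?powR_ge0// -powRrM.
rewrite -[X in _ * X](@powRr1 R) ?ltW// -powRD; last by rewrite (gt_eqF (k_gt0 i)) implybT.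
by congr (_ `^ _); by field; rewrite ?p_neq0 ?p2_neq0.
Qed.

Lemma generator_scale_powR i : (k i `^ (- p^-1) ^+ 2) `^ (p / 2) * k i = 1.
Proof.
move: (k i) (k_gt0 i) => c c0.
rewrite -powR_mulrn ?powR_ge0// -!powRrM -{2}(powRr1 (ltW c0)).
rewrite -powRD; last by rewrite (gt_eqF c0) implybT.
by rewrite (_ : _ + 1 = 0) ?powRr0//; field; rewrite p_neq0.
Qed.

Definition block a i m N (x : cube R) : R := \sum_(m <= n < N) a n * y i n x.

Let bm_cst c := @bounded_measurable_cst _ (cube R) R c.
Let bm_y i n : bounded_measurable (y i n).
Proof. exact: bounded_measurable_generator. Qed.
Let bm_ay a i n : bounded_measurable (fun x => a n * y i n x).
Proof. exact: bounded_measurableM. Qed.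

Lemma bounded_measurable_block a i m N : bounded_measurable (block a i m N).
Proof. by apply: bounded_measurable_sum => n; exact: bm_ay. Qed.

Lemma block_ltn a i m N x : (m < N)%N ->
  block a i m N x = block a i m.+1 N x + a m * y i m x.
Proof. by move=> mN; rewrite /block big_ltn// addrC. Qed.

Lemma block_geq a i m N x : (N <= m)%N -> block a i m N x = 0.
Proof. by move=> Nm; rewrite /block big_geq. Qed.

Lemma block_on_coord_neq a i j m N g x : j != i ->
  block a j m N (on_coord i g x) = block a j m N x.
Proof.
by move=> ji; apply: eq_bigr => n _; rewrite generator_on_coord_neq.
Qed.

(** A shift fixes only the Rademacher functions of larger index, and so sums are peeled from the
    lowest index upwards. *)
Lemma block_shift a i m N : exists2 g, unit_preserving g &
  (forall x, block a i m.+1 N (on_coord i g x) = block a i m.+1 N x) /\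
  (forall x, a m * y i m (on_coord i g x) = - (a m * y i m x)).
Proof.
have [g gP [g1 g2]] := generator_shift p2 w01 i m; exists g => //; split=> x.
  by rewrite /block !big_nat; apply: eq_bigr => n /andP[mn _]; rewrite g2.
by rewrite g1 mulrN.
Qed.

Lemma block_reflection a i m N : exists2 g, unit_preserving g &
  forall x, block a i m N (on_coord i g x) = - block a i m N x.
Proof.
have [g gP g1] := generator_reflection p2 w01 i; exists g => // x.
by rewrite /block -sumrN; apply: eq_bigr => n _; rewrite g1 mulrN.
Qed.

Let preserving i g : unit_preserving g -> measurable_fun setT (on_coord i g) /\
  forall E, measurable E -> P (on_coord i g @^-1` E) = P E.
Proof.
by move=> gP; split; [apply: measurable_on_coord; case: gP|exact: on_coord_preserving].
Qed.

Lemma mean_generator_invariant i n h : bounded_measurable h ->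
  (forall x, 0 <= h x) -> (forall g x, h (on_coord i g x) = h x) ->
  mean P (fun x => h x * y i n x ^+ 2) = w i ^+ 2 * mean P h.
Proof.
move=> hh h0 hi.
by rewrite mean_generator_sqr// mean_coord_le// mulrA generator_scale_sqr.
Qed.

(** Orthogonality: the shift kills the cross terms. The factor h is carried along so that it can be
    a power of the sum over the other coordinates in [rosenthal]. *)
Lemma mean_block_sqr a i m N h : bounded_measurable h ->
  (forall x, 0 <= h x) -> (forall g x, h (on_coord i g x) = h x) ->
  mean P (fun x => h x * block a i m N x ^+ 2) =
  w i ^+ 2 * (\sum_(m <= n < N) a n ^+ 2) * mean P h.
Proof.
move=> hh h0 hi.
have [d dE] : exists d, (N - m)%N = d by exists (N - m)%N.
elim: d m dE => [|d IH] m dE.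
  rewrite big_geq; last by rewrite -subn_eq0 dE.
  rewrite mulr0 mul0r -[RHS](mean_cst P 0); apply: eq_mean => x.
  by rewrite block_geq ?expr0n ?mulr0// -subn_eq0 dE.
have mN : (m < N)%N by rewrite -subn_gt0 dE.
have hB := bounded_measurable_block a i m.+1 N.
have hBh := bounded_measurableM hh (bounded_measurableX 2 hB).
have hay := bm_ay a i m.
have hc : bounded_measurable (fun x => 2 * (h x * block a i m.+1 N x * (a m * y i m x))).
  by do 2 apply: bounded_measurableM => //; exact: bounded_measurableM.
have hy := bounded_measurableM hh (bounded_measurableX 2 (bm_y i m)).
have hy' : bounded_measurable (fun x => a m ^+ 2 * (h x * y i m x ^+ 2)).
  exact: bounded_measurableM.
rewrite (eq_mean P (g := fun x => h x * block a i m.+1 N x ^+ 2 +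
  (2 * (h x * block a i m.+1 N x * (a m * y i m x)) +
   a m ^+ 2 * (h x * y i m x ^+ 2)))); last first.
  by move=> x; rewrite block_ltn//; ring.
rewrite meanD//; last exact: bounded_measurableD.
rewrite meanD// meanZ//; last by apply: bounded_measurableM => //; exact: bounded_measurableM.
rewrite meanZ// IH; last by rewrite subnS dE.
rewrite mean_generator_invariant//.
have [g gP [g1 g2]] := block_shift a i m N.
have [mU PU] := preserving i gP.
rewrite (@mean_flip0 _ _ _ _ (on_coord i g) (fun x => h x * block a i m.+1 N x)
  (fun x => a m * y i m x))//; last 2 first.
- by split=> // x; rewrite hi g1.
- exact: bounded_measurableM.
rewrite mulr0 add0r [in RHS]big_ltn//; ring.
Qed.

(** |y|^p is majorised by 1 / k_i times the indicator of an event of measure k_i. *)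
Lemma mean_generator_powR_le i n : mean P (fun x => `|y i n x| `^ p) <= 1.
Proof.
have p20 := p2.
have p0 : 0 <= p / 2 by lra.
have hD : bounded_measurable (\1_(coord_le p w i) : cube R -> R).
  by apply: bounded_measurable_indic; exact: measurable_coord_le.
have -> : 1 = mean P (fun x => (k i `^ (- p^-1) ^+ 2) `^ (p / 2) *
    (1 * \1_(coord_le p w i) x)).
  rewrite meanZ; last exact: bounded_measurableM.
  rewrite mean_coord_le//.
  by rewrite mean_cst mulr1 generator_scale_powR.
apply: ler_mean.
- by apply: bounded_measurable_abs_powR => //; lra.
- by do 2 apply: bounded_measurableM => //.
- move=> x; rewrite -powR_sqr mul1r.
  apply: le_trans (ge0_lerP p0 (sqr_ge0 _) (generator_sqr_le _ _ _ _ _)) _ => //.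
  rewrite powRM ?sqr_ge0// indicE ler_wpM2l ?powR_ge0//.
  by case: (_ \in _); rewrite ?powR1// powR0// gt_eqF//; lra.
Qed.

(** The two terms of the conclusion of [moment_recursion], with D the step constant and both sums
    estimated by the square sum of the coefficients. *)
Definition khintchine_const : R :=
  2 * step_const p + (2 * step_const p) `^ (p / 2).

Lemma khintchine_const_ge0 : 0 <= khintchine_const.
Proof.
by rewrite addr_ge0 ?powR_ge0// mulr_ge0// step_const_ge0// ltW.
Qed.

(** The recursion removes one generator at a time, with b m = a_m^2 and c m = |a_m|^p. The sum of
    the c m is at most the (p/2)-th power of the square sum, and the constant depends on p alone. *)
Lemma khintchine a i N : mean P (fun x => `|block a i 0 N x| `^ p) <=
  khintchine_const * (\sum_(0 <= n < N) a n ^+ 2) `^ (p / 2).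
Proof.
have p20 := p2.
have p0 : 0 < p by lra.
have p2' : 2 <= p by lra.
have D0 : 0 <= step_const p by exact: step_const_ge0.
have hB m := bounded_measurable_block a i m N.
have M0 m : 0 <= mean P (fun x => `|block a i m N x| `^ p).
  by apply: mean_ge0 => x; exact: powR_ge0.
have ME m : (m < N)%N -> mean P (fun x => `|block a i m N x| `^ p) =
    mean P (fun x => `|block a i m.+1 N x + a m * y i m x| `^ p).
  by move=> mN; apply: eq_mean => x; rewrite block_ltn.
have hfl m : exists U, flips P U (block a i m.+1 N) (fun x => a m * y i m x).
  have [g gP [g1 g2]] := block_shift a i m N.
  by have [mU PU] := preserving i gP; exists (on_coord i g); split.
have Ma m : mean P (fun x => `|a m * y i m x| `^ p) <= `|a m| `^ p.
  rewrite (eq_mean P (g := fun x => `|a m| `^ p * `|y i m x| `^ p)); last first.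
    by move=> x; rewrite normrM powRM.
  rewrite meanZ; last by apply: bounded_measurable_abs_powR => //; exact: ltW.
  by rewrite ler_piMr ?powR_ge0// mean_generator_powR_le.
apply: le_trans (@moment_recursion R p (step_const p)
  (fun m => mean P (fun x => `|block a i m N x| `^ p))
  (fun m => a m ^+ 2) (fun m => `|a m| `^ p) N _ _ _ _ _ _ _ _) _ => //.
- by move=> m; exact: sqr_ge0.
- rewrite -[RHS](mean_cst P 0); apply: eq_mean => x.
  by rewrite block_geq// normr0 powR0// gt_eqF.
- move=> m mN; rewrite (ME m mN); have [U hU] := hfl m.
  have := mean_flip_ge hU (hB m.+1) (bm_ay a i m) p2'.
  apply: le_trans.
  by rewrite lerDl; apply: mean_ge0 => x; exact: powR_ge0.
- move=> m mN; rewrite (ME m mN); have [U hU] := hfl m.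
  have := mean_flip_le hU (hB m.+1) (bm_ay a i m) p2'.
  move=> /le_trans; apply.
  rewrite lerD2l ler_wpM2l// lerD//.
  have hS : bounded_measurable (fun x => `|block a i m.+1 N x| `^ (p - 2)).
    by apply: bounded_measurable_abs_powR => //; lra.
  have hy2 := bounded_measurableX 2 (bm_y i m).
  rewrite (eq_mean P (g := fun x => a m ^+ 2 *
    (`|block a i m.+1 N x| `^ (p - 2) * y i m x ^+ 2))); last first.
    by move=> x; rewrite exprMn mulrCA.
  rewrite meanZ; last exact: bounded_measurableM.
  rewrite ler_wpM2l ?sqr_ge0//.
  (* Hoelder with exponents p/(p-2) and p/2 separates the remaining sum from the generator, whose
     factor is at most 1. *)
  apply: le_trans (@mean_hoelder _ _ _ P _ _ (p / (p - 2)) (p / 2) _ _ _ hS hy2 _ _) _.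
  + by rewrite divr_gt0//; lra.
  + by rewrite divr_gt0.
  + by field; rewrite ?p_neq0 ?p2_neq0.
  + by move=> x; exact: powR_ge0.
  + by move=> x; exact: sqr_ge0.
  rewrite (eq_mean P (g := fun x => `|block a i m.+1 N x| `^ p)); last first.
    by move=> x; rewrite -powRrM; congr (_ `^ _); field; rewrite ?p_neq0 ?p2_neq0.
  rewrite [X in _ * X `^ _](eq_mean P (g :=
    fun x => `|y i m x| `^ p)); last by move=> x; rewrite powR_sqr.
  rewrite invf_div ler_piMr ?powR_ge0// invf_div.
  rewrite [X in _ <= X](_ : _ = 1 `^ (2 / p)); last by rewrite powR1.
  apply: ge0_lerP.
  + by rewrite divr_ge0//; lra.
  + by apply: mean_ge0 => x; exact: powR_ge0.
  + exact: mean_generator_powR_le.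
set s := \sum_(0 <= n < N) a n ^+ 2.
have s0 : 0 <= s by apply: sumr_ge0 => n _; exact: sqr_ge0.
have : \sum_(0 <= m < N) `|a m| `^ p <= s `^ (p / 2).
  under eq_bigr => n _ do rewrite -powR_sqr.
  apply: sum_powR_le => [|n]; [lra|exact: sqr_ge0].
rewrite !(mulrA 2) (powRM _ _ s0) ?mulr_ge0// => h.
rewrite /khintchine_const [leRHS]mulrDl lerD2r.
by rewrite ler_wpM2l ?mulr_ge0.
Qed.

(** Hoelder on the event [coord_le] compares second and p-th moments. The measure of the event
    contributes k_i^(1-2/p) = w_i^2, which cancels the w_i^2 of the second moment and leaves the
    constant 1. *)
Lemma block_powR_ge a i N :
  (\sum_(0 <= n < N) a n ^+ 2) `^ (p / 2) <=
  mean P (fun x => `|block a i 0 N x| `^ p).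
Proof.
have p20 := p2.
have p0 : 0 < p by lra.
have hB := bounded_measurable_block a i 0 N.
have hB2 := bounded_measurableX 2 hB.
have hD : bounded_measurable (\1_(coord_le p w i) : cube R -> R).
  by apply: bounded_measurable_indic; exact: measurable_coord_le.
set s := \sum_(0 <= n < N) _.
have s0 : 0 <= s by apply: sumr_ge0 => n _; exact: sqr_ge0.
set M := mean P _; have M0 : 0 <= M by apply: mean_ge0 => x; exact: powR_ge0.
have y0 n x : x \notin coord_le p w i -> y i n x = 0.
  move=> xD; apply/eqP; rewrite -sqrf_eq0 eq_le sqr_ge0 andbT.
  apply: le_trans (generator_sqr_le _ _ _ _ _) _ => //.
  by rewrite indicE (negPf xD) mulr0.
have : w i ^+ 2 * s <= M `^ (2 / p) * w i ^+ 2.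
  have -> : w i ^+ 2 * s = mean P (fun x => block a i 0 N x ^+ 2 * \1_(coord_le p w i) x).
    have := @mean_block_sqr a i 0 N (cst 1) (bm_cst 1) (fun=> ler01) (fun _ _ => erefl).
    rewrite mean_cst mulr1 => <-; apply: eq_mean => x; rewrite mul1r indicE.
    have [xD|xD] := boolP (x \in _); rewrite ?mulr1// mulr0.
    rewrite /block big1 ?expr0n// => n _; by rewrite y0// mulr0.
  apply: le_trans (@mean_hoelder _ _ _ P _ _ (p / 2) (p / (p - 2)) _ _ _ hB2 hD _ _) _.
  + by rewrite divr_gt0.
  + by rewrite divr_gt0//; lra.
  + by field; rewrite ?p_neq0 ?p2_neq0.
  + by move=> x; exact: sqr_ge0.
  + by move=> x; rewrite indicE; case: (_ \in _).
  rewrite (eq_mean P (g := fun x => `|block a i 0 N x| `^ p)); last first.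
    by move=> x; rewrite powR_sqr.
  rewrite [X in _ * X `^ _](eq_mean P (g :=
    fun x => 1 * \1_(coord_le p w i) x)); last first.
    move=> x; rewrite mul1r indicE.
    case: (_ \in _); rewrite ?powR1// powR0// mulf_neq0 ?invr_eq0//; lra.
  rewrite mean_coord_le//.
  rewrite mean_cst mulr1 !invf_div -/M.
  rewrite (_ : (p - 2) / p = 1 - 2 / p); last by field; rewrite ?p_neq0 ?p2_neq0.
  by rewrite weight_sqr.
have w0 : 0 < w i ^+ 2 by rewrite exprn_gt0//; have /andP[] := w01 i.
rewrite mulrC ler_pM2r// => /(ge0_lerP _ s0) h.
have p2p : 0 <= p / 2 by lra.
apply: le_trans (h _ p2p) _.
by rewrite -powRrM (_ : 2 / p * (p / 2) = 1) ?powRr1//; field; rewrite ?p_neq0 ?p2_neq0.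
Qed.

End blocks.

(** * Rosenthal's inequality across the coordinates *)

Section rosenthal.
Context {R : realType} (P : probability (cube R) R) (hP : product_lebesgue P).
Variables (p : R) (w : nat -> R) (p2 : 2 < p) (w01 : forall n, 0 < w n <= 1).
Notation y := (generator p w).
Implicit Types (a : nat -> nat -> R).

Let p2' : 2 <= p. Proof. exact: ltW. Qed.
Let p_gt0 : 0 < p. Proof. exact: lt_trans p2. Qed.

Definition blocks a m I N (x : cube R) : R :=
  \sum_(m <= i < I) block p w (a i) i 0 N x.

Definition sqnorm a N i : R := \sum_(0 <= n < N) a i n ^+ 2.

Lemma sqnorm_ge0 a N i : 0 <= sqnorm a N i.
Proof. by apply: sumr_ge0 => n _; exact: sqr_ge0. Qed.

Lemma bounded_measurable_blocks a m I N : bounded_measurable (blocks a m I N).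
Proof. by apply: bounded_measurable_sum => i; exact: bounded_measurable_block. Qed.

Let bm_block a i N := bounded_measurable_block p w (a i) i 0 N.

Lemma blocks_ltn a m I N x : (m < I)%N ->
  blocks a m I N x = blocks a m.+1 I N x + block p w (a m) m 0 N x.
Proof. by move=> mI; rewrite /blocks big_ltn// addrC. Qed.

Lemma blocks_geq a m I N x : (I <= m)%N -> blocks a m I N x = 0.
Proof. by move=> Im; rewrite /blocks big_geq. Qed.

Lemma blocks_on_coord a m I N g x :
  blocks a m.+1 I N (on_coord m g x) = blocks a m.+1 I N x.
Proof.
rewrite /blocks !big_nat; apply: eq_bigr => i /andP[mi _].
by rewrite block_on_coord_neq// gt_eqF.
Qed.

(** Reflecting the coordinate m flips its block, and the later blocks do not see that coordinate. *)
Lemma blocks_flip a m I N : exists U,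
  flips P U (blocks a m.+1 I N) (block p w (a m) m 0 N).
Proof.
have [g gP g1] := block_reflection p2 w01 (a m) m 0 N.
exists (on_coord m g); split.
- by apply: measurable_on_coord; case: gP.
- exact: on_coord_preserving.
- by move=> x; exact: blocks_on_coord.
- exact: g1.
Qed.

Let M0 a m I N : 0 <= mean P (fun x => `|blocks a m I N x| `^ p).
Proof. by apply: mean_ge0 => x; exact: powR_ge0. Qed.

Let ME a m I N : (m < I)%N -> mean P (fun x => `|blocks a m I N x| `^ p) =
  mean P (fun x => `|blocks a m.+1 I N x + block p w (a m) m 0 N x| `^ p).
Proof. by move=> mI; apply: eq_mean => x; rewrite blocks_ltn. Qed.

Let down_ind (Q : nat -> Prop) I : (forall m, (I <= m)%N -> Q m) ->
  (forall m, (m < I)%N -> Q m.+1 -> Q m) -> forall m, Q m.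
Proof.
move=> Q0 QS m; have [d] : exists d, (I - m)%N = d by exists (I - m)%N.
elim: d m => [|d IH] m dE; first by apply: Q0; rewrite -subn_eq0 dE.
by apply: QS; [rewrite -subn_gt0 dE|apply: IH; rewrite subnS dE].
Qed.

Lemma mean_blocks_sqr a m I N : mean P (fun x => blocks a m I N x ^+ 2) =
  \sum_(m <= i < I) w i ^+ 2 * sqnorm a N i.
Proof.
move: m; apply: (@down_ind _ I) => [m Im|m mI IH].
  rewrite big_geq// -[RHS](mean_cst P 0); apply: eq_mean => x.
  by rewrite blocks_geq// expr0n.
have hS := bounded_measurable_blocks a m.+1 I N.
have hf := bm_block a m N.
have hSf := bounded_measurableM hS hf.
have hS2 := bounded_measurableX 2 hS.
have hf2 := bounded_measurableX 2 hf.
have h2 : bounded_measurable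
    (fun x => 2 * (blocks a m.+1 I N x * block p w (a m) m 0 N x)).
  by apply: bounded_measurableM => //; exact: bounded_measurable_cst.
rewrite (eq_mean P (g := fun x => blocks a m.+1 I N x ^+ 2 +
  (2 * (blocks a m.+1 I N x * block p w (a m) m 0 N x) +
   block p w (a m) m 0 N x ^+ 2))); last first.
  by move=> x; rewrite blocks_ltn//; ring.
rewrite meanD//; last exact: bounded_measurableD.
rewrite meanD// meanZ// IH; have [U hU] := blocks_flip a m I N.
rewrite (mean_flip0 hU)// mulr0 add0r [in RHS]big_ltn// [RHS]addrC; congr (_ + _).
have := mean_block_sqr hP p2 w01 (a m) (i := m) 0 N
  (@bounded_measurable_cst _ (cube R) R 1) (fun=> ler01) (fun _ _ => erefl).
by rewrite mean_cst mulr1 => <-; apply: eq_mean => x; rewrite mul1r.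
Qed.

Lemma blocks_sqr_le a I N : \sum_(0 <= i < I) w i ^+ 2 * sqnorm a N i <=
  mean P (fun x => `|blocks a 0 I N x| `^ p) `^ (2 / p).
Proof.
rewrite -mean_blocks_sqr.
have := @mean_powR_mono _ _ _ P _ 2 p (ltr0Sn _ 1) p2' (bounded_measurable_blocks a 0 I N).
by under eq_mean => x do rewrite powR_mulrn// real_normK ?num_real//.
Qed.

Lemma blocks_powR_ge a m I N :
  \sum_(m <= i < I) mean P (fun x => `|block p w (a i) i 0 N x| `^ p) <=
  mean P (fun x => `|blocks a m I N x| `^ p).
Proof.
move: m; apply: (@down_ind _ I) => [m Im|m mI IH]; first by rewrite big_geq.
rewrite big_ltn// ME//; have [U hU] := blocks_flip a m I N.
have := mean_flip_ge hU (bounded_measurable_blocks a m.+1 I N) (bm_block a m N) p2'.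
by apply: le_trans; rewrite addrC lerD2r.
Qed.

Lemma blocks_sqnorm_le a I N : \sum_(0 <= i < I) sqnorm a N i `^ (p / 2) <=
  mean P (fun x => `|blocks a 0 I N x| `^ p).
Proof.
apply: le_trans (blocks_powR_ge a 0 I N); apply: ler_sum => i _.
exact: block_powR_ge.
Qed.

(** The same recursion, now removing whole blocks. The mixed term factors exactly because the later
    blocks do not depend on the coordinate m, so w_m^2 appears there in place of 1; [khintchine]
    bounds the p-th moment of each block. *)
Lemma rosenthal a I N : mean P (fun x => `|blocks a 0 I N x| `^ p) <=
  2 * (step_const p * khintchine_const p) *
    (\sum_(0 <= i < I) sqnorm a N i `^ (p / 2)) +
  (2 * step_const p) `^ (p / 2) *
    (\sum_(0 <= i < I) w i ^+ 2 * sqnorm a N i) `^ (p / 2).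
Proof.
have D0 : 0 <= step_const p by exact: step_const_ge0.
have hB m := bounded_measurable_blocks a m I N.
have b0 m : 0 <= w m ^+ 2 * sqnorm a N m by rewrite mulr_ge0 ?sqr_ge0 ?sqnorm_ge0.
have c0 m : 0 <= mean P (fun x => `|block p w (a m) m 0 N x| `^ p).
  by apply: mean_ge0 => x; exact: powR_ge0.
have := @moment_recursion R p (step_const p)
  (fun m => mean P (fun x => `|blocks a m I N x| `^ p))
  (fun m => w m ^+ 2 * sqnorm a N m)
  (fun m => mean P (fun x => `|block p w (a m) m 0 N x| `^ p)) I p2 D0
  (fun m => M0 a m I N) b0 c0.
have -> : mean P (fun x => `|blocks a I I N x| `^ p) = 0.
  rewrite -[RHS](mean_cst P 0); apply: eq_mean => x.
  by rewrite blocks_geq// normr0 powR0// gt_eqF.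
move=> /(_ erefl) H.
have {}H := H _ _.
apply: le_trans (H _ _) _ => [m mI|m mI|].
- rewrite /= (@ME a m I N mI); have [U hU] := blocks_flip a m I N.
  have := mean_flip_ge hU (hB m.+1) (bm_block a m N) p2'.
  move=> h; apply: (le_trans _ h); rewrite lerDl; exact: c0.
- rewrite /= (@ME a m I N mI); have [U hU] := blocks_flip a m I N.
  have := mean_flip_le hU (hB m.+1) (bm_block a m N) p2'.
  move=> h; apply: (le_trans h); rewrite lerD2l ler_wpM2l// lerD2r.
  have p20 : 0 < p - 2 by rewrite subr_gt0.
  have hS : bounded_measurable (fun x => `|blocks a m.+1 I N x| `^ (p - 2)).
    by apply: bounded_measurable_abs_powR => //; exact: ltW.
  rewrite (mean_block_sqr hP p2 w01 (a m) 0 N hS).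
  + rewrite ler_wpM2l//; apply: mean_powR_mono => //.
    by rewrite gerBl.
  + by move=> x; exact: powR_ge0.
  + by move=> g x; rewrite blocks_on_coord.
rewrite !(mulrA 2) powRM ?mulr_ge0 ?sumr_ge0// lerD2r.
rewrite -[leRHS]mulrA ler_wpM2l ?mulr_ge0// mulr_sumr.
by apply: ler_sum => i _; exact: khintchine.
Qed.

End rosenthal.

(** * Retracts and duals *)

Section bounded_linear.
Context {R : realType}.
Implicit Types U V W : normedModType R.

Lemma continuous_linear_ex U V (f : U -> V) : linear f ->
  (exists C, forall x, `|f x| <= C * `|x|) ->
  exists2 F : {linear U -> V}, continuous F & F =1 f.
Proof.
move=> lf [C fC].
pose F := HB.pack_for {linear U -> V} f (GRing.isLinear.Build R U V *:%R f lf).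
exists F => //; apply/linear_bounded_continuous/linear_boundedP.
near=> M => x; apply: le_trans (fC x) _.
by apply: ler_wpM2r.
Unshelve. all: by end_near. Qed.

Lemma continuous_linear_bound U V (f : {linear U -> V}) : continuous f ->
  exists2 C, 0 < C & forall x, `|f x| <= C * `|x|.
Proof.
by move=> /linear_bounded_continuous/linear_boundedP/pinfty_ex_gt0[M M0 fM]; exists M.
Qed.

(** The identity of U factors through V. Unlike a projection with its range, this form composes and
    dualises directly. *)
Definition retract U V := exists (J : {linear U -> V}) (K : {linear V -> U}),
  [/\ continuous J, continuous K & cancel J K].

Lemma retract_intro U V (j : U -> V) (k : V -> U) : linear j -> linear k ->
  (exists C, forall x, `|j x| <= C * `|x|) ->
  (exists C, forall x, `|k x| <= C * `|x|) -> cancel j k -> retract U V.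
Proof.
move=> lj lk bj bk jk.
have [J cJ JE] := continuous_linear_ex lj bj.
have [K cK KE] := continuous_linear_ex lk bk.
by exists J, K; split => // x; rewrite JE KE jk.
Qed.

Lemma retract_trans U V W : retract U V -> retract V W -> retract U W.
Proof.
move=> [J [K [cJ cK JK]]] [J' [K' [cJ' cK' JK']]].
exists (J' \o J : {linear U -> W}), (K \o K' : {linear W -> U}); split.
- by move=> x; apply: continuous_comp; [exact: cJ|exact: cJ'].
- by move=> x; apply: continuous_comp; [exact: cK'|exact: cK].
- by move=> x /=; rewrite JK' JK.
Qed.

(** J K is the projection, and J is an isomorphism onto its range with inverse the restriction of
    K. *)
Lemma retract_complemented U V : retract U V -> complemented_embeds U V.
Proof.
move=> [J [K [cJ cK JK]]].
exists (J \o K : {linear V -> V}); split.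
- by move=> x; apply: continuous_comp; [exact: cK|exact: cJ].
- by move=> x /=; rewrite JK.
set hR := linear_subspace_range _.
have inR x : subsp_pred hR (J x).
  by apply/mem_set; exists (J x) => //=; rewrite JK.
pose f x : subsp hR := exist _ (J x) (inR x).
pose g (z : subsp hR) : U := K (val z).
have lf : linear f by move=> a x y; apply: val_inj; rewrite /= linearP.
have lg : linear g by move=> a x y; rewrite /g linearP.
have [CJ _ hJ] := continuous_linear_bound cJ.
have [CK _ hK] := continuous_linear_bound cK.
have [F cF FE] : exists2 F : {linear U -> subsp hR}, continuous F & F =1 f.
  by apply: continuous_linear_ex => //; exists CJ => x; exact: hJ.
have [G cG GE] : exists2 G : {linear subsp hR -> U}, continuous G & G =1 g.
  by apply: continuous_linear_ex => //; exists CK => x; exact: hK.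
exists F, G; split => // x; rewrite GE FE /f /g//=.
apply: val_inj => /=; have := valP x; rewrite /subsp_pred => /set_mem[y _ <-] /=.
by rewrite JK.
Qed.

Lemma retract_fst U V : retract U (U * V)%type.
Proof.
apply: (@retract_intro _ _ (fun x => (x, 0)) (fun z : (U * V)%type => z.1)) => //.
- by move=> a x y; congr pair; rewrite /= ?scaler0 ?addr0.
- by exists 1 => x; rewrite mul1r prod_normE/= normr0 ge_max lexx normr_ge0.
- by exists 1 => x; rewrite mul1r prod_normE/= le_max lexx.
Qed.

Lemma retract_snd U V : retract V (U * V)%type.
Proof.
apply: (@retract_intro _ _ (fun x => (0, x)) (fun z : (U * V)%type => z.2)) => //.
- by move=> a x y; congr pair; rewrite /= ?scaler0 ?addr0.
- by exists 1 => x; rewrite mul1r prod_normE/= normr0 ge_max lexx normr_ge0.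
- by exists 1 => x; rewrite mul1r prod_normE/= le_max lexx orbT.
Qed.

Lemma retract_prod U U' V V' : retract U U' -> retract V V' ->
  retract (U * V)%type (U' * V')%type.
Proof.
move=> [J [K [cJ cK JK]]] [J' [K' [cJ' cK' JK']]].
have [C C0 hJ] := continuous_linear_bound cJ.
have [C' C'0 hJ'] := continuous_linear_bound cJ'.
have [D D0 hK] := continuous_linear_bound cK.
have [D' D'0 hK'] := continuous_linear_bound cK'.
have bound (W1 W2 W1' W2' : normedModType R) (f : W1 -> W1') (g : W2 -> W2') B B' :
    0 < B -> 0 < B' -> (forall x, `|f x| <= B * `|x|) ->
    (forall x, `|g x| <= B' * `|x|) ->
    exists E, forall z : (W1 * W2)%type, `|(f z.1, g z.2)| <= E * `|z|.
  move=> B0 B'0 fB gB; exists (B + B') => z.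
  rewrite !prod_normE/= ge_max; apply/andP; split.
    apply: le_trans (fB _) _; apply: ler_pM => //; first exact: ltW.
      by rewrite lerDl ltW.
    by rewrite le_max lexx.
  apply: le_trans (gB _) _; apply: ler_pM => //; first exact: ltW.
    by rewrite lerDr ltW.
  by rewrite le_max lexx orbT.
apply: (@retract_intro _ _ (fun z : (U * V)%type => (J z.1, J' z.2))
  (fun z : (U' * V')%type => (K z.1, K' z.2))).
- by move=> a x y; congr pair; rewrite linearP.
- by move=> a x y; congr pair; rewrite linearP.
- exact: bound C0 C'0 hJ hJ'.
- exact: bound D0 D'0 hK hK'.
- by move=> [x y] /=; rewrite JK JK'.
Qed.

Section dual_facts.
Variable U : normedModType R.
Implicit Types f : dual_space U.

Lemma dual_linearP f : linear (val f : U -> R^o).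
Proof. by have /asboolP[] := valP f. Qed.

Lemma dualD f x y : val f (x + y) = val f x + val f y.
Proof. by have := dual_linearP f 1 x y; rewrite !scale1r. Qed.

Lemma dual0 f : val f 0 = 0.
Proof. by apply: (addrI (val f 0)); rewrite -dualD !addr0. Qed.

Lemma dualZ f a x : val f (a *: x) = a * val f x.
Proof. by have := dual_linearP f a x 0; rewrite !addr0 dual0 addr0. Qed.

Lemma val_dualP (f g : dual_space U) a x :
  val (a *: f + g) x = a * val f x + val g x.
Proof. by []. Qed.

Lemma dual_sum f I (s : seq I) (x : I -> U) :
  val f (\sum_(i <- s) x i) = \sum_(i <- s) val f (x i).
Proof.
elim: s => [|i s IH]; first by rewrite !big_nil dual0.
by rewrite !big_cons dualD IH.
Qed.

Let dual_bound f : exists2 C, 0 < C & forall x, `|val f x| <= C * `|x|.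
Proof.
have /asboolP[lf cf] := valP f.
pose g := HB.pack_for {linear U -> R^o} (val f : U -> R^o)
  (GRing.isLinear.Build R U R^o *:%R (val f) lf).
exact: (@continuous_linear_bound U R^o g).
Qed.

Lemma dual_norm_ge f x : `|val f x| <= `|f| * `|x|.
Proof.
have [->|x0] := eqVneq x 0; first by rewrite dual0 !normr0 mulr0.
have nx : 0 < `|x| by rewrite normr_gt0.
have : `|val f (`|x|^-1 *: x)| <= `|f|.
  apply: ub_le_sup; last by exists (`|x|^-1 *: x) => //=; rewrite normfZV.
  have [C C0 fC] := dual_bound f; exists C => _ [z z1 <-].
  by apply: le_trans (fC z) _; rewrite ler_piMr// ltW.
by rewrite dualZ normrM normfV normr_id mulrC ler_pdivrMr.
Qed.

Lemma dual_norm_le f C : 0 <= C -> (forall x, `|val f x| <= C * `|x|) -> `|f| <= C.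
Proof.
move=> C0 fC; apply: ge_sup; first by exists `|val f 0|, 0 => //=; rewrite normr0.
by move=> _ [z z1 <-]; apply: le_trans (fC z) _; rewrite ler_piMr.
Qed.

Lemma dual_ex (f : U -> R) : linear (f : U -> R^o) ->
  (exists C, forall x, `|f x| <= C * `|x|) -> dual_pred (f : U -> R^o).
Proof.
move=> lf bf; apply/asboolP; split => //.
by have [F cF FE] := @continuous_linear_ex U R^o f lf bf; rewrite -(funext FE).
Qed.

End dual_facts.

Definition mk_dual U (f : U -> R^o) (hf : dual_pred f) : dual_space U :=
  exist _ f hf.

(** Taking adjoints exchanges the roles: the adjoint of K embeds and that of J retracts. *)
Lemma retract_dual U V : retract U V -> retract (dual_space U) (dual_space V).
Proof.
move=> [J [K [cJ cK JK]]].
have comp_dual (W W' : normedModType R) (f : dual_space W) (T : {linear W' -> W}) :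
    continuous T -> dual_pred (val f \o T : W' -> R^o).
  move=> cT; apply: dual_ex.
    by move=> a x y; rewrite /= linearP dual_linearP.
  have [C C0 hT] := continuous_linear_bound cT; exists (`|f| * C) => x.
  by apply: le_trans (dual_norm_ge f _) _; rewrite -mulrA ler_wpM2l.
have comp_bound (W W' : normedModType R) (T : {linear W' -> W}) (cT : continuous T) :
    exists C, forall f : dual_space W,
      `|mk_dual (comp_dual _ _ f T cT)| <= C * `|f|.
  have [C C0 hT] := continuous_linear_bound cT; exists C => f.
  apply: dual_norm_le => [|x]; first by rewrite mulr_ge0// ltW.
  apply: le_trans (dual_norm_ge f _) _.
  by rewrite (mulrC C) -mulrA ler_wpM2l//; exact: hT.
pose K' (f : dual_space U) : dual_space V := mk_dual (comp_dual _ _ f K cK).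
pose J' (f : dual_space V) : dual_space U := mk_dual (comp_dual _ _ f J cJ).
apply: (@retract_intro (dual_space U) (dual_space V) K' J').
- by move=> a f g; apply: val_inj.
- by move=> a f g; apply: val_inj.
- exact: comp_bound.
- exact: comp_bound.
- by move=> f; apply: val_inj; apply/funext => x /=; rewrite JK.
Qed.

(** A pair of functionals acts by the sum of its values; restricting to the two factors recovers the
    pair. *)
Lemma retract_dual_prod U V :
  retract (dual_space U * dual_space V)%type (dual_space (U * V)%type).
Proof.
have jd (fg : (dual_space U * dual_space V)%type) :
    dual_pred ((fun z => val fg.1 z.1 + val fg.2 z.2) : (U * V)%type -> R^o).
  apply: dual_ex.
    by move=> a x y /=; rewrite !dual_linearP scalerDr addrACA.
  exists (`|fg.1| + `|fg.2|) => z; apply: le_trans (ler_normD _ _) _.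
  rewrite mulrDl; apply: lerD; apply: le_trans (dual_norm_ge _ _) _;
  by rewrite ler_wpM2l// prod_normE le_max lexx ?orbT.
have kd1 (f : dual_space (U * V)%type) :
    dual_pred ((fun x => val f (x, 0)) : U -> R^o).
  apply: dual_ex.
    move=> a x y /=; rewrite -dual_linearP; congr (val f _).
    by congr pair; rewrite /= ?scaler0 ?addr0.
  exists `|f| => x; apply: le_trans (dual_norm_ge _ _) _.
  by rewrite ler_wpM2l// prod_normE/= normr0 ge_max lexx normr_ge0.
have kd2 (f : dual_space (U * V)%type) :
    dual_pred ((fun x => val f (0, x)) : V -> R^o).
  apply: dual_ex.
    move=> a x y /=; rewrite -dual_linearP; congr (val f _).
    by congr pair; rewrite /= ?scaler0 ?addr0.
  exists `|f| => x; apply: le_trans (dual_norm_ge _ _) _.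
  by rewrite ler_wpM2l// prod_normE/= normr0 ge_max lexx normr_ge0.
pose J (fg : (dual_space U * dual_space V)%type) : dual_space (U * V)%type :=
  mk_dual (jd fg).
have JE fg z : val (J fg) z = val fg.1 z.1 + val fg.2 z.2 by [].
pose K (f : dual_space (U * V)%type) : (dual_space U * dual_space V)%type :=
  (mk_dual (kd1 f), mk_dual (kd2 f)).
apply: (@retract_intro (dual_space U * dual_space V)%type
  (dual_space (U * V)%type) J K).
- move=> a f g; apply: val_inj; apply/funext => z.
  rewrite [RHS]val_dualP !JE.
  have -> : (a *: f + g).1 = a *: f.1 + g.1 by [].
  have -> : (a *: f + g).2 = a *: f.2 + g.2 by [].
  by rewrite !val_dualP mulrDr addrACA.
- by move=> a f g; congr pair; apply: val_inj.
- exists 2 => fg; apply: dual_norm_le => [|z]; first by rewrite mulr_ge0.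
  apply: le_trans (ler_normD _ _) _.
  rewrite -mulrA mulrDl mul1r; apply: lerD.
    apply: le_trans (dual_norm_ge fg.1 _) _.
    by apply: ler_pM => //; rewrite prod_normE le_max lexx ?orbT.
  apply: le_trans (dual_norm_ge fg.2 _) _.
  by apply: ler_pM => //; rewrite prod_normE le_max lexx ?orbT.
- exists 1 => f; rewrite mul1r prod_normE/= ge_max; apply/andP; split;
  apply: dual_norm_le => // x; apply: le_trans (dual_norm_ge f _) _;
  by rewrite ler_wpM2l// prod_normE/= normr0 ge_max lexx normr_ge0.
- move=> [f g]; congr pair; apply: val_inj; apply/funext => x /=.
    by rewrite dual0 addr0.
  by rewrite dual0 add0r.
Qed.

End bounded_linear.

(** * Sequence spaces *)

Section counting_norm.
Context {R : realType}.

(** Converts norm bounds into bounds on partial sums, so that infinite series of powers do not occur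
    afterwards. *)
Lemma Lnorm_counting_le (p : R) (x : nat -> R) C : 1 <= p -> 0 <= C ->
  ('N[counting]_p%:E[EFin \o x] <= C%:E)%E <->
  forall n, \sum_(0 <= k < n) `|x k| `^ p <= C `^ p.
Proof.
move=> p1 C0; have p0 : 0 < p by exact: lt_le_trans p1.
rewrite Lnorm_counting//.
rewrite (@eq_eseriesr _ _ (fun k => (`|x k| `^ p)%:E)); last first.
  by move=> k _; rewrite -poweR_EFin.
set S := (\sum_(k <oo) _)%E.
have S0 : (0 <= S)%E by apply: nneseries_ge0 => k _ _; rewrite lee_fin powR_ge0.
have SP : (S <= (C `^ p)%:E)%E <->
    forall n, \sum_(0 <= k < n) `|x k| `^ p <= C `^ p.
  split=> [SC n|H].
    rewrite -lee_fin -sumEFin; apply: le_trans SC.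
    by apply: nneseries_lim_ge => k _ _; rewrite lee_fin powR_ge0.
  apply: lime_le.
    by apply: is_cvg_nneseries => k _ _; rewrite lee_fin powR_ge0.
  by apply: nearW => n; rewrite sumEFin lee_fin.
rewrite -SP; split => h.
  have : ((S `^ p^-1) `^ p <= C%:E `^ p)%E.
    by apply: gt0_ler_poweR; rewrite ?in_itv/= ?leey ?lee_fin ?poweR_ge0 ?andbT// ltW.
  by rewrite -poweRrM mulVf ?gt_eqF// poweRe1.
have : (S `^ p^-1 <= (C `^ p)%:E `^ p^-1)%E.
  by apply: gt0_ler_poweR; rewrite ?in_itv/= ?leey ?S0 ?lee_fin ?powR_ge0 ?andbT// invr_ge0 ltW.
by rewrite poweR_EFin -powRrM divff ?gt_eqF// powRr1.
Qed.

End counting_norm.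

Lemma seq_linearP {R : realType} (V : lmodType R) a (f g : nat -> V) i :
  (a *: f + g) i = a *: f i + g i.
Proof. by []. Qed.

Section finite_norm_facts.
Context {R : realType} {V : lmodType R} (N : V -> \bar R)
  (hN : extended_norm N).

Lemma finite_normE (x : finite_norm_space hN) : `|x|%:E = N (val x).
Proof.
have [N0 _ _ _] := hN.
by rewrite -[LHS]/(fine (N (val x)))%:E fineK// ge0_fin_numE//; exact: (valP x).
Qed.

Lemma finite_norm_valP a (x y : finite_norm_space hN) :
  val (a *: x + y) = a *: val x + val y.
Proof. by []. Qed.

(** The way in which maps into sequence spaces are built: one bound yields both membership and
    boundedness. *)
Lemma finite_norm_lift (U : normedModType R) (f : U -> V) (C : R) :
  linear f -> (forall u, (N (f u) <= (C * `|u|)%:E)%E) ->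
  exists2 j : U -> finite_norm_space hN, linear j &
    (forall u, val (j u) = f u) /\ (forall u, `|j u| <= C * `|u|).
Proof.
move=> lf fC.
have fin u : finite_norm_pred hN (f u).
  exact: le_lt_trans (fC u) (ltry _).
exists (fun u => exist _ (f u) (fin u)); last split => // u.
  by move=> a u v; apply: val_inj; exact: lf.
by rewrite -lee_fin finite_normE; exact: fC.
Qed.

End finite_norm_facts.

Section ell2.
Context {R : realType}.

(** [ell2] is declared as a bare normed module; the coordinates are reached through its form as an
    [lp_sum]. *)
Definition ell2_coord (x : ell2 R) : nat -> R :=
  val (x : lp_sum (ler1n R 2) R^o).

Lemma ell2_coordP a (x y : ell2 R) n :
  ell2_coord (a *: x + y) n = a * ell2_coord x n + ell2_coord y n.
Proof. by []. Qed.

Lemma ell2_coord_inj (x y : ell2 R) : ell2_coord x =1 ell2_coord y -> x = y.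
Proof. by move=> xy; apply: val_inj; apply/funext => n; exact: xy. Qed.

Let Lnorm2_le (x : nat -> R) C : 0 <= C ->
  (lp_sum_norm 2 (x : nat -> R^o) <= C%:E)%E <->
  forall n, \sum_(0 <= k < n) x k ^+ 2 <= C ^+ 2.
Proof.
move=> C0; rewrite /lp_sum_norm Lnorm_counting_le ?ler1n//.
rewrite powR_mulrn//.
by split=> H n; apply: le_trans (H n); rewrite le_eqVlt; apply/orP; left;
  apply/eqP; apply: eq_bigr => k _; rewrite /= normr_id powR_mulrn//
  real_normK// num_real.
Qed.

Lemma ell2_norm_leP (x : ell2 R) C : 0 <= C ->
  `|x| <= C <-> forall n, \sum_(0 <= k < n) ell2_coord x k ^+ 2 <= C ^+ 2.
Proof.
move=> C0; rewrite -lee_fin.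
have -> : `|x|%:E = lp_sum_norm 2 (ell2_coord x : nat -> R^o).
  exact: (finite_normE (x : lp_sum (ler1n R 2) R^o)).
exact: Lnorm2_le.
Qed.

Lemma ell2_sum_le (x : ell2 R) n :
  \sum_(0 <= k < n) ell2_coord x k ^+ 2 <= `|x| ^+ 2.
Proof. by have /ell2_norm_leP := lexx `|x|; apply. Qed.

Lemma ell2_lift (U : normedModType R) (f : U -> nat -> R) (C : R) : 0 <= C ->
  (forall a u v n, f (a *: u + v) n = a * f u n + f v n) ->
  (forall u n, \sum_(0 <= k < n) f u k ^+ 2 <= (C * `|u|) ^+ 2) ->
  exists2 j : U -> ell2 R, linear j &
    (forall u, ell2_coord (j u) = f u) /\ (forall u, `|j u| <= C * `|u|).
Proof.
move=> C0 lf fC.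
have lf' : linear (f : U -> nat -> R^o).
  by move=> a u v; apply/funext => n; exact: lf.
have fC' u : (lp_sum_norm 2 (f u : nat -> R^o) <= (C * `|u|)%:E)%E.
  by apply/Lnorm2_le; rewrite ?mulr_ge0.
have [j lj [jE jC]] :=
  finite_norm_lift (extended_norm_lp_sum R^o (ler1n R 2)) lf' fC'.
by exists j.
Qed.

(* The powers of the partial sums exceed any fraction < 1 of the power of the
   norm, so no continuity of powers is needed. *)
Lemma ell2_sum_powR_le (r B : R) (x : nat -> ell2 R) I : 0 < r ->
  (forall n, \sum_(0 <= i < I)
     (\sum_(0 <= k < n) ell2_coord (x i) k ^+ 2) `^ (r / 2) <= B) ->
  \sum_(0 <= i < I) `|x i| `^ r <= B.
Proof.
move=> r0 H; pose s i n := \sum_(0 <= k < n) ell2_coord (x i) k ^+ 2.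
have s0 i n : 0 <= s i n by apply: sumr_ge0 => k _; exact: sqr_ge0.
have smono i n m : (n <= m)%N -> s i n <= s i m.
  move=> nm; rewrite /s [leRHS](big_cat_nat (n := n))//= lerDl.
  by apply: sumr_ge0 => k _; exact: sqr_ge0.
have r20 : 0 < r / 2 by rewrite divr_gt0.
suff frac t : 0 < t < 1 -> t * \sum_(0 <= i < I) `|x i| `^ r <= B.
  set S := \sum_(0 <= i < I) _ in frac *.
  rewrite leNgt; apply/negP => BS.
  have B0 : 0 <= B by apply: le_trans (H 0%N); apply: sumr_ge0 => i _; exact: powR_ge0.
  have S0 : 0 < S by exact: le_lt_trans BS.
  have u1 : B / S < 1 by rewrite ltr_pdivrMr// mul1r.
  have u0 : 0 <= B / S by rewrite divr_ge0// ltW.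
  have e : B / S * S = B by rewrite divfK// gt_eqF.
  have t01 : 0 < (1 + B / S) / 2 < 1 by lra.
  by have := frac _ t01; rewrite -[leRHS]e ler_pM2r//; lra.
move=> /andP[t0 t1]; pose th := t `^ (2 / r).
have th1 : th < 1.
  have := @gt0_ltr_powR R (2 / r); rewrite divr_gt0// => /(_ isT t 1).
  by rewrite !nnegrE powR1 => ->//; exact: ltW.
have thE : th `^ (r / 2) = t.
  rewrite -powRrM (_ : 2 / r * (r / 2) = 1) ?powRr1//; first exact: ltW.
  by field; rewrite gt_eqF.
have step i : exists n, th * `|x i| ^+ 2 <= s i n.
  have [x0|x0] := eqVneq (x i) 0; first by exists 0%N; rewrite x0 normr0 expr0n mulr0.
  apply: contrapT => /forallNP h.
  have : `|x i| <= Num.sqrt th * `|x i|.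
    apply/ell2_norm_leP; first by rewrite mulr_ge0 ?sqrtr_ge0.
    move=> n; rewrite exprMn sqr_sqrtr ?powR_ge0//.
    by apply: ltW; rewrite ltNge; apply/negP; exact: h.
  have nx : 0 < `|x i| by rewrite normr_gt0.
  by rewrite ler_pMl// leNgt -[X in _ < X]sqrtr1 ltr_sqrt// th1 => /negP; apply.
have stepI J : exists n, forall i, (i < J)%N -> th * `|x i| ^+ 2 <= s i n.
  elim: J => [|J [n hn]]; first by exists 0%N.
  have [m hm] := step J; exists (maxn n m) => i; rewrite ltnS leq_eqVlt.
  move=> /predU1P[->|iJ]; first by apply: le_trans hm _; apply: smono; rewrite leq_maxr.
  by apply: le_trans (hn i iJ) _; apply: smono; rewrite leq_maxl.
have [n hn] := stepI I.
apply: le_trans (H n); rewrite mulr_sumr !big_nat; apply: ler_sum => i /andP[_ iI].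
rewrite -{1}thE -[X in _ * X](_ : (`|x i| ^+ 2) `^ (r / 2) = _); last first.
  by rewrite powR_sqr normr_id.
rewrite -powRM ?powR_ge0 ?sqr_ge0//; apply: ge0_lerP; [exact: ltW| |exact: hn].
by rewrite mulr_ge0 ?powR_ge0 ?sqr_ge0.
Qed.

End ell2.

(** * The weighted spaces with coefficients in l2 *)

Section weighted_sum.
Context {R : realType}.

Lemma lp_sum_norm_leP (p : R) (p1 : 1 <= p) (V : normedModType R)
    (x : lp_sum p1 V) C : 0 <= C ->
  `|x| <= C <-> forall n, \sum_(0 <= k < n) `|val x k| `^ p <= C `^ p.
Proof.
move=> C0; rewrite -lee_fin finite_normE Lnorm_counting_le//.
by split=> H n; apply: le_trans (H n); rewrite le_eqVlt; apply/orP; left;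
  apply/eqP; apply: eq_bigr => k _; rewrite normr_id.
Qed.

Let sqr_sum_leP (w x : nat -> R) C : 0 <= C ->
  ('N[counting]_2[EFin \o (fun n => w n * x n)%R] <= C%:E)%E <->
  forall n, \sum_(0 <= k < n) w k ^+ 2 * x k ^+ 2 <= C ^+ 2.
Proof.
move=> C0; rewrite Lnorm_counting_le ?ler1n// powR_mulrn//.
by split=> H n; apply: le_trans (H n); rewrite le_eqVlt; apply/orP; left;
  apply/eqP; apply: eq_bigr => k _; rewrite powR_mulrn// real_normK ?num_real// exprMn.
Qed.

Lemma Xpw_norm_leP (p : R) (p1 : 1 <= p) (w : nat -> R) (x : nat -> R) C :
  0 <= C -> (Xpw_norm p w x <= C%:E)%E <->
  (forall n, \sum_(0 <= k < n) `|x k| `^ p <= C `^ p) /\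
  (forall n, \sum_(0 <= k < n) w k ^+ 2 * x k ^+ 2 <= C ^+ 2).
Proof.
move=> C0; rewrite /Xpw_norm ge_max; split.
  by move=> /andP[/Lnorm_counting_le h1 /sqr_sum_leP h2]; split; [exact: h1|exact: h2].
by move=> [h1 h2]; apply/andP; split; [apply/Lnorm_counting_le|apply/sqr_sum_leP].
Qed.

(* The norm of X_(p,w) with coefficients in l2 in place of scalars. *)
Definition XH_norm (p : R) (w : nat -> R) (y : nat -> ell2 R) : \bar R :=
  Xpw_norm p w (fun n => `|y n|).

Lemma XH_norm_leP (p : R) (p1 : 1 <= p) (w : nat -> R) (y : nat -> ell2 R) C :
  0 <= C -> (XH_norm p w y <= C%:E)%E <->
  (forall n, \sum_(0 <= k < n) `|y k| `^ p <= C `^ p) /\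
  (forall n, \sum_(0 <= k < n) w k ^+ 2 * `|y k| ^+ 2 <= C ^+ 2).
Proof.
move=> C0; rewrite /XH_norm Xpw_norm_leP//.
suff e n : \sum_(0 <= k < n) `| `|y k| | `^ p = \sum_(0 <= k < n) `|y k| `^ p.
  by split=> -[h1 h2]; split => // n; move: (h1 n); rewrite e.
by apply: eq_bigr => k _; rewrite normr_id.
Qed.

(** The triangle inequality comes from that of [Xpw_norm] and its monotonicity on nonnegative
    sequences. *)
Lemma extended_norm_XH (p : R) (w : nat -> R) : 1 <= p ->
  extended_norm (XH_norm p w).
Proof.
move=> p1; have [N0 ND NZ Neq0] := extended_norm_Xpw w p1.
have mono (x y : nat -> R) : (forall n, 0 <= x n <= y n) ->
    (Xpw_norm p w x <= Xpw_norm p w y)%E.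
  move=> xy; have [yoo|] := ltP (Xpw_norm p w y) +oo%E; last first.
    by rewrite leye_eq => /eqP ->; rewrite leey.
  have yfin : Xpw_norm p w y \is a fin_num by rewrite ge0_fin_numE.
  rewrite -(fineK yfin); set C := fine _.
  have C0 : 0 <= C by exact: fine_ge0.
  have : (Xpw_norm p w y <= C%:E)%E by rewrite fineK.
  move=> /(Xpw_norm_leP p1 _ _ C0)[h1 h2]; apply/(Xpw_norm_leP p1 _ _ C0); split=> n.
    apply: le_trans (h1 n); apply: ler_sum => k _.
    have /andP[x0 xyk] := xy k.
    apply: ge0_lerP => //; first exact: le_trans p1.
    by rewrite (ger0_norm x0) (ger0_norm (le_trans x0 xyk)).
  apply: le_trans (h2 n); apply: ler_sum => k _.
  have /andP[x0 xyk] := xy k; rewrite ler_wpM2l ?sqr_ge0//.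
  by rewrite lerXn2r// nnegrE (le_trans x0 xyk).
split=> [y|x y|a y|y].
- exact: N0.
- apply: le_trans (ND _ _); apply: mono => n.
  by rewrite normr_ge0 ler_normD.
- rewrite /XH_norm -(normr_id a) -NZ; congr (Xpw_norm p w _).
  by apply/funext => n; rewrite normrZ.
- move=> /Neq0 y0; apply/funext => n; apply/eqP.
  by rewrite -normr_eq0; have /= -> := congr1 (@^~ n) y0.
Qed.

Definition XH (p : R) (p1 : 1 <= p) (w : nat -> R) :=
  finite_norm_space (extended_norm_XH w p1).

Lemma XH_sum_le (p : R) (p1 : 1 <= p) (w : nat -> R) (y : XH p1 w) :
  (forall n, \sum_(0 <= k < n) `|val y k| `^ p <= `|y| `^ p) /\
  (forall n, \sum_(0 <= k < n) w k ^+ 2 * `|val y k| ^+ 2 <= `|y| ^+ 2).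
Proof. by apply/XH_norm_leP => //; rewrite finite_normE. Qed.

End weighted_sum.

(** * Limits of sequences in normed spaces *)

Section sequential_limits.
Context {R : realType}.
Implicit Types U V : normedModType R.

(** A property and not a structure, since it is to be proved for the quotient, subspace and dual
    types, which are equipped as normed modules only. *)
Definition seq_complete V := forall u : nat -> V,
  (forall e, 0 < e -> exists N, forall m n, (N <= m)%N -> (m <= n)%N ->
     `|u n - u m| <= e) ->
  exists l : V, u @ \oo --> l.

Lemma cvg_seq_sum V (I : Type) (s : seq I) (u : I -> nat -> V) (l : I -> V) :
  (forall i, u i n @[n --> \oo] --> l i) ->
  \sum_(i <- s) u i n @[n --> \oo] --> \sum_(i <- s) l i.
Proof.
move=> ul; elim: s => [|i s IH].
  by rewrite big_nil; under eq_fun => n do rewrite big_nil; exact: cvg_cst.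
rewrite big_cons; under eq_fun => n do rewrite big_cons.
by apply: cvgD; [exact: ul|exact: IH].
Qed.

Lemma cvg_seq_near V (u : nat -> V) l e : u @ \oo --> l -> 0 < e ->
  exists N, forall n, (N <= n)%N -> `|l - u n| < e.
Proof. by move=> /cvgrPdist_lt h e0; have [N _ hN] := h e e0; exists N => n /hN. Qed.

Lemma cvg_norm_le V (u : nat -> V) l B : u @ \oo --> l ->
  (forall n, `|u n| <= B) -> `|l| <= B.
Proof.
move=> ul uB; rewrite leNgt; apply/negP => Bl.
have /(cvg_seq_near ul)[N /(_ N (leqnn N)) h] : 0 < `|l| - B by rewrite subr_gt0.
have := uB N; have := ler_normD (l - u N) (u N); rewrite subrK; lra.
Qed.

(** Reads a coefficient off a series: along the partial sums a biorthogonal functional is eventually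
    constant. *)
Lemma cvg_functional V (u : nat -> V) l (b : V -> R) C c N0 :
  (forall a x y, b (a *: x + y) = a * b x + b y) ->
  (forall x, `|b x| <= C * `|x|) -> u @ \oo --> l ->
  (forall n, (N0 <= n)%N -> b (u n) = c) -> b l = c.
Proof.
move=> lb bC ul bu; apply/eqP; rewrite -subr_eq0 -normr_le0 leNgt; apply/negP => h.
have C0 : 0 < `|C| + 1 by rewrite ltr_wpDl.
have /(cvg_seq_near ul)[N hN] : 0 < `|b l - c| / (`|C| + 1) by rewrite divr_gt0.
have := hN (maxn N N0) (leq_maxl _ _); rewrite ltr_pdivlMr//.
have := bu (maxn N N0) (leq_maxr _ _); set m := maxn _ _ => bm.
have : b (l - u m) = b l - c.
  by rewrite -bm -[l - _]addrC -scaleN1r lb mulN1r addrC.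
have := bC (l - u m) => + e; rewrite e => h1 h2.
have h3 : C * `|l - u m| <= `|C| * `|l - u m| by rewrite ler_wpM2r// ler_norm.
have h4 := normr_ge0 (l - u m).
lra.
Qed.

Lemma limit_linear U V (S : nat -> U -> V) : (forall n, linear (S n)) ->
  (forall x, exists l : V, S n x @[n --> \oo] --> l) ->
  exists2 L : U -> V, linear L & forall x, S n x @[n --> \oo] --> L x.
Proof.
move=> lS /choice[L LS]; exists L => // a x y.
apply: (@cvg_unique _ (@norm_hausdorff _ V) _ _ _ _ (LS (a *: x + y))).
rewrite (_ : (fun n => S n _) = (fun n => a *: S n x + S n y)); last first.
  by apply/funext => n; exact: lS.
by apply: cvgD; [apply: cvgZl_tmp; exact: LS|exact: LS].
Qed.

Lemma bounded_tail (t : nat -> R) B : (forall n, 0 <= t n) ->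
  (forall n, \sum_(0 <= k < n) t k <= B) -> forall e, 0 < e ->
  exists N, forall m n, (N <= m)%N -> (m <= n)%N -> \sum_(m <= k < n) t k <= e.
Proof.
move=> t0 tB e e0; pose A := range (fun n => \sum_(0 <= k < n) t k).
have hA : has_sup A.
  by split; [exists 0, 0%N => //; rewrite big_nil|exists B => _ [n _ <-]].
have [_ [N _ <-] hN] := sup_adherent e0 hA.
exists N => m n Nm mn.
have : \sum_(0 <= k < n) t k <= sup A by apply: ub_le_sup; [exact: hA.2|exists n].
rewrite (big_cat_nat (n := m))//= (big_cat_nat (n := N) (p := m))//=.
have : 0 <= \sum_(N <= k < m) t k by apply: sumr_ge0.
lra.
Qed.

End sequential_limits.

(** * Retracts from biorthogonal systems *)

Section synthesis.
Context {R : realType} (V : normedModType R) (hV : seq_complete V).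
Variables (p : R) (p1 : 1 <= p) (w : nat -> R) (g : nat -> nat -> V) (C : R).

Let p_gt0 : 0 < p. Proof. exact: lt_le_trans p1. Qed.

Let sq (c : nat -> nat -> R) N i := \sum_(0 <= n < N) c i n ^+ 2.

Hypotheses (C0 : 0 <= C) (gC : forall c I N,
  `|\sum_(0 <= i < I) \sum_(0 <= n < N) c i n *: g i n| <=
  C * ((\sum_(0 <= i < I) sq c N i `^ (p / 2)) `^ p^-1 +
       (\sum_(0 <= i < I) w i ^+ 2 * sq c N i) `^ 2^-1)).

Let sq_ge0 c N i : 0 <= sq c N i.
Proof. by apply: sumr_ge0 => n _; exact: sqr_ge0. Qed.

Let sum_from (W : zmodType) m I (F : nat -> W) :
  \sum_(0 <= i < I) (if (m <= i)%N then F i else 0) = \sum_(m <= i < I) F i.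
Proof. by rewrite -big_mkcond (big_nat_widenl m 0). Qed.

(** The hypothesis is applied to coefficients set to 0 on the rows before m; this gives the tail
    estimates needed for Cauchy sequences. *)
Let gC_from c m I N :
  `|\sum_(m <= i < I) \sum_(0 <= n < N) c i n *: g i n| <=
  C * ((\sum_(m <= i < I) sq c N i `^ (p / 2)) `^ p^-1 +
       (\sum_(m <= i < I) w i ^+ 2 * sq c N i) `^ 2^-1).
Proof.
pose c' i n := if (m <= i)%N then c i n else 0.
have e1 i : \sum_(0 <= n < N) c' i n *: g i n =
    if (m <= i)%N then \sum_(0 <= n < N) c i n *: g i n else 0.
  rewrite /c'; case: ifP => // _; rewrite big1// => n _; exact: scale0r.
have e2 i : sq c' N i = if (m <= i)%N then sq c N i else 0.
  by rewrite /sq /c'; case: ifP => // _; rewrite big1// => n _; rewrite expr0n.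
have := gC c' I N; under eq_bigr => i _ do rewrite e1; rewrite sum_from.
have -> : \sum_(0 <= i < I) sq c' N i `^ (p / 2) =
    \sum_(m <= i < I) sq c N i `^ (p / 2).
  rewrite -[RHS]sum_from; apply: eq_bigr => i _; rewrite e2; case: ifP => // _.
  by rewrite powR0// mulf_neq0 ?invr_neq0// gt_eqF.
suff -> : \sum_(0 <= i < I) w i ^+ 2 * sq c' N i =
    \sum_(m <= i < I) w i ^+ 2 * sq c N i by [].
by rewrite -[RHS]sum_from; apply: eq_bigr => i _; rewrite e2; case: ifP; rewrite ?mulr0.
Qed.

(** A single row: both terms of the bound become multiples of the l2 norm, with factors 1 and
    |w_i|. *)
Let gC_seg i (x : nat -> R) m N :
  `|\sum_(m <= n < N) x n *: g i n| <=
  C * (1 + `|w i|) * (\sum_(m <= n < N) x n ^+ 2) `^ 2^-1.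
Proof.
pose c (j n : nat) := if (m <= n)%N then x n else 0.
have := gC_from c i i.+1 N; rewrite !big_nat1.
have -> : sq c N i = \sum_(m <= n < N) x n ^+ 2.
  by rewrite /sq -[RHS]sum_from; apply: eq_bigr => n _; rewrite /c; case: ifP; rewrite ?expr0n.
have -> : \sum_(0 <= n < N) c i n *: g i n = \sum_(m <= n < N) x n *: g i n.
  by rewrite -[RHS]sum_from; apply: eq_bigr => n _; rewrite /c; case: ifP; rewrite ?scale0r.
set s := \sum_(m <= n < N) x n ^+ 2; set v := `|_|.
have s0 : 0 <= s by apply: sumr_ge0 => n _; exact: sqr_ge0.
rewrite powRM ?sqr_ge0// -powRrM (_ : p / 2 * p^-1 = 2^-1); last first.
  by field; rewrite gt_eqF.
rewrite (_ : (w i ^+ 2) `^ 2^-1 = `|w i|); last first.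
  by rewrite -[2^-1]mul1r powR_sqr powRr1.
by rewrite -{1}[s `^ _]mul1r -mulrDl mulrA.
Qed.

Let powR_le_eps (t e q : R) : 0 < q -> 0 <= t -> 0 < e -> t <= e `^ q -> t `^ q^-1 <= e.
Proof.
move=> q0 t0 e0 te; have qi : 0 <= q^-1 by rewrite invr_ge0 ltW.
apply: le_trans (ge0_lerP qi t0 te) _.
by rewrite -powRrM divff ?gt_eqF// powRr1// ltW.
Qed.

Let ell2_synthesis i : exists2 G : ell2 R -> V, linear G &
  forall x, \sum_(0 <= n < N) ell2_coord x n *: g i n @[N --> \oo] --> G x.
Proof.
apply: (@limit_linear _ _ V (fun N x => \sum_(0 <= n < N) ell2_coord x n *: g i n)).
  move=> N a x y; rewrite scaler_sumr -big_split/=; apply: eq_bigr => n _.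
  by rewrite ell2_coordP scalerDl scalerA.
move=> x; apply: hV => e e0.
set D := C * (1 + `|w i|); have D0 : 0 < D + 1.
  by rewrite ltr_wpDl// mulr_ge0// addr_ge0.
have e'0 : 0 < (e / (D + 1)) `^ 2 by apply: powR_gt0; rewrite divr_gt0.
have [N hN] := @bounded_tail R (fun n => ell2_coord x n ^+ 2) _
  (fun n => sqr_ge0 _) (ell2_sum_le x) _ e'0.
exists N => m n Nm mn.
rewrite [X in X - _](big_cat_nat (n := m))//= addrAC subrr add0r.
apply: le_trans (gC_seg i _ m n) _; rewrite -/D.
have h : (\sum_(m <= n0 < n) ell2_coord x n0 ^+ 2) `^ 2^-1 <= e / (D + 1).
  apply: powR_le_eps => //; [|by rewrite divr_gt0|exact: hN].
  by apply: sumr_ge0 => k _; exact: sqr_ge0.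
have D00 : 0 <= D by rewrite mulr_ge0// addr_ge0.
apply: le_trans (ler_wpM2l D00 h) _.
by rewrite mulrA ler_pdivrMr// mulrC ler_wpM2l ?(ltW e0)// lerDl.
Qed.

(** Each row is summed in l2 before the rows are added. The bound on finite arrays passes to the
    limit in each row, and the convergence of both scalar sums in the norm then makes the sums of
    rows Cauchy. Each of these two sums contributes one norm, whence 2 * C. *)
Lemma XH_synthesis : exists G : nat -> ell2 R -> V, exists J : XH p1 w -> V,
  [/\ forall i x, \sum_(0 <= n < N) ell2_coord x n *: g i n @[N --> \oo] --> G i x,
      linear J, forall y, `|J y| <= (2 * C) * `|y| &
      forall y, \sum_(0 <= i < I) G i (val y i) @[I --> \oo] --> J y].
Proof.
have /choice[G GP] : forall i, exists Gi : ell2 R -> V, linear Gi /\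
    forall x, \sum_(0 <= n < N) ell2_coord x n *: g i n @[N --> \oo] --> Gi x.
  by move=> i; have [Gi lG cG] := ell2_synthesis i; exists Gi.
have lG i : linear (G i) by case: (GP i).
have cG i x := proj2 (GP i) x.
have segP (y : nat -> ell2 R) m I : `|\sum_(m <= i < I) G i (y i)| <=
    C * ((\sum_(m <= i < I) `|y i| `^ p) `^ p^-1 +
         (\sum_(m <= i < I) w i ^+ 2 * `|y i| ^+ 2) `^ 2^-1).
  apply: (@cvg_norm_le _ V (fun N => \sum_(m <= i < I)
      \sum_(0 <= n < N) ell2_coord (y i) n *: g i n)).
    by apply: cvg_seq_sum => i; exact: cG.
  move=> N; apply: le_trans (gC_from (fun i => ell2_coord (y i)) m I N) _.
  have sy i : sq (fun i => ell2_coord (y i)) N i <= `|y i| ^+ 2 by exact: ell2_sum_le.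
  have pi0 : 0 <= p^-1 by rewrite invr_ge0 ltW.
  apply: ler_wpM2l => //; apply: lerD; apply: ge0_lerP => //.
  - by apply: sumr_ge0 => i _; exact: powR_ge0.
  - apply: ler_sum => i _; rewrite -[`|y i|]normr_id -powR_sqr.
    by apply: ge0_lerP => //; rewrite divr_ge0// ltW.
  - by apply: sumr_ge0 => i _; rewrite mulr_ge0 ?sqr_ge0.
  - by apply: ler_sum => i _; rewrite ler_wpM2l ?sqr_ge0.
have [J lJ cJ] : exists2 J : XH p1 w -> V, linear J &
    forall y, \sum_(0 <= i < I) G i (val y i) @[I --> \oo] --> J y.
  apply: (@limit_linear _ _ V (fun I (y : XH p1 w) => \sum_(0 <= i < I) G i (val y i))).
    move=> I a x y; rewrite scaler_sumr -big_split/=; apply: eq_bigr => i _.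
    by rewrite -lG.
  move=> y; apply: hV => e e0; have [y1 y2] := XH_sum_le y.
  have C1 : 0 < 2 * (C + 1) by rewrite mulr_gt0// ltr_wpDl.
  have e'0 : 0 < e / (2 * (C + 1)) by rewrite divr_gt0.
  have [N1 h1] := @bounded_tail R _ _ (fun i => powR_ge0 _ _) y1 _ (powR_gt0 p e'0).
  have [N2 h2] := @bounded_tail R _ _
    (fun i => mulr_ge0 (sqr_ge0 (w i)) (sqr_ge0 `|val y i|)) y2 _ (powR_gt0 2 e'0).
  exists (maxn N1 N2) => m n; rewrite geq_max => /andP[N1m N2m] mn.
  rewrite [X in X - _](big_cat_nat (n := m))//= addrAC subrr add0r.
  apply: le_trans (segP _ m n) _.
  have k1 : (\sum_(m <= i < n) `|val y i| `^ p) `^ p^-1 <= e / (2 * (C + 1)).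
    apply: powR_le_eps => //; last exact: h1.
    by apply: sumr_ge0 => i _; exact: powR_ge0.
  have k2 : (\sum_(m <= i < n) w i ^+ 2 * `|val y i| ^+ 2) `^ 2^-1 <= e / (2 * (C + 1)).
    apply: powR_le_eps => //; last exact: h2.
    by apply: sumr_ge0 => i _; rewrite mulr_ge0 ?sqr_ge0.
  apply: le_trans (ler_wpM2l C0 (lerD k1 k2)) _.
  have -> : C * (e / (2 * (C + 1)) + e / (2 * (C + 1))) = e * (C / (C + 1)).
    by field; rewrite gt_eqF// ltr_wpDl.
  by rewrite ger_pMr// ler_pdivrMr ?mul1r ?lerDl// ltr_wpDl.
exists G, J; split => // y.
apply: (cvg_norm_le (cJ y)) => I; apply: le_trans (segP _ 0%N I) _.
have [y1 y2] := XH_sum_le y.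
rewrite [2 * C]mulrC -mulrA ler_wpM2l// mulrDl mul1r.
have le_root q (t : R) : 0 < q -> 0 <= t -> t <= `|y| `^ q -> t `^ q^-1 <= `|y|.
  move=> q0 t0 ty; have qi : 0 <= q^-1 by rewrite invr_ge0 ltW.
  apply: le_trans (ge0_lerP qi t0 ty) _.
  by rewrite -powRrM divff ?gt_eqF// powRr1.
apply: lerD; apply: le_root => //.
- by apply: sumr_ge0 => i _; exact: powR_ge0.
- by apply: sumr_ge0 => i _; rewrite mulr_ge0 ?sqr_ge0.
- by rewrite powR_mulrn.
Qed.

Variables (b : nat -> nat -> V -> R) (C' : R).
Hypotheses (C'0 : 0 <= C')
  (b_lin : forall i n a x y, b i n (a *: x + y) = a * b i n x + b i n y)
  (bg : forall i n j m, b i n (g j m) = ((i == j) && (n == m))%:R)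
  (b1 : forall v I N, \sum_(0 <= i < I) (\sum_(0 <= n < N) b i n v ^+ 2) `^ (p / 2)
          <= (C' * `|v|) `^ p)
  (b2 : forall v I N, \sum_(0 <= i < I) w i ^+ 2 * \sum_(0 <= n < N) b i n v ^+ 2
          <= (C' * `|v|) ^+ 2).

(** J is the synthesis map, and K collects the values of the functionals b, which lie in the
    sequence space by [b1] and [b2]. Biorthogonality gives K J = id coordinate by coordinate. *)
Lemma XH_retract : retract (XH p1 w) V.
Proof.
have [G [J [cG lJ JC cJ]]] := XH_synthesis.
have Cv v : 0 <= C' * `|v| by rewrite mulr_ge0.
(* A single term of [b1], raised to the power 2/p, shows that each row of coefficients lies in
   l2. *)
have bs i N v : \sum_(0 <= n < N) b i n v ^+ 2 <= (C' * `|v|) ^+ 2.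
  set s := \sum_(0 <= n < N) _.
  have s0 : 0 <= s by apply: sumr_ge0 => n _; exact: sqr_ge0.
  have : s `^ (p / 2) <= (C' * `|v|) `^ p.
    apply: le_trans (b1 v i.+1 N); rewrite big_nat_recr//= lerDr.
    by apply: sumr_ge0 => j _; exact: powR_ge0.
  have p20 : 0 <= 2 / p by rewrite divr_ge0// ltW.
  move=> /(ge0_lerP p20 (powR_ge0 _ _)).
  rewrite -!powRrM (_ : p / 2 * (2 / p) = 1); last by field; rewrite gt_eqF.
  by rewrite powRr1// (_ : p * (2 / p) = 2%:R) ?powR_mulrn//; field; rewrite gt_eqF.
have b_bound i n v : `|b i n v| <= C' * `|v|.
  rewrite -ler_sqr ?nnegrE// real_normK ?num_real//.
  apply: le_trans (bs i n.+1 v); rewrite big_nat_recr//= lerDr.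
  by apply: sumr_ge0 => j _; exact: sqr_ge0.
have b0 i n : b i n 0 = 0.
  by have := b_lin i n (-1) 0 0; rewrite scaler0 addr0 mulN1r addNr.
have b_sum i n m N (x : nat -> V) :
    b i n (\sum_(m <= k < N) x k) = \sum_(m <= k < N) b i n (x k).
  apply: (big_morph (b i n)) => // u v.
  by rewrite -[u]scale1r b_lin mul1r scale1r.
have bZ i n a v : b i n (a *: v) = a * b i n v.
  by rewrite -[a *: v]addr0 b_lin b0 addr0.
have /choice[k kP] : forall i, exists ki : V -> ell2 R, linear ki /\
    forall v, ell2_coord (ki v) = fun n => b i n v.
  move=> i.
  have [ki lki [kiE _]] := @ell2_lift R V (fun v n => b i n v) C' C'0
    (fun a u v n => b_lin i n a u v) (fun v N => bs i N v).
  by exists ki.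
have kE i v n : ell2_coord (k i v) n = b i n v by case: (kP i) => _ ->.
have lk : linear (fun v i => k i v) by move=> a u v; apply/funext => i; case: (kP i) => ->.
have [K lK [KE KC]] : exists2 K : V -> XH p1 w, linear K &
    (forall v, val (K v) = fun i => k i v) /\ (forall v, `|K v| <= C' * `|v|).
  apply: finite_norm_lift => // v; apply/XH_norm_leP => //; split=> I.
    apply: ell2_sum_powR_le => // N.
    by under eq_bigr => i _ do (under eq_bigr => n _ do rewrite kE).
  (* Exponent 2 and the vectors w_i k_i(v) turn [b2] into the second half of the norm. *)
  have := @ell2_sum_powR_le R 2 ((C' * `|v|) ^+ 2) (fun i => w i *: k i v) I (ltr0Sn _ 1).
  under eq_bigr => i _ do rewrite powR_mulrn// normrZ exprMn real_normK ?num_real//.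
  apply=> N; apply: le_trans (b2 v I N); rewrite le_eqVlt; apply/orP; left; apply/eqP.
  apply: eq_bigr => i _; rewrite divff// powRr1; last first.
    by apply: sumr_ge0 => n _; exact: sqr_ge0.
  rewrite mulr_sumr; apply: eq_bigr => n _; rewrite -kE.
  have := ell2_coordP (w i) (k i v) 0 n; rewrite !addr0 => ->.
  by rewrite exprMn.
apply: (retract_intro lJ lK); [by exists (2 * C)|by exists C'|].
move=> y; apply: val_inj; apply/funext => i; rewrite KE; apply: ell2_coord_inj => n.
rewrite kE.
(* Two limits are undone in turn: within the row j here, and over the rows afterwards. *)
have bG j x : b i n (G j x) = if i == j then ell2_coord x n else 0.
  apply: (cvg_functional (N0 := n.+1) (b_lin i n) (b_bound i n) (cG j x)) => N nN.
  rewrite b_sum; under eq_bigr => m _ do rewrite bZ bg.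
  case: eqP => _; last by rewrite big1// => m _; rewrite mulr0.
  rewrite (big_cat_nat (n := n.+1))//= big_nat_recr//= eqxx mulr1.
  rewrite [X in X + _ + _]big_nat big1 => [|m /andP[_ mn]]; last first.
    by rewrite gt_eqF ?mulr0.
  rewrite [X in _ + _ + X]big_nat big1 => [|m /andP[mn _]]; last first.
    by rewrite lt_eqF ?mulr0.
  by rewrite add0r addr0.
apply: (cvg_functional (N0 := i.+1) (b_lin i n) (b_bound i n) (cJ y)) => I iI.
rewrite b_sum; under eq_bigr => m _ do rewrite bG.
rewrite (big_cat_nat (n := i.+1))//= big_nat_recr//= eqxx.
rewrite [X in X + _ + _]big_nat big1 => [|m /andP[_ mn]]; last by rewrite gt_eqF.
rewrite [X in _ + _ + X]big_nat big1 => [|m /andP[mn _]]; last by rewrite lt_eqF.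
by rewrite add0r addr0.
Qed.

End synthesis.

(** * Blocks of weights *)

Section block_partition.
Context {R : realType} (p : R) (p2 : 2 < p) (w : nat -> R).
Hypotheses (w_gt0 : forall n, 0 < w n) (w_star : condition_star p w).
Notation k := (weight_power p w).

Let ex : R := 2 * p / (p - 2).
Let ex_gt0 : 0 < ex.
Proof. by have := p2 => ?; rewrite divr_gt0//; lra. Qed.
Let p_neq0 : p != 0. Proof. by have := p2 => ?; rewrite gt_eqF//; lra. Qed.
Let p2_neq0 : p - 2 != 0.
Proof. by have := p2 => ?; rewrite gt_eqF//; lra. Qed.

Let kE r i : k i `^ r = w i `^ (ex * r).
Proof. by rewrite /weight_power -powRrM. Qed.

(* Condition (star) provides finitely many small weights after s whose
   powers k add up to a prescribed size, up to a factor 2. *)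
Lemma block_exists s t : 0 < t -> exists M (q : nat -> R),
  [/\ (s < M)%N, forall i, 0 <= q i, \sum_(s <= i < M) q i = 1,
      forall i, w i ^+ 2 * q i `^ (2 / p) <= t ^+ 2 * q i &
      forall i, t ^+ 2 * q i `^ (1 - 2 / p) <= 2 * w i ^+ 2].
Proof.
move=> t0; have p20 := p2.
pose T := t `^ ex; have T0 : 0 < T by exact: powR_gt0.
(* Weights below e have k at most T / 2. Adding such terms until T / 2 is reached therefore cannot
   exceed T. *)
pose e := (T / 2) `^ ex^-1; have e0 : 0 < e by rewrite powR_gt0// divr_gt0.
pose c i : R := if w i < e then k i else 0.
have c0 i : 0 <= c i by rewrite /c; case: ifP => // _; exact: powR_ge0.
have cT i : c i <= T / 2.
  rewrite /c; case: ifPn => wi; last by rewrite divr_ge0// ltW.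
  have -> : T / 2 = e `^ ex.
    by rewrite -powRrM mulVf ?gt_eqF// powRr1// divr_ge0// ltW.
  by apply: ge0_lerP; rewrite ltW.
have unbounded B : exists n, B <= \sum_(0 <= i < n) c i.
  apply: contrapT => /forallNP h.
  have := w_star e0; apply/eqP; rewrite lt_eqF//.
  apply: (@le_lt_trans _ _ B%:E); last by rewrite ltry.
  apply: lime_le.
    by apply: is_cvg_nneseries_cond => i _ _; rewrite lee_fin powR_ge0.
  apply: nearW => n; rewrite sumEFin lee_fin big_mkcond/=.
  by apply: ltW; rewrite ltNge; apply/negP; exact: h.
pose S n := \sum_(0 <= i < n) c i.
have hM : exists M, S s + T / 2 <= S M by exact: unbounded.
pose M := ex_minn hM.
have [SM Mmin] : S s + T / 2 <= S M /\ forall n, S s + T / 2 <= S n -> (M <= n)%N.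
  by rewrite /M; case: ex_minnP.
have T20 : 0 < T / 2 by rewrite divr_gt0.
have Smono n m : (n <= m)%N -> S n <= S m.
  move=> nm; rewrite /S [leRHS](big_cat_nat (n := n))//= lerDl.
  by apply: sumr_ge0.
have sM : (s < M)%N.
  by rewrite ltnNge; apply/negP => /Smono; lra.
pose beta := \sum_(s <= i < M) c i.
have SbM : S M = S s + beta by rewrite /S (big_cat_nat (n := s))//= ltnW.
have b1 : T / 2 <= beta by move: SM; rewrite SbM; lra.
have b2 : beta <= T.
  move: SbM Mmin sM b1; case: (M) => // N SbN Nmin sN b1.
  have : S N < S s + T / 2.
    by rewrite ltNge; apply/negP => /Nmin; rewrite ltnn.
  by move: SbN; rewrite {1}/S big_nat_recr//= -/(S N); have := cT N; lra.
have b0 : 0 < beta by lra.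
(* With k_i = q_i beta on the support of q, the bound beta <= T yields the first inequality and T <=
   2 beta the second. *)
pose q i := c i / beta.
have q0 i : 0 <= q i by rewrite divr_ge0// ltW.
have r0 : 0 <= 1 - 2 / p by rewrite subr_ge0 ler_pdivrMr ?mul1r; lra.
have exE : ex * (1 - 2 / p) = 2%:R by rewrite /ex; field; rewrite p_neq0 p2_neq0.
have w2E i : k i `^ (1 - 2 / p) = w i ^+ 2.
  by rewrite kE exE powR_mulrn// ltW.
have t2E : T `^ (1 - 2 / p) = t ^+ 2.
  by rewrite -powRrM exE powR_mulrn// ltW.
exists M, q; split => // [|i|i].
- by rewrite -mulr_suml divff// gt_eqF.
- have := q0 i; rewrite le_eqVlt => /predU1P[<-|qi].
    by rewrite powR0 ?mulr0// mulf_neq0 ?invr_neq0.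
  have ci : c i = q i * beta by rewrite divfK// gt_eqF.
  have wi : k i = q i * beta.
    rewrite -ci /c; case: ifPn => // wi; move: qi.
    by rewrite /q /c (negPf wi) mul0r ltxx.
  rewrite -w2E wi powRM ?(ltW b0)// mulrAC -powRD; last by rewrite (gt_eqF qi) implybT.
  rewrite subrK powRr1// mulrC ler_wpM2r// -t2E.
  by apply: ge0_lerP => //; exact: ltW.
- have := q0 i; rewrite le_eqVlt => /predU1P[<-|qi].
    rewrite powR0; first by rewrite mulr0 mulr_ge0 ?sqr_ge0.
    rewrite gt_eqF// subr_gt0 ltr_pdivrMr ?mul1r; lra.
  have ci : c i = q i * beta by rewrite divfK// gt_eqF.
  have wi : k i = q i * beta.
    rewrite -ci /c; case: ifPn => // wi; move: qi.
    by rewrite /q /c (negPf wi) mul0r ltxx.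
  rewrite -w2E wi powRM ?(ltW b0)// mulrCA mulrC ler_wpM2l ?powR_ge0//.
  rewrite -t2E; apply: (@le_trans _ _ ((2 * beta) `^ (1 - 2 / p))).
    by apply: ge0_lerP => //; lra.
  rewrite powRM ?(ltW b0)// ler_wpM2r ?powR_ge0//.
  rewrite -[X in _ <= X](powRr1 (ltW (ltr0Sn R 1))); apply: ler_powR.
    by rewrite ler1n.
  by rewrite gerBl divr_ge0//; lra.
Qed.

(** Each block begins where its predecessor ended, and the j-th one is built for the size u j. The
    map b sends an index to the block which contains it, so that q can be a single sequence. *)
Lemma block_partition (u : nat -> R) : (forall j, 0 < u j) ->
  exists (m : nat -> nat) (b : nat -> nat) (q : nat -> R),
  [/\ m 0%N = 0%N /\ (forall j, (m j < m j.+1)%N),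
      forall j i, (m j <= i < m j.+1)%N -> b i = j,
      (forall i, 0 <= q i) /\ (forall j, \sum_(m j <= i < m j.+1) q i = 1),
      forall i, w i ^+ 2 * q i `^ (2 / p) <= u (b i) ^+ 2 * q i &
      forall i, u (b i) ^+ 2 * q i `^ (1 - 2 / p) <= 2 * w i ^+ 2].
Proof.
move=> u0.
have /choice[F FP] : forall sj : nat * nat, exists Mq : nat * (nat -> R),
    [/\ (sj.1 < Mq.1)%N, forall i, 0 <= Mq.2 i, \sum_(sj.1 <= i < Mq.1) Mq.2 i = 1,
      forall i, w i ^+ 2 * Mq.2 i `^ (2 / p) <= u sj.2 ^+ 2 * Mq.2 i &
      forall i, u sj.2 ^+ 2 * Mq.2 i `^ (1 - 2 / p) <= 2 * w i ^+ 2].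
  by move=> [s j]; have [M [q h]] := block_exists s (u0 j); exists (M, q).
pose m := fix m j := if j is j'.+1 then (F (m j', j')).1 else 0%N.
have mS j : (m j < m j.+1)%N by have [] := FP (m j, j).
have m_mono i j : (i <= j)%N -> (m i <= m j)%N.
  by elim: j => [|j IH]; rewrite leq_eqVlt => /predU1P[->//|//]; rewrite ltnS => /IH h;
    exact: leq_trans h (ltnW (mS j)).
have m_ge j : (j <= m j)%N by elim: j => // j IH; exact: leq_ltn_trans IH (mS j).
have hb i : exists j, (i < m j.+1)%N by exists i; exact: m_ge i.+1.
pose b i := ex_minn (hb i).
have bE j i : (m j <= i < m j.+1)%N -> b i = j.
  move=> /andP[ji ij]; rewrite /b; case: ex_minnP => n ni nmin.
  apply/eqP; rewrite eqn_leq nmin//= leqNgt; apply/negP => nj.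
  by have := leq_trans (leq_trans ni (m_mono _ _ nj)) ji; rewrite ltnn.
pose q i := (F (m (b i), b i)).2 i.
exists m, b, q; split => //.
- split => [i|j]; first by have [_ h _ _ _] := FP (m (b i), b i); exact: h.
  have [_ _ + _ _] := FP (m j, j) => /= h; rewrite -[RHS]h !big_nat.
  by apply: eq_bigr => i hi; rewrite /q (bE j).
- by move=> i; have [_ _ _ h _] := FP (m (b i), b i); exact: h.
- by move=> i; have [_ _ _ _ h] := FP (m (b i), b i); exact: h.
Qed.

Let sum_blocks (m : nat -> nat) (f : nat -> R) J : m 0%N = 0%N ->
  (forall j, (m j < m j.+1)%N) ->
  \sum_(0 <= i < m J) f i = \sum_(0 <= j < J) \sum_(m j <= i < m j.+1) f i.
Proof.
move=> m0 mS; elim: J => [|J IH]; first by rewrite m0 !big_nil.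
by rewrite (big_cat_nat (n := m J))//= ?IH ?big_nat_recr// ltnW.
Qed.

(** J spreads y_j over the block j with factors q_i^(1/p), and K recombines with q_i^(1-1/p); K J =
    id because q sums to 1 on each block. J keeps the l^p sum over a block, while the inequalities
    between w, u and q control the weighted l2 sums. *)
Lemma XH_weights_retract (p1 : 1 <= p) (u : nat -> R) : (forall j, 0 < u j) ->
  retract (XH p1 u) (XH p1 w).
Proof.
move=> u0; have p20 := p2; have p0 : 0 < p by lra.
have [m [b [q [[m0 mS] bE [q0 q1] qw qu]]]] := block_partition u0.
have m_ge j : (j <= m j)%N by elim: j => // j IH; exact: leq_ltn_trans IH (mS j).
have sum_le (f : nat -> R) n : (forall i, 0 <= f i) ->
    \sum_(0 <= i < n) f i <= \sum_(0 <= j < n) \sum_(m j <= i < m j.+1) f i.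
  move=> f0; rewrite -sum_blocks// [leRHS](big_cat_nat (n := n))//= lerDl.
  exact: sumr_ge0.
have [J lJ [JE JC]] : exists2 J : XH p1 u -> XH p1 w, linear J &
    (forall y, val (J y) = fun i => q i `^ p^-1 *: val y (b i)) /\
    (forall y, `|J y| <= 1 * `|y|).
  apply: finite_norm_lift.
    move=> a x y; apply/funext => i.
    rewrite finite_norm_valP seq_linearP.
    by rewrite seq_linearP scalerDr !scalerA mulrC.
  move=> y; have [y1 y2] := XH_sum_le y.
  apply/XH_norm_leP; rewrite ?mulr_ge0// mul1r; split=> n.
    apply: le_trans (y1 n); apply: le_trans (sum_le _ _ _) _ => [i|].
      exact: powR_ge0.
    apply: ler_sum => j _; rewrite -[leRHS]mul1r -(q1 j) mulr_suml !big_nat.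
    apply: ler_sum => i hi; rewrite (bE j)// normrZ powRM// ger0_norm ?powR_ge0//.
    by rewrite -powRrM mulVf// powRr1.
  apply: le_trans (y2 n); apply: le_trans (sum_le _ _ _) _ => [i|].
    by rewrite mulr_ge0 ?sqr_ge0.
  apply: ler_sum => j _; rewrite -[leRHS]mulr1 -(q1 j) mulr_sumr !big_nat.
  apply: ler_sum => i hi; have := qw i; rewrite (bE j)// => qwi.
  rewrite normrZ exprMn mulrA [leRHS]mulrAC ler_wpM2r ?sqr_ge0//.
  apply: le_trans qwi; rewrite ler_wpM2l ?sqr_ge0// ger0_norm ?powR_ge0//.
  by rewrite -powR_mulrn ?powR_ge0// -powRrM mulrC.
have [K lK [KE KC]] : exists2 K : XH p1 w -> XH p1 u, linear K &
    (forall z, val (K z) =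
      fun j => \sum_(m j <= i < m j.+1) q i `^ (1 - p^-1) *: val z i) /\
    (forall z, `|K z| <= 2 * `|z|).
  apply: finite_norm_lift.
    move=> a x y; apply/funext => j; rewrite seq_linearP.
    rewrite scaler_sumr -big_split/=; apply: eq_bigr => i _.
    by rewrite seq_linearP scalerDr !scalerA mulrC.
  move=> z; have [z1 z2] := XH_sum_le z.
  (* In terms of t, K is dominated by averages with respect to the probability q on a block, so
     Jensen applies with the exponents p and 2. Where q_i = 0 the power convention gives t_i = 0. *)
  pose t i := q i `^ (- p^-1) * `|val z i|.
  have t0 i : 0 <= t i by rewrite mulr_ge0 ?powR_ge0.
  have qt i : q i `^ (1 - p^-1) * `|val z i| = q i * t i.
    have := q0 i; rewrite le_eqVlt => /predU1P[<-|qi].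
      rewrite mul0r powR0 ?mul0r// gt_eqF// subr_gt0 invf_lt1//; lra.
    by rewrite powRD ?(gt_eqF qi) ?implybT// powRr1 ?q0// mulrA.
  have Kle j : `|\sum_(m j <= i < m j.+1) q i `^ (1 - p^-1) *: val z i| <=
      \sum_(m j <= i < m j.+1) q i * t i.
    apply: le_trans (ler_norm_sum _ _ _) _; apply: ler_sum => i _.
    by rewrite normrZ ger0_norm ?powR_ge0// qt.
  have jensen r j : 1 <= r -> (\sum_(m j <= i < m j.+1) q i * t i) `^ r <=
      \sum_(m j <= i < m j.+1) q i * t i `^ r.
    by move=> r1; apply: powR_jensen => // [i _|i _]; rewrite ?q0 ?t0.
  have s0 j : 0 <= \sum_(m j <= i < m j.+1) q i * t i.
    by apply: sumr_ge0 => i _; rewrite mulr_ge0.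
  apply/XH_norm_leP; rewrite ?mulr_ge0//; split=> n.
    apply: (@le_trans _ _ (`|z| `^ p)); last first.
      by apply: ge0_lerP; rewrite ?(ltW p0)//; have := normr_ge0 z; lra.
    apply: le_trans (z1 (m n)); rewrite (sum_blocks _ n m0 mS); apply: ler_sum => j _.
    apply: le_trans (ge0_lerP (ltW p0) (normr_ge0 _) (Kle j)) _.
    apply: le_trans (jensen p j p1) _; apply: ler_sum => i _.
    rewrite powRM ?powR_ge0// mulrA -powRrM ler_piMl ?powR_ge0//.
    have := q0 i; rewrite le_eqVlt => /predU1P[<-|qi]; first by rewrite mul0r.
    by rewrite mulNr mulVf// powR_inv1// divff// gt_eqF.
  apply: (@le_trans _ _ (2 * `|z| ^+ 2)); last first.
    by rewrite exprMn ler_wpM2r ?sqr_ge0// expr2; lra.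
  apply: le_trans (ler_wpM2l (ltW (ltr0Sn R 1)) (z2 (m n))).
  rewrite (sum_blocks _ n m0 mS) mulr_sumr; apply: ler_sum => j _.
  apply: (@le_trans _ _ (u j ^+ 2 * \sum_(m j <= i < m j.+1) q i * t i `^ 2)).
    rewrite ler_wpM2l ?sqr_ge0//; apply: le_trans (jensen 2 j _); rewrite ?ler1n//.
    by rewrite -powR_mulrn//; apply: ge0_lerP.
  rewrite !mulr_sumr !big_nat; apply: ler_sum => i hi.
  have := qu i; rewrite (bE j)// => qui.
  rewrite [leRHS]mulrA; apply: le_trans (ler_wpM2r (sqr_ge0 _) qui).
  rewrite powR_mulrn// exprMn -[leRHS]mulrA ler_wpM2l ?sqr_ge0// mulrA ler_wpM2r ?sqr_ge0//.
  have := q0 i; rewrite le_eqVlt => /predU1P[<-|qi]; first by rewrite mul0r powR_ge0.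
  rewrite powRD ?(gt_eqF qi) ?implybT// powRr1 ?q0// ler_wpM2l ?q0//.
  by rewrite -powR_mulrn ?powR_ge0// -powRrM mulNr mulrC.
apply: (retract_intro lJ lK); [by exists 1|by exists 2|].
move=> y; apply: val_inj; apply/funext => j; rewrite KE JE.
rewrite -[RHS]scale1r -[X in _ = X *: _](q1 j) scaler_suml !big_nat; apply: eq_bigr => i hi.
rewrite (bE j)// scalerA; congr (_ *: _).
have := q0 i; rewrite le_eqVlt => /predU1P[<-|qi].
  by rewrite [X in _ * X]powR0 ?mulr0// invr_neq0.
by rewrite -powRD ?(gt_eqF qi) ?implybT// subrK powRr1.
Qed.

End block_partition.

(** * The sum of copies of l2 together with X_p *)

Section sum_retract.
Context {R : realType}.

Lemma ell2_unit : exists2 e : nat -> R^o -> ell2 R,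
  (forall n, linear (e n)) & forall n a,
  (forall k, ell2_coord (e n a) k = a * (k == n)%:R) /\ `|e n a| <= `|a|.
Proof.
have /choice[e eP] : forall n, exists en : R^o -> ell2 R, linear en /\ forall a,
    (forall k, ell2_coord (en a) k = a * (k == n)%:R) /\ `|en a| <= `|a|.
  move=> n.
  have lf a (u v : R^o) k : (a *: u + v) * (k == n)%:R =
      a * (u * (k == n)%:R) + v * (k == n)%:R :> R by rewrite mulrDl mulrA.
  have fC (u : R^o) N : \sum_(0 <= k < N) (u * (k == n)%:R : R) ^+ 2 <= (1 * `|u|) ^+ 2.
    rewrite mul1r real_normK ?num_real//.
    have -> : \sum_(0 <= k < N) (u * (k == n)%:R : R) ^+ 2 =
        if (n < N)%N then u ^+ 2 else 0.
      elim: N => [|N IH]; first by rewrite big_nil.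
      rewrite big_nat_recr//= IH ltnS; case: (ltngtP n N) => _.
      - by rewrite mulr0 expr0n addr0.
      - by rewrite mulr0 expr0n addr0.
      - by rewrite mulr1 add0r.
    by case: ifP => // _; exact: sqr_ge0.
  have [en len [enE enC]] := @ell2_lift R R^o _ 1 ler01 lf fC.
  exists en; split => // a; split; first by move=> k; rewrite enE.
  by have := enC a; rewrite mul1r.
by exists e => n; [case: (eP n)|move=> a; case: (eP n) => _; exact].
Qed.

Lemma sum_even_odd (f : nat -> R) n : \sum_(0 <= i < n.*2) f i =
  \sum_(0 <= j < n) f j.*2 + \sum_(0 <= j < n) f j.*2.+1.
Proof.
elim: n => [|n IH]; first by rewrite !big_nil addr0.
by rewrite doubleS !big_nat_recr//= IH; ring.
Qed.

Lemma sum_le_even_odd (f : nat -> R) n : (forall i, 0 <= f i) ->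
  \sum_(0 <= i < n) f i <=
  \sum_(0 <= j < n) f j.*2 + \sum_(0 <= j < n) f j.*2.+1.
Proof.
move=> f0; rewrite -sum_even_odd [leRHS](big_cat_nat (n := n))//=.
  by rewrite lerDl; exact: sumr_ge0.
by rewrite -addnn leq_addr.
Qed.

(* On the even indices the squares of the weights are summable, so that there
   the l2 part of the norm is dominated by the lp part. *)
Definition mixed_weights (v : nat -> R) i : R :=
  if odd i then v i./2 else 2 ^- i./2.

Lemma mixed_weights_even v j : mixed_weights v j.*2 = 2 ^- j.
Proof. by rewrite /mixed_weights odd_double doubleK. Qed.

Lemma mixed_weights_odd v j : mixed_weights v j.*2.+1 = v j.
Proof. by rewrite /mixed_weights/= odd_double/= uphalf_double. Qed.

Lemma sum_geometric_le n : \sum_(0 <= j < n) (2 ^- j : R) ^+ 2 <= 2.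
Proof.
(* The remainder 2 * 4^-n makes the bound inductive. *)
suff : \sum_(0 <= j < n) (2 ^- j : R) ^+ 2 <= 2 - 2 * (2 ^- n) ^+ 2.
  by move=> /le_trans; apply; rewrite gerBl mulr_ge0 ?sqr_ge0.
elim: n => [|n IH]; first by rewrite big_nil expr0 invr1; lra.
rewrite big_nat_recr//=; apply: le_trans (lerD IH (lexx _)) _.
have -> : (2 ^- n.+1 : R) ^+ 2 = (2 ^- n) ^+ 2 / 4.
  by rewrite [2 ^+ n.+1]exprSr [(2 ^+ n * 2)^-1]invfM exprMn; congr (_ * _); field.
have := sqr_ge0 (2 ^- n : R); lra.
Qed.

Lemma mixed_retract (p : R) (p1 : 1 <= p) (v : nat -> R) :
  retract (lp_sum p1 (ell2 R) * Xpw p1 v)%type (XH p1 (mixed_weights v)).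
Proof.
have p0 : 0 < p by exact: lt_le_trans p1.
have [e le eP] := ell2_unit.
pose u := mixed_weights v.
pose f (z : (lp_sum p1 (ell2 R) * Xpw p1 v)%type) i : ell2 R :=
  if odd i then e 0%N (val z.2 i./2) else val z.1 i./2.
have f0 z j : f z j.*2 = val z.1 j by rewrite /f odd_double doubleK.
have f1 z j : f z j.*2.+1 = e 0%N (val z.2 j).
  by rewrite /f/= odd_double/= uphalf_double.
have lf : linear f.
  move=> a x y; apply/funext => i; rewrite seq_linearP /f; case: ifP => _.
    have -> : (a *: x + y).2 = a *: x.2 + y.2 by [].
    by rewrite finite_norm_valP -le.
  have -> : (a *: x + y).1 = a *: x.1 + y.1 by [].
  by rewrite finite_norm_valP seq_linearP.
have z12 (z : (lp_sum p1 (ell2 R) * Xpw p1 v)%type) : `|z.1| <= `|z| /\ `|z.2| <= `|z|.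
  by rewrite prod_normE !le_max !lexx orbT.
have X2 (x : Xpw p1 v) :
    (forall n, \sum_(0 <= k < n) `|val x k| `^ p <= `|x| `^ p) /\
    (forall n, \sum_(0 <= k < n) v k ^+ 2 * val x k ^+ 2 <= `|x| ^+ 2).
  by apply/(Xpw_norm_leP p1) => //; rewrite finite_normE.
have L1 (a : lp_sum p1 (ell2 R)) :
    forall n, \sum_(0 <= k < n) `|val a k| `^ p <= `|a| `^ p.
  exact/lp_sum_norm_leP.
have L2 (a : lp_sum p1 (ell2 R)) k : `|val a k| <= `|a|.
  have : `|val a k| `^ p <= `|a| `^ p.
    apply: le_trans (L1 a k.+1); rewrite big_nat_recr//= lerDr.
    by apply: sumr_ge0 => i _; exact: powR_ge0.
  have pi0 : 0 <= p^-1 by rewrite invr_ge0 ltW.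
  move=> /(ge0_lerP pi0 (powR_ge0 _ _)).
  by rewrite -!powRrM divff ?gt_eqF// !powRr1.
have [J lJ [JE JC]] : exists2 J : _ -> XH p1 u, linear J &
    (forall z, val (J z) = f z) /\ (forall z, `|J z| <= 2 * `|z|).
  apply: finite_norm_lift => // z.
  have [zl zr] := z12 z; have [x1 x2] := X2 z.2.
  apply/XH_norm_leP; rewrite ?mulr_ge0//; split=> n.
    apply: le_trans (sum_le_even_odd _ _) _ => [i|]; first exact: powR_ge0.
    (* Each half contributes at most |z|^p, and superadditivity fits the sum under (2|z|)^p. *)
    have -> : 2 * `|z| = `|z| + `|z| by ring.
    apply: le_trans (powR_superadditive p1 (normr_ge0 z) (normr_ge0 z)).
    apply: lerD.
      under eq_bigr => j _ do rewrite f0.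
      by apply: le_trans (L1 _ _) _; apply: ge0_lerP; rewrite ?(ltW p0).
    apply: le_trans (_ : _ <= `|z.2| `^ p) _; last by apply: ge0_lerP; rewrite ?(ltW p0).
    apply: le_trans (x1 n); apply: ler_sum => j _; rewrite f1.
    by apply: ge0_lerP; rewrite ?(ltW p0)//; case: (eP 0%N (val z.2 j)).
  apply: le_trans (sum_le_even_odd _ _) _ => [i|].
    by rewrite mulr_ge0 ?sqr_ge0.
  have -> : (2 * `|z|) ^+ 2 = 2 * `|z| ^+ 2 + 2 * `|z| ^+ 2 by ring.
  apply: lerD.
    (* On even indices every entry is bounded by the norm, and the squared weights add up to at most
       2. *)
    apply: le_trans (ler_wpM2r (sqr_ge0 _) (sum_geometric_le n)).
    rewrite mulr_suml; apply: ler_sum => j _.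
    rewrite f0 /u mixed_weights_even ler_wpM2l ?sqr_ge0//.
    by rewrite lerXn2r// ?nnegrE//; exact: le_trans (L2 _ _) zl.
  apply: (@le_trans _ _ (`|z.2| ^+ 2)); last first.
    apply: (@le_trans _ _ (`|z| ^+ 2)); first by rewrite lerXn2r// ?nnegrE.
    by have := sqr_ge0 `|z|; lra.
  apply: le_trans (x2 n); apply: ler_sum => j _.
  rewrite f1 /u mixed_weights_odd ler_wpM2l ?sqr_ge0//.
  rewrite -[leRHS]real_normK ?num_real// lerXn2r ?nnegrE//.
  by case: (eP 0%N (val z.2 j)).
have ev (g : nat -> R) n : (forall i, 0 <= g i) ->
    \sum_(0 <= j < n) g j.*2 <= \sum_(0 <= i < n.*2) g i.
  by move=> g0; rewrite sum_even_odd lerDl; exact: sumr_ge0.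
have od (g : nat -> R) n : (forall i, 0 <= g i) ->
    \sum_(0 <= j < n) g j.*2.+1 <= \sum_(0 <= i < n.*2) g i.
  by move=> g0; rewrite sum_even_odd lerDr; exact: sumr_ge0.
have [K1 lK1 [K1E K1C]] : exists2 K : XH p1 u -> lp_sum p1 (ell2 R), linear K &
    (forall y, val (K y) = fun j => val y j.*2) /\ (forall y, `|K y| <= 1 * `|y|).
  apply: finite_norm_lift.
    by move=> a x y; apply/funext => j; rewrite seq_linearP finite_norm_valP seq_linearP.
  move=> y; have [y1 _] := XH_sum_le y; rewrite mul1r.
  apply/Lnorm_counting_le => // n; apply: le_trans (y1 n.*2).
  under eq_bigr => j _ do rewrite normr_id.
  by apply: (ev (fun i => `|val y i| `^ p)) => i; exact: powR_ge0.
have [K2 lK2 [K2E K2C]] : exists2 K : XH p1 u -> Xpw p1 v, linear K &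
    (forall y, val (K y) = fun j => ell2_coord (val y j.*2.+1) 0%N) /\
    (forall y, `|K y| <= 1 * `|y|).
  apply: finite_norm_lift.
    move=> a x y; apply/funext => j.
    by rewrite seq_linearP finite_norm_valP seq_linearP ell2_coordP.
  move=> y; have [y1 y2] := XH_sum_le y; rewrite mul1r.
  have c2 (x : ell2 R) : ell2_coord x 0 ^+ 2 <= `|x| ^+ 2.
    by apply: le_trans (ell2_sum_le x 1); rewrite big_nat1.
  have c1 (x : ell2 R) : `|ell2_coord x 0| <= `|x|.
    by rewrite -ler_sqr ?nnegrE// real_normK ?num_real.
  apply/(Xpw_norm_leP p1) => //; split=> n.
    apply: le_trans (y1 n.*2).
    apply: le_trans (od (fun i => `|val y i| `^ p) n (fun i => powR_ge0 _ _)).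
    by apply: ler_sum => j _; apply: ge0_lerP; rewrite ?(ltW p0).
  apply: le_trans (y2 n.*2).
  apply: le_trans (od (fun i => u i ^+ 2 * `|val y i| ^+ 2) n _) => [|i].
    by apply: ler_sum => j _; rewrite /u mixed_weights_odd ler_wpM2l ?sqr_ge0.
  by rewrite mulr_ge0 ?sqr_ge0.
apply: (retract_intro (k := fun y => (K1 y, K2 y)) lJ).
- by move=> a x y; rewrite lK1 lK2.
- by exists 2.
- exists 1 => y; rewrite prod_normE/= ge_max; apply/andP; split; [exact: K1C|exact: K2C].
- move=> [a x]; congr pair; apply: val_inj; rewrite ?K1E ?K2E JE; apply/funext => j.
    by rewrite f0.
  by rewrite f1; have [-> _] := eP 0%N (val x j); rewrite eqxx mulr1.
Qed.

End sum_retract.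

(** * Completeness of Lp *)

Section riesz_fischer.
Context d (T : measurableType d) (R : realType) (P : probability T R).
Variables (p : R) (p_gt1 : 1 < p).

Let p1 : 1 <= p. Proof. exact: ltW. Qed.
Let p_gt0 : 0 < p. Proof. exact: lt_trans p_gt1. Qed.
Local Notation Lf := (LfunType P (ereal_ge1 p1)).

(** The tangents make t^p Lipschitz on [0, l + 1] with the constant p (l + 1)^(p-1). *)
Lemma powR_cvg (u : nat -> R) (l : R) : (forall n, 0 <= u n) -> 0 <= l ->
  u @ \oo --> l -> (fun n => u n `^ p) @ \oo --> l `^ p.
Proof.
move=> u0 l0 ul; have p10 : 0 <= p - 1 by rewrite subr_ge0.
pose M := p * (l + 1) `^ (p - 1).
have M0 : 0 <= M by rewrite mulr_ge0 ?powR_ge0// ltW.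
apply/cvgrPdist_lt => e e0.
have e10 : 0 < Num.min 1 (e / (M + 1)).
  by rewrite lt_min ltr01 divr_gt0// ltr_wpDl.
have /cvgrPdist_lt/(_ _ e10) := ul; apply: filterS => n.
rewrite lt_min => /andP[un1]; rewrite ltr_pdivlMr ?ltr_wpDl// => une.
have unl : u n <= l + 1 by move: un1; rewrite ltr_norml; lra.
have bnd (x : R) : 0 <= x -> x <= l + 1 -> p * x `^ (p - 1) <= M.
  by move=> x0 xl; rewrite /M ler_wpM2l ?(ltW p_gt0)//; exact: ge0_lerP.
have key (x z : R) : 0 <= x -> 0 <= z -> x <= l + 1 ->
    x `^ p - z `^ p <= M * `|x - z|.
  move=> x0 z0 xl; have := powR_tangent p1 z0 x0.
  have h : p * x `^ (p - 1) * (x - z) <= M * `|x - z|.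
    apply: (@le_trans _ _ (p * x `^ (p - 1) * `|x - z|)).
      by rewrite ler_wpM2l ?ler_norm// mulr_ge0 ?powR_ge0// ltW.
    by rewrite ler_wpM2r// bnd.
  by move: h; rewrite !mulrBr; lra.
have h1 := key _ _ (u0 n) l0 unl.
have h2 := key _ _ l0 (u0 n) (_ : l <= l + 1).
rewrite (distrC (u n) l) in h1.
apply: (@le_lt_trans _ _ (M * `|l - u n|)); last by have := normr_ge0 (l - u n); lra.
by rewrite ler_norml; have := h2 _; rewrite lerDl ler01 => /(_ isT); lra.
Qed.

Lemma Lnorm1_le (f : T -> R) : measurable_fun setT f ->
  (\int[P]_x `|f x|%:E <= 'N[P]_p%:E[EFin \o f])%E.
Proof.
move=> mf; have q0 : 0 < p / (p - 1) by rewrite divr_gt0// subr_gt0.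
have pn : p != 0 by rewrite gt_eqF.
have := @hoelder _ _ _ P f (cst 1) p (p / (p - 1)) mf (measurable_cst _) p_gt0 q0.
have e : p^-1 + (p / (p - 1))^-1 = 1 by rewrite invf_div; field.
move=> /(_ e); rewrite Lnorm1.
have -> : ('N[P]_(p / (p - 1))%:E[EFin \o cst 1%R] = 1)%E.
  transitivity ('N[P]_(p / (p - 1))%:E[cst 1])%E; first by [].
  rewrite Lnorm_cst1 [X in (X `^ _)%E](_ : _ = 1%E) ?poweR1r//.
  exact: probability_setT.
rewrite mule1; apply: le_trans; rewrite le_eqVlt; apply/orP; left; apply/eqP.
by apply: eq_integral => x _ /=; rewrite mulr1.
Qed.

Let limn_einf_le (u : nat -> \bar R) B : (forall n, u n <= B)%E -> (limn_einf u <= B)%E.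
Proof.
move=> uB; rewrite limn_einf_lim; apply: lime_le; first exact: is_cvg_einfs.
apply: nearW => n; apply: le_trans (uB n).
by apply: ereal_inf_lbound; exists n => /=.
Qed.

(** The L^1 norms of the increments are dominated by their L^p norms and add up to at most 2, so the
    series of increments converges absolutely almost everywhere. *)
Let fast_cauchy_ae (F : nat -> Lf) :
  (forall k, ('N[P]_p%:E[EFin \o (F k.+1 \- F k)%R] <= (2 ^- k)%:E)%E) ->
  {ae P, forall x, cvgn (fun k => F k x)}.
Proof.
move=> FC; pose g k x := F k.+1 x - F k x.
have mg k : measurable_fun setT (g k) by exact: measurable_funB.
have mgE k : measurable_fun setT (fun x => `|g k x|%:E).
  by apply/measurable_EFinP; exact: measurableT_comp.
have g0 k x : (0 <= `|g k x|%:E)%E by rewrite lee_fin.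
have intg k : (\int[P]_x `|g k x|%:E <= (2 ^- k)%:E)%E.
  exact: le_trans (Lnorm1_le (mg k)) (FC k).
pose G x := (\sum_(k <oo) `|g k x|%:E)%E.
have mG : measurable_fun setT G by apply: ge0_emeasurable_sum.
have intG : (\int[P]_x G x <= 2%:E)%E.
  rewrite integral_nneseries//.
  apply: lime_le; first by apply: is_cvg_nneseries => k _ _; exact: integral_ge0.
  apply: nearW => n; apply: (@le_trans _ _ (\sum_(0 <= k < n) (2 ^- k)%:E)%E).
    by apply: lee_sum => k _; exact: intg.
  rewrite sumEFin lee_fin.
  suff : \sum_(0 <= k < n) (2 ^- k : R) <= 2 - 2 * 2 ^- n.
    by move=> /le_trans; apply; rewrite gerBl mulr_ge0.
  elim: n => [|n IH]; first by rewrite big_nil expr0 invr1; lra.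
  rewrite big_nat_recr//=; apply: le_trans (lerD IH (lexx _)) _.
  have -> : (2 ^- n.+1 : R) = 2 ^- n / 2 by rewrite exprSr invfM.
  by set z := 2 ^- n; lra.
have G0 x : (0 <= G x)%E by exact: nneseries_ge0.
have iG : P.-integrable setT G.
  apply/integrableP; split => //; under eq_integral => x _ do rewrite gee0_abs//.
  by rewrite (le_lt_trans intG)// ltry.
have := integrable_ae measurableT iG; apply: filterS => x /(_ I) Gx.
have gx : cvgn [normed series (fun k => g k x)].
  apply: nondecreasing_is_cvgn; first by apply: nondecreasing_series => *; exact: normr_ge0.
  exists (fine (G x)) => _ [n _ <-] /=.
  rewrite -lee_fin fineK// -sumEFin.
  by apply: nneseries_lim_ge => k _ _.
have := @normed_cvg R R^o _ gx => sx.
have -> : (fun k => F k x) = (fun k => F 0%N x + series (fun k => g k x) k).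
  apply/funext; elim => [|k IH]; first by rewrite /series/= big_nil addr0.
  by rewrite /series/= big_nat_recr//= addrA -IH /g addrC subrK.
by apply: is_cvgD => //; exact: is_cvg_cst.
Qed.

(** Fatou's lemma for |F (m+k) - F m|^p as k grows: the bound on the differences passes to the
    pointwise limit. *)
Let fast_cauchy_limit (F : nat -> Lf) :
  (forall m k, ('N[P]_p%:E[EFin \o (F (m + k)%N \- F m)%R] <= (2 ^- m)%:E)%E) ->
  exists f : Lf, forall m, ('N[P]_p%:E[EFin \o (f \- F m)%R] <= (2 ^- m)%:E)%E.
Proof.
move=> FC.
have Fae : {ae P, forall x, cvgn (fun k => F k x)}.
  by apply: fast_cauchy_ae => k; have := FC k 1%N; rewrite addn1.
(* The upper limit is measurable and equals the limit wherever that exists; [fine] replaces infinite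
   values by 0, on a null set only. *)
pose f x : R := fine (limn_esup (fun k => (F k x)%:E)).
have mf : measurable_fun setT f.
  apply: (@measurableT_comp _ _ _ _ _ _ (@fine R)); first exact: fine_measurable.
  by apply: measurable_fun_limn_esup => k; exact/measurable_EFinP.
have flim x : cvgn (fun k => F k x) -> (fun k => F k x) @ \oo --> f x.
  move=> Fx; have : (fun k => (F k x)%:E) @ \oo --> (limn (fun k => F k x))%:E.
    by apply: cvg_EFin; [exact: nearW|exact: Fx].
  move=> /cvg_limn_einf_sup[_ e]; rewrite /f e/=; exact: Fx.
have mpow (h : T -> R) : measurable_fun setT h ->
    measurable_fun setT (fun x => (`|h x| `^ p)%:E).
  move=> mh; apply/measurable_EFinP.
  apply: (@measurableT_comp _ _ _ _ _ _ (@powR R ^~ p)) => //.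
  exact: measurableT_comp.
have normP (h : T -> R) B : 0 <= B -> ('N[P]_p%:E[EFin \o h] <= B%:E)%E <->
    (\int[P]_x (`|h x| `^ p)%:E <= (B `^ p)%:E)%E.
  move=> B0; have e : ('N[P]_p%:E[EFin \o h] `^ p = \int[P]_x (`|h x| `^ p)%:E)%E.
    by rewrite poweR_Lnorm ?gt_eqF//; apply: eq_integral => x _; rewrite -poweR_EFin.
  have i0 : (0 <= \int[P]_x (`|h x| `^ p)%:E)%E.
    by apply: integral_ge0 => x _; rewrite lee_fin powR_ge0.
  rewrite -e -poweR_EFin; split => hB.
    by apply: gt0_ler_poweR; rewrite ?in_itv/= ?leey ?lee_fin ?Lnorm_ge0 ?andbT// ltW.
  have : (('N[P]_p%:E[EFin \o h] `^ p) `^ p^-1 <= (B%:E `^ p) `^ p^-1)%E.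
    apply: gt0_ler_poweR => //; first by rewrite invr_ge0 ltW.
      by rewrite in_itv/= leey poweR_ge0.
    by rewrite in_itv/= leey lee_fin powR_ge0.
  by rewrite -!poweRrM divff ?gt_eqF// !poweRe1//; exact: Lnorm_ge0.
have fm m : ('N[P]_p%:E[EFin \o (f \- F m)%R] <= (2 ^- m)%:E)%E.
  apply/normP => //.
  have -> : (\int[P]_x (`|(f \- F m)%R x| `^ p)%:E =
      \int[P]_x limn_einf (fun k => (`|F (m + k)%N x - F m x| `^ p)%:E))%E.
    apply: ae_eq_integral => //.
    - by apply: mpow; exact: measurable_funB.
    - rewrite (_ : (fun x => limn_einf _) =
        (fun x => - limn_esup (fun k => (- (`|F (m + k)%N x - F m x| `^ p)%:E)))%E)//.
      apply: measurableT_comp => //.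
      apply: measurable_fun_limn_esup => k; apply: measurableT_comp => //.
      by apply: mpow; exact: measurable_funB.
    - apply: filterS Fae => x Fx _; apply/esym.
      have h : (fun k => `|F (m + k)%N x - F m x| `^ p) @ \oo --> `|f x - F m x| `^ p.
        apply: powR_cvg => //; apply: cvg_norm; apply: cvgB; last exact: cvg_cst.
        apply: (@cvg_comp _ _ _ (addn m) (fun k => F k x) _ \oo).
          exact: cvg_addnl.
        exact: flim.
      have /cvg_limn_einf_sup[] : (fun k => (`|F (m + k)%N x - F m x| `^ p)%:E) @ \oo
          --> (`|f x - F m x| `^ p)%:E.
        by apply: cvg_EFin; [exact: nearW|exact: h].
      by [].
  apply: le_trans (fatou _ _ _ _) _ => //.
    by move=> k; apply: mpow; exact: measurable_funB.
  apply: (@limn_einf_le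
    (fun k => \int[P]_x (`|F (m + k)%N x - F m x| `^ p)%:E)%E) => k.
  by apply/(normP (fun x => F (m + k)%N x - F m x)) => //; exact: FC.
have h0 : (f \- F 0%N)%R \in Lfun P p%:E.
  apply/andP; split; rewrite inE /=; first exact: measurable_funB.
  by rewrite /finite_norm (le_lt_trans (fm 0%N))// ltry.
exists (Lfun_Sub (ereal_ge1 p1) h0 + F 0%N) => m.
rewrite (_ : (Lfun_Sub (ereal_ge1 p1) h0 + F 0%N : T -> R) = f); first exact: fm.
by apply/funext => x; exact: subrK.
Qed.

(** The limit is found along a subsequence with differences at most 2^-k, and the Cauchy property
    extends convergence to the whole sequence. *)
Lemma Lp_seq_complete : seq_complete (Lp P p1).
Proof.
move=> u uC.
have half0 k : 0 < 2 ^- k :> R by rewrite invr_gt0 exprn_gt0.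
have /choice[N NP] : forall k, exists N, forall m n, (N <= m)%N -> (m <= n)%N ->
    `|u n - u m| <= 2 ^- k by move=> k; exact: uC.
(* The running maximum makes the indices nondecreasing and keeps n k above N k. *)
pose n := fix n k := if k is k'.+1 then maxn (n k') (N k) else N 0%N.
have nN k : (N k <= n k)%N by case: k => //= k; rewrite leq_maxr.
have nS k j : (n k <= n (k + j)%N)%N.
  elim: j => [|j IH]; first by rewrite addn0.
  by rewrite addnS /=; apply: leq_trans IH _; rewrite leq_maxl.
pose F k : Lf := repr (u (n k)).
have FE k : Lp_class (F k) = u (n k) by exact: Lp_class_repr.
have normE (f g : Lf) : (`|Lp_class f - Lp_class g|%:E = 'N[P]_p%:E[EFin \o (f \- g)%R])%E.
  rewrite -Lp_classB -[LHS]/(Lp_norm _)%:E Lp_normE.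
  exact: (finite_norm_fine (f - g)).
have [m k|f fP] := @fast_cauchy_limit F.
  by rewrite -normE !FE lee_fin; exact: (NP m).
exists (Lp_class f); apply/cvgrPdist_lt => e e0.
have [k ke] : exists k, 2 ^- k + 2 ^- k < e.
  have e20 : 0 <= 2 / e by rewrite divr_ge0// ltW.
  exists (Num.bound (2 / e)); set k := Num.bound _.
  have k2 : 2 / e < 2 ^+ k.
    apply: lt_trans (archi_boundP e20) _.
    by rewrite -natrX ltr_nat ltn_expl.
  have -> : 2 ^- k + 2 ^- k = 2 / 2 ^+ k :> R by ring.
  rewrite ltr_pdivrMr ?exprn_gt0//.
  by move: k2; rewrite ltr_pdivrMr// mulrC.
exists (n k) => // j /= kj.
have h1 : `|Lp_class f - u (n k)| <= 2 ^- k by rewrite -lee_fin -FE normE.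
have h2 : `|u j - u (n k)| <= 2 ^- k by apply: (NP k).
apply: le_lt_trans ke; rewrite -(subrKA (u (n k))).
by apply: le_trans (ler_normD _ _) _; rewrite lerD// distrC.
Qed.

End riesz_fischer.

(** * The closed span of the generators *)

Section coefficients.
Context {R : realType} (P : probability (cube R) R) (hP : product_lebesgue P).
Variables (p : R) (p1 : 1 <= p) (w : nat -> R).
Hypotheses (p2 : 2 < p) (w01 : forall n, 0 < w n <= 1).
Notation y := (generator p w).
Local Notation Lf := (LfunType P (ereal_ge1 p1)).
Local Notation L := (Lp P p1).

Let p_gt1 : 1 < p. Proof. by have := p2 => ?; lra. Qed.
Let p_gt0 : 0 < p. Proof. exact: lt_trans p_gt1. Qed.
Let w_gt0 i : 0 < w i. Proof. by have /andP[] := w01 i. Qed.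

Lemma Lp_classZ a (f : Lf) : Lp_class (a *: f) = a *: (Lp_class f : L).
Proof. by rewrite -Lp_scaleE. Qed.

Lemma Lp_class0 : Lp_class (0 : Lf) = 0 :> L.
Proof. by rewrite -(subrr (0 : Lf)) Lp_classB subrr. Qed.

Lemma Lp_class_sum I (s : seq I) (f : I -> Lf) :
  Lp_class (\sum_(i <- s) f i) = \sum_(i <- s) (Lp_class (f i) : L).
Proof.
by apply: (big_morph (fun f : Lf => Lp_class f : L)); [exact: Lp_classD|exact: Lp_class0].
Qed.

Lemma Lfun_sumE I (s : seq I) (f : I -> Lf) x :
  (\sum_(i <- s) f i : Lf) x = \sum_(i <- s) f i x.
Proof. exact: (big_morph (fun f : Lf => f x)). Qed.

Lemma Lp_norm_mean (f : Lf) : bounded_measurable f ->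
  `|Lp_class f : L| = mean P (fun x => `|f x| `^ p) `^ p^-1.
Proof.
by move=> hf; rewrite -[LHS]/(Lp_norm _) Lp_normE Lnorm_mean.
Qed.

Let gen i n : Lf := Lfun_Sub (ereal_ge1 p1) (generator_Lfun P p w i n p1).

Lemma norm_generator_sum c I N :
  `|\sum_(0 <= i < I) \sum_(0 <= n < N) c i n *: generator_class P p1 w i n| =
  mean P (fun x => `|blocks p w c 0 I N x| `^ p) `^ p^-1.
Proof.
have -> : \sum_(0 <= i < I) \sum_(0 <= n < N) c i n *: generator_class P p1 w i n =
    Lp_class (\sum_(0 <= i < I) \sum_(0 <= n < N) c i n *: gen i n).
  rewrite Lp_class_sum; apply: eq_bigr => i _.
  by rewrite Lp_class_sum; apply: eq_bigr => n _; rewrite Lp_classZ.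
have e : (\sum_(0 <= i < I) \sum_(0 <= n < N) c i n *: gen i n : Lf) =
    blocks p w c 0 I N :> (_ -> _).
  apply/funext => x; rewrite Lfun_sumE; apply: eq_bigr => i _.
  by rewrite Lfun_sumE.
rewrite Lp_norm_mean; first by under eq_mean => x do rewrite e.
by rewrite e; exact: bounded_measurable_blocks.
Qed.

Let powR_subadd a b : 0 <= a -> 0 <= b -> (a + b) `^ p^-1 <= a `^ p^-1 + b `^ p^-1.
Proof.
move=> a0 b0; have pi0 : 0 <= p^-1 by rewrite invr_ge0 ltW.
have rt t : 0 <= t -> t = (t `^ p^-1) `^ p.
  by move=> t0; rewrite -powRrM mulVf ?gt_eqF// powRr1.
have := powR_superadditive p1 (powR_ge0 a p^-1) (powR_ge0 b p^-1).
rewrite -!rt// => /(ge0_lerP pi0 (addr_ge0 a0 b0)).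
by rewrite -powRrM divff ?gt_eqF// powRr1// addr_ge0 ?powR_ge0.
Qed.

(** The p-th roots of the two constants in [rosenthal]. *)
Definition upper_const : R :=
  (2 * (step_const p * khintchine_const p)) `^ p^-1 +
  ((2 * step_const p) `^ (p / 2)) `^ p^-1.

Lemma norm_generator_sum_le c I N :
  `|\sum_(0 <= i < I) \sum_(0 <= n < N) c i n *: generator_class P p1 w i n| <=
  upper_const * ((\sum_(0 <= i < I) sqnorm c N i `^ (p / 2)) `^ p^-1 +
       (\sum_(0 <= i < I) w i ^+ 2 * sqnorm c N i) `^ 2^-1).
Proof.
rewrite norm_generator_sum.
have pi0 : 0 <= p^-1 by rewrite invr_ge0 ltW.
have m0 : 0 <= mean P (fun x => `|blocks p w c 0 I N x| `^ p).
  by apply: mean_ge0 => x; exact: powR_ge0.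
apply: le_trans (ge0_lerP pi0 m0 (rosenthal hP p2 w01 c I N)) _.
have D0 : 0 <= step_const p by apply: step_const_ge0; exact: ltW.
have K0 : 0 <= khintchine_const p by exact: khintchine_const_ge0.
have A0 : 0 <= 2 * (step_const p * khintchine_const p) by rewrite !mulr_ge0.
have B0 := powR_ge0 (2 * step_const p) (p / 2).
rewrite /upper_const; move: A0 B0; set A := 2 * _; set B := _ `^ (p / 2) => A0 B0.
set X := \sum_(0 <= i < I) sqnorm _ _ _ `^ _.
set Y := \sum_(0 <= i < I) w i ^+ 2 * _.
have X0 : 0 <= X by apply: sumr_ge0 => i _; exact: powR_ge0.
have Y0 : 0 <= Y.
  by apply: sumr_ge0 => i _; rewrite mulr_ge0 ?sqr_ge0// sqnorm_ge0.
apply: le_trans (powR_subadd _ _) _; rewrite ?mulr_ge0 ?powR_ge0//.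
rewrite (powRM _ A0 X0) (powRM _ B0 (powR_ge0 Y _)) -(powRrM Y).
rewrite (_ : p / 2 * p^-1 = 2^-1); last by field; rewrite gt_eqF.
have := mulr_ge0 (powR_ge0 A p^-1) (powR_ge0 Y 2^-1).
have := mulr_ge0 (powR_ge0 B p^-1) (powR_ge0 X p^-1).
set a := A `^ _; set b := B `^ _; set s := X `^ _; set t := Y `^ _.
rewrite (mulrDr (a + b)) !mulrDl; lra.
Qed.

Lemma upper_const_ge0 : 0 <= upper_const.
Proof. by rewrite addr_ge0 ?powR_ge0. Qed.

Let bound i : R := weight_power p w i `^ (- p^-1).

Lemma Lp_mul_generator_integrable (f : Lf) i n :
  P.-integrable setT (fun x => (f x * y i n x)%:E).
Proof.
apply/integrableP; split.
  by apply/measurable_EFinP; apply: measurable_funM => //; exact: measurable_generator.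
apply: (@le_lt_trans _ _ (\int[P]_x ((bound i)%:E * `|f x|%:E))%E).
  apply: ge0_le_integral => //.
  - by do 2 apply: measurableT_comp => //; apply: measurable_funM => //;
      exact: measurable_generator.
  - by apply/measurable_EFinP; apply: measurable_funM => //; exact: measurableT_comp.
  - move=> x _ /=; rewrite lee_fin normrM mulrC ler_wpM2r//.
    exact: generator_bounded.
rewrite ge0_integralZl//; last 2 first.
- by apply/measurable_EFinP; exact: measurableT_comp.
- by rewrite lee_fin powR_ge0.
rewrite lte_mul_pinfty ?lee_fin ?powR_ge0//.
apply: le_lt_trans (Lnorm1_le P p_gt1 _) _ => //.
by have := finite_norm_fine f => <-; rewrite ltry.
Qed.

(** The generators are orthogonal with second moment w_i^2, which the division normalises. *)
Definition raw_coef i n (f : cube R -> R) : R :=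
  (\int[P]_x (f x * y i n x)) / w i ^+ 2.

Definition coef i n (v : L) : R := raw_coef i n (repr v).

Lemma coef_class i n (f : Lf) : coef i n (Lp_class f) = raw_coef i n f.
Proof.
rewrite /coef /raw_coef; congr (_ / _); congr fine; apply: ae_eq_integral => //.
- by apply: measurable_int (Lp_mul_generator_integrable _ i n).
- by apply: measurable_int (Lp_mul_generator_integrable _ i n).
have /Lp_classP /asboolP := Lp_class_repr (Lp_class f).
apply: filterS => x /(_ I) h _; congr ((_ * _)%:E).
by apply/eqP; rewrite -subr_eq0; apply/eqP; exact: h.
Qed.

Lemma coef_linear i n a (u v : L) :
  coef i n (a *: u + v) = a * coef i n u + coef i n v.
Proof.
rewrite -[u]Lp_class_repr -[v]Lp_class_repr -Lp_classZ -Lp_classD !coef_class.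
rewrite /raw_coef mulrA -mulrDl; congr (_ / _).
have iu := Lp_mul_generator_integrable (repr u) i n.
have iv := Lp_mul_generator_integrable (repr v) i n.
rewrite -RintegralZl// -RintegralD//; last first.
  have := Lp_mul_generator_integrable (a *: repr u) i n.
  apply: eq_integrable => // x _.
  by transitivity ((a * repr u x * y i n x)%:E) => //; rewrite -mulrA.
apply: eq_Rintegral => x _.
by transitivity ((a * repr u x + repr v x) * y i n x) => //; rewrite mulrDl mulrA.
Qed.

(** Generators are bounded and the L^1 norm is below the L^p norm. The constant depends on i; it
    serves for continuity only, and uniform bounds come from [coef_closure_le]. *)
Lemma coef_bounded i n : exists C, forall v : L, `|coef i n v| <= C * `|v|.
Proof.
exists (bound i / w i ^+ 2) => v.
rewrite -[v]Lp_class_repr coef_class /raw_coef.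
rewrite normrM normfV (ger0_norm (sqr_ge0 _)) [leRHS]mulrAC.
rewrite ler_wpM2r ?invr_ge0 ?sqr_ge0//.
set f := repr v; have fi := Lp_mul_generator_integrable f i n.
apply: le_trans (le_normr_Rintegral measurableT fi) _.
rewrite -lee_fin /Rintegral fineK; last first.
  apply: integrable_fin_num => //.
  by have := integrable_abse fi; apply: eq_integrable.
apply: (@le_trans _ _ (\int[P]_x ((bound i)%:E * `|f x|%:E))%E).
  apply: ge0_le_integral => //.
  - by apply/measurable_EFinP; apply: measurableT_comp => //;
      apply: measurable_funM => //; exact: measurable_generator.
  - by apply/measurable_EFinP; apply: measurable_funM => //; exact: measurableT_comp.
  - move=> x _ /=; rewrite lee_fin normrM mulrC ler_wpM2r//.
    exact: generator_bounded.
rewrite ge0_integralZl//; last 2 first.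
- by apply/measurable_EFinP; exact: measurableT_comp.
- by rewrite lee_fin powR_ge0.
rewrite EFinM lee_wpmul2l ?lee_fin ?powR_ge0//.
apply: le_trans (Lnorm1_le P p_gt1 _) _ => //.
by rewrite -[`|_|]/(Lp_norm _) Lp_normE finite_norm_fine.
Qed.

(** Distinct coordinates are separated by a reflection. Within one coordinate, the half-period shift
    for the smaller index flips that generator and fixes the other. *)
Lemma coef_generator i n j m :
  coef i n (generator_class P p1 w j m) = ((i == j) && (n == m))%:R.
Proof.
rewrite coef_class /raw_coef -[\int[P]_x _]/(mean P (fun x => y j m x * y i n x)).
have hy k l := bounded_measurable_generator p w k l.
have flip0 U k l (S : cube R -> R) : bounded_measurable S -> unit_preserving U ->
    (forall x, S (on_coord k U x) = S x) ->
    (forall x, y k l (on_coord k U x) = - y k l x) ->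
    mean P (fun x => S x * y k l x) = 0.
  move=> hS hU SU yU; apply: (@mean_flip0 _ _ _ P (on_coord k U)) => //; split => //.
    by apply: measurable_on_coord; case: hU.
  exact: on_coord_preserving.
have [<-|ij] := eqVneq i j; last first.
  have [U hU yU] := generator_reflection p2 w01 i.
  rewrite (flip0 U i n)//= ?mul0r// => x; rewrite generator_on_coord_neq// eq_sym//.
have shift a b : (a < b)%N -> mean P (fun x => y i b x * y i a x) = 0.
  move=> ab; have [U hU [yU1 yU2]] := generator_shift p2 w01 i a.
  by rewrite (flip0 U i a)// => x; rewrite yU2.
have [<-|nm] := eqVneq n m => /=.
  have := @mean_generator_invariant R P hP p w p2 w01 i n (cst 1)
    (@bounded_measurable_cst _ (cube R) R 1) (fun=> ler01) (fun _ _ => erefl).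
  rewrite mean_cst mulr1 => h.
  rewrite -[X in X / _](_ : w i ^+ 2 = _) ?divff ?sqrf_eq0 ?gt_eqF//.
  by rewrite -h; apply: eq_mean => x; rewrite mul1r expr2.
case: (ltngtP n m) nm => // nm _; first by rewrite shift ?mul0r.
by under eq_mean => x do rewrite mulrC; rewrite shift ?mul0r.
Qed.

End coefficients.

Section closures.
Context {R : realType} {V : normedModType R}.
Implicit Types A : set V.

Lemma closure_seq_cvg A x : closure A x ->
  exists2 u : nat -> V, (forall n, A (u n)) & u @ \oo --> x.
Proof.
move=> Ax; have /choice[u uP] : forall n : nat, exists y, A y /\ `|x - y| < n.+1%:R^-1.
  move=> n; have n0 : 0 < n.+1%:R^-1 :> R by rewrite invr_gt0.
  have [y [Ay]] := Ax (ball x n.+1%:R^-1) (nbhsx_ballx x _ n0).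
  by rewrite -ball_normE => xy; exists y.
exists u; first by move=> n; case: (uP n).
apply/cvgrPdist_lt => e e0; near=> n; have [_ h] := uP n.
apply: lt_trans h _; near: n; exact: near_infty_natSinv_lt (PosNum e0).
Unshelve. all: by end_near. Qed.

Lemma subsp_closure_complete A (hA : linear_subspace A) : seq_complete V ->
  seq_complete (subsp (linear_subspace_closure hA)).
Proof.
move=> hV u uC; have [l ul] := hV (fun n => val (u n)) uC.
have Al : subsp_pred (linear_subspace_closure hA) l.
  apply/mem_set; apply: (closed_cvg (closure A)) ul; first exact: closed_closure.
  by apply: nearW => n; exact/set_mem/(valP (u n)).
exists (exist _ l Al).
apply/cvgrPdist_lt => e e0; near=> n.
rewrite -[`|_|]/(`|l - val (u n)|); near: n.
by move/cvgrPdist_lt : ul; exact.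
Unshelve. all: by end_near. Qed.

End closures.

(** * Coefficient bounds on the closed span *)

Section Dpw_retract.
Context {R : realType} (P : probability (cube R) R) (hP : product_lebesgue P).
Variables (p : R) (p1 : 1 <= p) (w : nat -> R).
Hypotheses (p2 : 2 < p) (w01 : forall n, 0 < w n <= 1).
Local Notation L := (Lp P p1).
Local Notation gen := (generator_class P p1 w).
Let gens : set L := [set y | exists i n, y = gen i n].

Let p_gt0 : 0 < p. Proof. by have := p2 => ?; lra. Qed.

(** A finite combination is stored as a square array padded with zeros, valid for all large sizes,
    so that sums can be put on a common format. *)
Lemma span_generators v : linear_span gens v -> exists c M0, forall M, (M0 <= M)%N ->
  v = \sum_(0 <= i < M) \sum_(0 <= n < M) c i n *: gen i n.
Proof.
move=> [n [c [g [gG ->]]]].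
apply: (big_ind (fun v : L => exists c M0, forall M, (M0 <= M)%N ->
  v = \sum_(0 <= i < M) \sum_(0 <= n < M) c i n *: gen i n)).
- exists (fun _ _ => 0), 0%N => M _.
  by rewrite big1// => i _; rewrite big1// => m _; rewrite scale0r.
- move=> x y [a [M1 h1]] [b [M2 h2]]; exists (fun i n => a i n + b i n), (maxn M1 M2) => M.
  rewrite geq_max => /andP[/h1 -> /h2 ->].
  rewrite -big_split; apply: eq_bigr => i _; rewrite -big_split; apply: eq_bigr => m _.
  by rewrite scalerDl.
- move=> k _; have [j [m ->]] := gG k.
  exists (fun i n => c k * ((i == j) && (n == m))%:R), (maxn j m).+1 => M.
  rewrite gtn_max => /andP[jM mM].
  rewrite big_mkord (bigD1 (Ordinal jM))//= [X in _ + X]big1 ?addr0 => [|i ij].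
    rewrite big_mkord (bigD1 (Ordinal mM))//= [X in _ + X]big1 ?addr0 => [|l lm].
      by rewrite !eqxx mulr1.
    have -> : (nat_of_ord l == m) = false by apply: contraNF lm => /eqP h; exact/eqP/val_inj.
    by rewrite andbF mulr0 scale0r.
  have -> : (nat_of_ord i == j) = false by apply: contraNF ij => /eqP h; exact/eqP/val_inj.
  by rewrite big1// => l _; rewrite mulr0 scale0r.
Qed.

Let coef_sum (a : nat -> nat -> R) i n M : (i < M)%N -> (n < M)%N ->
  coef w i n (\sum_(0 <= j < M) \sum_(0 <= m < M) a j m *: gen j m : L) = a i n.
Proof.
move=> iM nM.
have c0 : coef w i n (0 : L) = 0.
  by have := coef_linear w p2 i n (-1) (0 : L) 0; rewrite scaler0 addr0 mulN1r addNr.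
have cD (x y : L) : coef w i n (x + y) = coef w i n x + coef w i n y.
  by have := coef_linear w p2 i n 1 x y; rewrite scale1r mul1r.
have cZ b (x : L) : coef w i n (b *: x) = b * coef w i n x.
  by have := coef_linear w p2 i n b x 0; rewrite addr0 c0 addr0.
have cS (F : nat -> L) : coef w i n (\sum_(0 <= j < M) F j) =
    \sum_(0 <= j < M) coef w i n (F j).
  exact: (big_morph (coef w i n)).
have cg j m := coef_generator hP p1 p2 w01 i n j m.
rewrite cS big_mkord (bigD1 (Ordinal iM))//= [X in _ + X]big1 ?addr0 => [|j ij].
  rewrite cS big_mkord (bigD1 (Ordinal nM))//= [X in _ + X]big1 ?addr0 => [|m nm].
    by rewrite cZ cg !eqxx mulr1.
  rewrite cZ cg.
  have -> : (n == nat_of_ord m) = false by apply: contraNF nm => /eqP h; exact/eqP/val_inj.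
  by rewrite andbF mulr0.
have ji : (i == nat_of_ord j) = false by apply: contraNF ij => /eqP h; exact/eqP/val_inj.
by rewrite cS big1// => l _; rewrite cZ cg ji mulr0.
Qed.

Let sqcoef N i (v : L) := \sum_(0 <= n < N) coef w i n v ^+ 2.

Let sqcoef_ge0 N i v : 0 <= sqcoef N i v.
Proof. by apply: sumr_ge0 => n _; exact: sqr_ge0. Qed.

(** The lower moment bounds, applied to an array which contains both v and the window I x N. They
    hold with constant 1. *)
Lemma coef_span_le v I N : linear_span gens v ->
  \sum_(0 <= i < I) sqcoef N i v `^ (p / 2) <= `|v| `^ p /\
  \sum_(0 <= i < I) w i ^+ 2 * sqcoef N i v <= `|v| ^+ 2.
Proof.
move=> /span_generators[a [M0 vE]].
pose M := maxn M0 (maxn I N).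
have M0M : (M0 <= M)%N by rewrite leq_maxl.
have IM : (I <= M)%N by rewrite /M maxnCA leq_maxl.
have NM : (N <= M)%N by rewrite /M maxnA leq_maxr.
have coefE i n : (i < M)%N -> (n < M)%N -> coef w i n v = a i n.
  by move=> iM nM; rewrite (vE M M0M) coef_sum.
have sq_le i : (i < I)%N -> sqcoef N i v <= sqnorm a M i.
  move=> iI; rewrite /sqnorm [leRHS](big_cat_nat (n := N))//=.
  apply: (@le_trans _ _ (\sum_(0 <= n < N) a i n ^+ 2)).
    rewrite /sqcoef !big_nat; apply: ler_sum => n /andP[_ nN].
    by rewrite coefE ?(leq_trans nN NM) ?(leq_trans iI IM).
  by rewrite lerDl; apply: sumr_ge0 => n _; exact: sqr_ge0.
set A := mean P (fun x => `|blocks p w a 0 M M x| `^ p).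
have A0 : 0 <= A by apply: mean_ge0 => x; exact: powR_ge0.
have vA : `|v| = A `^ p^-1 by rewrite (vE M M0M); exact: norm_generator_sum.
have p20 : 0 <= p / 2 by rewrite divr_ge0// ltW.
split.
  have -> : `|v| `^ p = A by rewrite vA -powRrM mulVf ?gt_eqF// powRr1.
  apply: le_trans (blocks_sqnorm_le hP p2 w01 a M M).
  rewrite [leRHS](big_cat_nat (n := I))//=; apply: (@le_trans _ _ (\sum_(0 <= i < I) sqnorm a M i `^ (p / 2))).
    rewrite !big_nat; apply: ler_sum => i /andP[_ iI].
    by apply: ge0_lerP => //; exact: sq_le.
  by rewrite lerDl; apply: sumr_ge0 => i _; exact: powR_ge0.
have -> : `|v| ^+ 2 = A `^ (2 / p).
  by rewrite vA -powR_mulrn ?powR_ge0// -powRrM mulrC.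
apply: le_trans (blocks_sqr_le hP p2 w01 a M M).
rewrite [leRHS](big_cat_nat (n := I))//=; apply: (@le_trans _ _ (\sum_(0 <= i < I) w i ^+ 2 * sqnorm a M i)).
  rewrite !big_nat; apply: ler_sum => i /andP[_ iI].
  by rewrite ler_wpM2l ?sqr_ge0//; exact: sq_le.
by rewrite lerDl; apply: sumr_ge0 => i _; rewrite mulr_ge0 ?sqr_ge0 ?sqnorm_ge0.
Qed.

(** Only finitely many coefficients occur, each of them continuous, so the bounds pass to limits. *)
Lemma coef_closure_le v I N : closure (linear_span gens) v ->
  \sum_(0 <= i < I) sqcoef N i v `^ (p / 2) <= `|v| `^ p /\
  \sum_(0 <= i < I) w i ^+ 2 * sqcoef N i v <= `|v| ^+ 2.
Proof.
move=> /closure_seq_cvg[u uG uv].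
have cu i n : coef w i n (u k) @[k --> \oo] --> coef w i n v.
  have [C hC] := coef_bounded P p1 w p2 i n.
  apply/cvgrPdist_lt => e e0.
  have C0 : 0 < `|C| + 1 by rewrite ltr_wpDl.
  move/cvgrPdist_lt : uv => /(_ (e / (`|C| + 1))); rewrite divr_gt0// => /(_ isT).
  apply: filterS => k; rewrite ltr_pdivlMr// => h; apply: le_lt_trans h.
  have -> : coef w i n v - coef w i n (u k) = coef w i n (v - u k).
    by rewrite (_ : v - u k = -1 *: u k + v) ?(coef_linear w p2) ?mulN1r 1?addrC ?scaleN1r.
  apply: le_trans (hC _) _; rewrite mulrC ler_wpM2l//.
  by apply: le_trans (ler_norm C) _; rewrite lerDl.
have sqcu i : sqcoef N i (u k) @[k --> \oo] --> sqcoef N i v.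
  by apply: cvg_seq_sum => n; apply: cvgM; exact: cu.
have nu : `|u k| @[k --> \oo] --> `|v| by apply: cvg_norm.
have p21 : 1 < p / 2 by have := p2 => ?; rewrite ltr_pdivlMr//; lra.
have p_gt1 : 1 < p by have := p2 => ?; lra.
split.
  have nup := powR_cvg p_gt1 (fun k => normr_ge0 (u k)) (normr_ge0 v) nu.
  apply: ler_cvg_to nup _; last first.
    apply: nearW => k; have [h _] := coef_span_le I N (uG k); exact: h.
  by apply: cvg_seq_sum => i; apply: powR_cvg.
have nu2 : `|u k| ^+ 2 @[k --> \oo] --> `|v| ^+ 2 by apply: cvgM.
apply: ler_cvg_to nu2 _; last first.
  apply: nearW => k; have [_ h] := coef_span_le I N (uG k); exact: h.
by apply: cvg_seq_sum => i; apply: cvgM => //; exact: cvg_cst.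
Qed.

Lemma Dpw_retract : retract (XH p1 w) (Dpw P p1 w).
Proof.
have p_gt1 : 1 < p by have := p2 => ?; lra.
have hD : seq_complete (Dpw P p1 w).
  apply: subsp_closure_complete.
  (* [Lp] depends on the proof of 1 <= p, and completeness was obtained for the one derived from 1 <
     p. *)
  have irr (q1 q2 : 1 <= p) : seq_complete (Lp P q1) -> seq_complete (Lp P q2).
    by rewrite (bool_irrelevance q1 q2).
  exact: (irr _ _ (@Lp_seq_complete _ _ R P p p_gt1)).
have inD i n : subsp_pred (linear_subspace_closure (linear_subspace_span gens)) (gen i n).
  apply/mem_set; apply: subset_closure.
  exists 1%N, (fun=> 1), (fun=> gen i n); split; first by move=> _; exists i, n.
  by rewrite big_ord1 scale1r.
pose g i n : Dpw P p1 w := exist _ (gen i n) (inD i n).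
have val_sum (m : nat) (F : nat -> Dpw P p1 w) :
    val (\sum_(0 <= k < m) F k) = \sum_(0 <= k < m) val (F k).
  exact: (big_morph val).
apply: (@XH_retract _ _ hD p p1 w g (upper_const p) (upper_const_ge0 p) _
  (fun i n v => coef w i n (val v)) 1 ler01).
- move=> c I N; apply: le_trans (norm_generator_sum_le hP p1 p2 w01 c I N).
  rewrite -[`|_|]/(`|val _|) val_sum le_eqVlt; apply/orP; left; apply/eqP.
  by congr `|_|; apply: eq_bigr => i _; rewrite val_sum.
- by move=> i n a x y; exact: coef_linear.
- by move=> i n j m; exact: coef_generator.
- move=> v I N; rewrite mul1r.
  by case: (coef_closure_le I N (set_mem (valP v))).
- move=> v I N; rewrite mul1r.
  by case: (coef_closure_le I N (set_mem (valP v))).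
Qed.

End Dpw_retract.

(** * The dual of the sum of copies of l2 *)

Section dual_complete.
Context {R : realType}.

Lemma real_seq_complete : seq_complete (R^o : normedModType R).
Proof.
move=> u uC; suff /cvg_ex[l ul] : cvg (u @ \oo) by exists l.
apply: cauchy_cvg; apply: cauchy_exP => e e0.
have [N hN] := uC _ (divr_gt0 e0 (ltr0Sn R 1)).
exists (u N); exists N => // n /= Nn.
rewrite -ball_normE /= distrC; apply: le_lt_trans (hN N n (leqnn N) Nn) _.
by rewrite ltr_pdivrMr// ltr_pMr// ltr1n.
Qed.

(** The pointwise limit is linear; the Cauchy estimates, tested at each x, pass to it and give
    convergence in norm. *)
Lemma dual_seq_complete (U : normedModType R) : seq_complete (dual_space U).
Proof.
move=> u uC.
have bd m n x : `|val (u n) x - val (u m) x| <= `|u n - u m| * `|x|.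
  exact: (dual_norm_ge (u n - u m) x).
have [f lf cf] : exists2 f : U -> R^o, linear f &
    forall x, (val (u n) x : R^o) @[n --> \oo] --> f x.
  apply: (@limit_linear R U R^o (fun n x => val (u n) x)).
    by move=> n; exact: dual_linearP.
  move=> x; apply: real_seq_complete => e e0.
  have x0 : 0 < `|x| + 1 by rewrite ltr_wpDl.
  have [N hN] := uC _ (divr_gt0 e0 x0); exists N => m n Nm mn.
  apply: le_trans (bd _ _ _) _; have := hN m n Nm mn.
  rewrite ler_pdivlMr// => h; apply: le_trans h; rewrite ler_wpM2l// lerDl//.
have lim_le e m N x : (forall n, (N <= n)%N -> `|u n - u m| <= e) ->
    `|f x - val (u m) x| <= e * `|x|.
  move=> h.
  have cn : `|(val (u n) x : R^o) - val (u m) x| @[n --> \oo] --> `|f x - val (u m) x|.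
    by apply: cvg_norm; apply: cvgB; [exact: cf|exact: cvg_cst].
  apply: (cvgr_to_le cn); exists N => // n /= Nn.
  by apply: le_trans (bd _ _ _) _; rewrite ler_wpM2r// h.
have bf : exists C, forall x, `|f x| <= C * `|x|.
  have [N hN] := uC 1 ltr01; exists (1 + `|u N|) => x.
  rewrite -[f x](subrK (val (u N) x)); apply: le_trans (ler_normD _ _) _.
  rewrite mulrDl; apply: lerD; last exact: dual_norm_ge.
  by apply: (lim_le 1 N N) => n Nn; exact: hN.
exists (mk_dual (dual_ex lf bf)); apply/cvgrPdist_lt => e e0.
have [N hN] := uC _ (divr_gt0 e0 (ltr0Sn R 1)); exists N => // m /= Nm.
apply: (@le_lt_trans _ _ (e / 2)); last by rewrite ltr_pdivrMr// ltr_pMr// ltr1n.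
apply: dual_norm_le => [|x]; first by rewrite divr_ge0// ltW.
by apply: (lim_le _ m m) => n mn; exact: hN.
Qed.

End dual_complete.

(** * Hoelder's inequality for finite sums *)

Section finite_hoelder.
Context {R : realType}.

(** Young's inequality for x_i / X and y_i / Y, summed; X = 0 or Y = 0 forces all terms of that
    sequence to vanish. *)
Lemma hoelder_sum (q r X Y : R) (x y : nat -> R) n : 0 < q -> 0 < r ->
  q^-1 + r^-1 = 1 -> 0 <= X -> 0 <= Y ->
  (forall i, 0 <= x i) -> (forall i, 0 <= y i) ->
  \sum_(0 <= i < n) x i `^ q <= X `^ q -> \sum_(0 <= i < n) y i `^ r <= Y `^ r ->
  \sum_(0 <= i < n) x i * y i <= X * Y.
Proof.
move=> q0 r0 qr X0 Y0 x0 y0 hx hy.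
have zero s (z : nat -> R) i : 0 < s -> (forall i, 0 <= z i) ->
    \sum_(0 <= i < n) z i `^ s <= 0 `^ s -> (i < n)%N -> z i = 0.
  move=> s0 z0 h iN.
  have : 0 `^ s = 0 by rewrite powR0// gt_eqF.
  move=> e; rewrite e in h; have : z i `^ s <= 0; last first.
    move=> h'; apply/eqP; have : z i `^ s == 0 by rewrite eq_le powR_ge0 h'.
    by rewrite powR_eq0 => /andP[].
  apply: le_trans h; rewrite big_mkord (bigD1 (Ordinal iN))//= lerDl.
  by apply: sumr_ge0 => j _; exact: powR_ge0.
have [X00|Xn0] := eqVneq X 0.
  rewrite X00 in hx *; rewrite mul0r big_nat big1// => i /andP[_ iN].
  by rewrite (zero q x) ?mul0r.
have [Y00|Yn0] := eqVneq Y 0.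
  rewrite Y00 in hy *; rewrite mulr0 big_nat big1// => i /andP[_ iN].
  by rewrite (zero r y) ?mulr0.
have {X0 Xn0} X0 : 0 < X by rewrite lt_def Xn0.
have {Y0 Yn0} Y0 : 0 < Y by rewrite lt_def Yn0.
have young i : x i * y i <= X * Y * (q^-1 * (x i `^ q / X `^ q) + r^-1 * (y i `^ r / Y `^ r)).
  have := @conjugate_powR R (x i / X) (y i / Y) q r.
  rewrite !divr_ge0 ?(ltW X0) ?(ltW Y0)// => /(_ isT isT q0 r0 qr).
  have dv (a b s : R) : 0 <= a -> 0 < b -> (a / b) `^ s = a `^ s / b `^ s.
    move=> a0 b0; rewrite powRM ?invr_ge0 ?(ltW b0)//; congr (_ * _).
    by rewrite -powR_inv1 ?(ltW b0)// -powRrM mulN1r powRN.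
  rewrite !dv// ![_ / q]mulrC ![_ / r]mulrC => h.
  have := ler_wpM2l (ltW (mulr_gt0 X0 Y0)) h; apply: le_trans.
  by rewrite le_eqVlt; apply/orP; left; apply/eqP; field; rewrite !gt_eqF.
apply: le_trans (ler_sum _ (fun i _ => young i)) _.
rewrite -mulr_sumr big_split/= -!mulr_sumr -!mulr_suml.
rewrite -[leRHS]mulr1 ler_wpM2l ?mulr_ge0 ?(ltW X0) ?(ltW Y0)//.
rewrite -qr; apply: lerD; rewrite -[leRHS]mulr1 ler_wpM2l ?invr_ge0 ?(ltW q0) ?(ltW r0)//.
  by rewrite ler_pdivrMr ?powR_gt0// mul1r.
by rewrite ler_pdivrMr ?powR_gt0// mul1r.
Qed.

Lemma cauchy_schwarz_sum (x y : nat -> R) n X Y : 0 <= X -> 0 <= Y ->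
  \sum_(0 <= i < n) x i ^+ 2 <= X ^+ 2 -> \sum_(0 <= i < n) y i ^+ 2 <= Y ^+ 2 ->
  `|\sum_(0 <= i < n) x i * y i| <= X * Y.
Proof.
move=> X0 Y0 hx hy; apply: le_trans (ler_norm_sum _ _ _) _.
under eq_bigr => i _ do rewrite normrM.
have e (z : nat -> R) : \sum_(0 <= i < n) `|z i| `^ 2 = \sum_(0 <= i < n) z i ^+ 2.
  by apply: eq_bigr => i _; rewrite powR_mulrn// real_normK ?num_real.
apply: (@hoelder_sum 2 2) => //; first by field.
  by rewrite e powR_mulrn.
by rewrite e powR_mulrn.
Qed.

End finite_hoelder.

(** * A copy of l^q(l2) in the dual of l^r(l2) *)

Section lp_sum_dual.
Context {R : realType}.

Lemma sum_trunc_le (F : nat -> R) N n : (forall k, 0 <= F k) ->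
  \sum_(0 <= k < n) (if (k < N)%N then F k else 0) <= \sum_(0 <= k < N) F k.
Proof.
move=> F0; apply: (@le_trans _ _ (\sum_(0 <= k < n + N) (if (k < N)%N then F k else 0))).
  rewrite [leRHS](big_cat_nat (n := n)) ?leq_addr//= lerDl.
  by apply: sumr_ge0 => k _; case: ifP.
rewrite (big_cat_nat (n := N)) ?leq_addl//=.
have -> : \sum_(N <= k < n + N) (if (k < N)%N then F k else 0) = 0.
  by rewrite big_nat big1// => k /andP[Nk _]; rewrite ltnNge Nk.
rewrite addr0 le_eqVlt; apply/orP; left; apply/eqP.
by apply: eq_big_nat => k /andP[_ ->].
Qed.

(** Zero weights leave the l^q part of the norm alone, which brings l^q(l2) under [XH_retract]. *)
Lemma lp_sum_XH_retract (q : R) (q1 : 1 <= q) :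
  retract (lp_sum q1 (ell2 R)) (XH q1 (fun=> 0)).
Proof.
have [J lJ [JE JC]] : exists2 J : lp_sum q1 (ell2 R) -> XH q1 (fun=> 0), linear J &
    (forall x, val (J x) = val x) /\ (forall x, `|J x| <= 1 * `|x|).
  apply: finite_norm_lift; first by move=> a x y; rewrite finite_norm_valP.
  move=> x; rewrite mul1r; apply/XH_norm_leP => //.
  split=> n; first by have /lp_sum_norm_leP := lexx `|x|; apply.
  by rewrite big1 ?sqr_ge0// => k _; rewrite expr0n mul0r.
have [K lK [KE KC]] : exists2 K : XH q1 (fun=> 0) -> lp_sum q1 (ell2 R), linear K &
    (forall x, val (K x) = val x) /\ (forall x, `|K x| <= 1 * `|x|).
  apply: finite_norm_lift; first by move=> a x y; rewrite finite_norm_valP.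
  move=> x; rewrite mul1r; apply/Lnorm_counting_le => // n.
  by have [h _] := XH_sum_le x; apply: le_trans (h n); apply: ler_sum => k _; rewrite normr_id.
apply: (retract_intro lJ lK); [by exists 1|by exists 1|].
by move=> x; apply: val_inj; rewrite KE JE.
Qed.

Variables (r : R) (r1 : 1 <= r).
Local Notation L := (lp_sum r1 (ell2 R)).

Let r_gt0 : 0 < r. Proof. exact: lt_le_trans r1. Qed.

Lemma lp_sum_powR_le (a : L) n : \sum_(0 <= k < n) `|val a k| `^ r <= `|a| `^ r.
Proof. by have /lp_sum_norm_leP := lexx `|a|; apply. Qed.

Lemma lp_sum_val_le (a : L) k : `|val a k| <= `|a|.
Proof.
have : `|val a k| `^ r <= `|a| `^ r.
  apply: le_trans (lp_sum_powR_le a k.+1); rewrite big_nat_recr//= lerDr.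
  by apply: sumr_ge0 => i _; exact: powR_ge0.
have ri0 : 0 <= r^-1 by rewrite invr_ge0 ltW.
move=> /(ge0_lerP ri0 (powR_ge0 _ _)).
by rewrite -!powRrM divff ?gt_eqF// !powRr1.
Qed.

Lemma ell2_coord_le (x : ell2 R) n : `|ell2_coord x n| <= `|x|.
Proof.
rewrite -ler_sqr ?nnegrE// real_normK ?num_real//.
apply: le_trans (ell2_sum_le x n.+1); rewrite big_nat_recr//= lerDr.
by apply: sumr_ge0 => k _; exact: sqr_ge0.
Qed.

Lemma ell2_coord0 n : ell2_coord (0 : ell2 R) n = 0.
Proof.
have := ell2_coordP (-1) (0 : ell2 R) 0 n.
by rewrite scaler0 addr0 mulN1r addNr.
Qed.

Lemma lp_sum_slot : exists2 slot : nat -> ell2 R -> L,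
  (forall i, linear (slot i)) &
  forall i x k, val (slot i x) k = if k == i then x else 0.
Proof.
have /choice[s sP] : forall i, exists s : ell2 R -> L, linear s /\
    forall x k, val (s x) k = if k == i then x else 0.
  move=> i; pose f (x : ell2 R) (k : nat) : ell2 R := if k == i then x else 0.
  have lf : linear f.
    move=> a x y; apply/funext => k; rewrite seq_linearP /f; case: ifP => // _.
    by rewrite scaler0 addr0.
  have [s ls [sE _]] : exists2 s : ell2 R -> L, linear s &
      (forall x, val (s x) = f x) /\ (forall x, `|s x| <= 1 * `|x|).
    apply: finite_norm_lift => // x; rewrite mul1r; apply/Lnorm_counting_le => // n.
    have [iN|iN] := ltnP i n.
      rewrite big_mkord (bigD1 (Ordinal iN))//= big1 => [|k ki].
        by rewrite addr0 normr_id /f eqxx.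
      by rewrite /f ifN ?normr0 ?powR0// ?gt_eqF//.
    rewrite big_nat big1 ?powR_ge0// => k /andP[_ kn].
    by rewrite /f ltn_eqF ?(leq_trans kn)// !normr0 powR0// gt_eqF.
  by exists s; split => // x k; rewrite sE.
by exists s => [i|i x k]; case: (sP i).
Qed.

Let lp_sum_valD (a b : L) k : val (a + b) k = val a k + val b k.
Proof.
have := finite_norm_valP 1 a b; rewrite scale1r => ->.
by rewrite seq_linearP scale1r.
Qed.

Variables (q : R) (q1 : 1 <= q) (q_gt1 : 1 < q) (qr : q^-1 + r^-1 = 1).

Let q_gt0 : 0 < q. Proof. exact: lt_trans q_gt1. Qed.

Let conjE : (q - 1) * r = q.
Proof.
have r0 : r != 0 by rewrite gt_eqF.
have q0 : q != 0 by rewrite gt_eqF.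
have : (q^-1 + r^-1) * (q * r) = q * r by rewrite qr mul1r.
have -> : (q^-1 + r^-1) * (q * r) = r + q by field; rewrite q0 r0.
by move=> h; rewrite mulrBl mul1r -h addrAC subrr add0r.
Qed.

(** The coordinate functionals g and evaluation at the unit vectors are biorthogonal. Cauchy-Schwarz
    within the rows and Hoelder across them bound the synthesis; the coefficients of f are bounded
    by testing f on a finitely supported extremal vector. *)
Lemma lp_sum_dual_retract : retract (lp_sum q1 (ell2 R)) (dual_space L).
Proof.
apply: retract_trans (lp_sum_XH_retract q1) _.
have [e le eP] := ell2_unit (R := R).
have [slot ls slotE] := lp_sum_slot.
have gP i n : dual_pred ((fun a : L => ell2_coord (val a i) n) : L -> R^o).
  apply: dual_ex.
    by move=> a x y; rewrite finite_norm_valP seq_linearP ell2_coordP.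
  exists 1 => a; rewrite mul1r; apply: le_trans (ell2_coord_le _ _) _.
  exact: lp_sum_val_le.
pose g i n : dual_space L := mk_dual (gP i n).
pose b i n (f : dual_space L) : R := val f (slot i (e n 1)).
have val_sum (m : nat) (F : nat -> dual_space L) a :
    val (\sum_(0 <= k < m) F k) a = \sum_(0 <= k < m) val (F k) a.
  exact: (big_morph (fun f : dual_space L => val f a)).
apply: (@XH_retract _ _ (@dual_seq_complete R L) q q1 (fun=> 0) g 1 ler01 _ b 1 ler01).
- move=> c I N; rewrite mul1r; apply: dual_norm_le => [|a].
    by rewrite addr_ge0 ?powR_ge0.
  set sq := fun i => \sum_(0 <= n < N) c i n ^+ 2.
  have sq0 i : 0 <= sq i by apply: sumr_ge0 => n _; exact: sqr_ge0.
  apply: (@le_trans _ _ ((\sum_(0 <= i < I) sq i `^ (q / 2)) `^ q^-1 * `|a|)); last first.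
    by rewrite ler_wpM2r// lerDl powR_ge0.
  rewrite val_sum; apply: le_trans (ler_norm_sum _ _ _) _.
  apply: (@le_trans _ _ (\sum_(0 <= i < I) sq i `^ 2^-1 * `|val a i|)).
    apply: ler_sum => i _; rewrite val_sum; apply: cauchy_schwarz_sum => //.
    - exact: powR_ge0.
    - by rewrite -powR_mulrn ?powR_ge0// -powRrM mulVf ?powRr1// pnatr_eq0.
    - exact: ell2_sum_le.
  apply: (@hoelder_sum R q r) => //.
  - exact: powR_ge0.
  - by move=> i; exact: powR_ge0.
  - rewrite -[leRHS]powRrM mulVf ?gt_eqF// powRr1; last first.
      by apply: sumr_ge0 => i _; exact: powR_ge0.
    by apply: ler_sum => i _; rewrite -powRrM mulrC.
  - exact: lp_sum_powR_le.
- by move=> i n a x y.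
- move=> i n j m; rewrite /b /= slotE eq_sym.
  case: eqP => _ /=; last exact: ell2_coord0.
  by have [-> _] := eP n 1; rewrite mul1r eq_sym.
- move=> f I N; rewrite mul1r.
  set B := fun i => \sum_(0 <= n < N) b i n f ^+ 2.
  have B0 i : 0 <= B i by apply: sumr_ge0 => n _; exact: sqr_ge0.
  pose z i : ell2 R := \sum_(0 <= n < N) b i n f *: e n 1.
  (* Equality case of Hoelder, on which f is tested. *)
  pose t i := B i `^ (q / 2 - 1).
  pose a : L := \sum_(0 <= i < I) slot i (t i *: z i).
  set S := \sum_(0 <= i < I) _.
  have S0 : 0 <= S by apply: sumr_ge0 => i _; exact: powR_ge0.
  have tB i : t i * B i = B i `^ (q / 2).
    have [->|Bi] := eqVneq (B i) 0.
      by rewrite mulr0 powR0// mulf_neq0 ?invr_neq0// gt_eqF.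
    by rewrite /t -{2}[B i]powRr1// -powRD ?Bi ?implybT// subrK.
  have fa : val f a = S.
    have fslot i c x y : val f (slot i (c *: x + y)) = c * val f (slot i x) + val f (slot i y).
      by rewrite ls dual_linearP.
    have fslot0 i : val f (slot i 0) = 0.
      by have := fslot i (-1) 0 0; rewrite scaler0 addr0 mulN1r addNr.
    have fslotZ i c x : val f (slot i (c *: x)) = c * val f (slot i x).
      by have := fslot i c x 0; rewrite addr0 fslot0 addr0.
    have fslotD i : {morph (fun x => val f (slot i x)) : x y / x + y}.
      by move=> x y /=; have := fslot i 1 x y; rewrite scale1r mul1r.
    rewrite dual_sum; apply: eq_bigr => i _; rewrite fslotZ -tB; congr (_ * _).
    rewrite (big_morph _ (fslotD i) (fslot0 i)); apply: eq_bigr => n _.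
    by rewrite fslotZ expr2.
  have zn i : `|z i| <= B i `^ 2^-1.
    apply/ell2_norm_leP; first exact: powR_ge0.
    move=> n; rewrite -powR_mulrn ?powR_ge0// -powRrM mulVf ?pnatr_eq0// powRr1//.
    have zE k : ell2_coord (z i) k = if (k < N)%N then b i k f else 0.
      have coordD : {morph (fun x : ell2 R => ell2_coord x k) : x y / x + y}.
        by move=> x y /=; have := ell2_coordP 1 x y k; rewrite scale1r mul1r.
      rewrite (big_morph _ coordD (ell2_coord0 k)).
      under eq_bigr => m _.
        have := ell2_coordP (b i m f) (e m 1) 0 k; rewrite addr0 ell2_coord0 addr0 => ->.
        have [-> _] := eP m 1; rewrite mul1r; over.
      case: ifPn => kN.
        rewrite big_mkord (bigD1 (Ordinal kN))//= eqxx mulr1 big1 ?addr0// => m mk.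
        have -> : (k == nat_of_ord m) = false by apply: contraNF mk => /eqP h; exact/eqP/val_inj.
        by rewrite mulr0.
      rewrite big_nat big1// => m /andP[_ mN].
      by rewrite gtn_eqF ?mulr0// (leq_trans mN)// leqNgt.
    under eq_bigr => k _ do rewrite zE (fun_if (fun x : R => x ^+ 2)) expr0n.
    exact: (sum_trunc_le N n (fun k => sqr_ge0 (b i k f))).
  have an : `|a| <= S `^ r^-1.
    apply/lp_sum_norm_leP; first exact: powR_ge0.
    move=> n; rewrite -powRrM mulVf ?gt_eqF// powRr1//.
    have aE k : val a k = if (k < I)%N then t k *: z k else 0.
      have val0 : val (0 : L) k = 0 by [].
      have valD : {morph (fun x : L => val x k) : x y / x + y} by move=> x y; exact: lp_sum_valD.
      rewrite (big_morph _ valD val0); under eq_bigr => i _ do rewrite slotE.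
      case: ifPn => kI.
        rewrite big_mkord (bigD1 (Ordinal kI))//= eqxx big1 ?addr0// => i ik.
        by rewrite ifN//; apply: contraNneq ik => h; exact/eqP/val_inj.
      rewrite big_nat big1// => i /andP[_ iI].
      by rewrite gtn_eqF// (leq_trans iI)// leqNgt.
    under eq_bigr => k _ do rewrite aE.
    apply: le_trans (_ : _ <= \sum_(0 <= k < n)
        (if (k < I)%N then B k `^ (q / 2) else 0)) _.
      apply: ler_sum => k _; case: ifP => _; last by rewrite normr0 powR0 ?gt_eqF.
      rewrite normrZ ger0_norm ?powR_ge0//.
      (* By [conjE], (q/2 - 1 + 1/2) r = q/2. The exponent in t is chosen so that the r-th powers of
         the bounds on the entries of a are again the terms of S. *)
      have -> : B k `^ (q / 2) = (t k * B k `^ 2^-1) `^ r.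
        have [->|Bk] := eqVneq (B k) 0.
          by rewrite [0 `^ 2^-1]powR0 ?invr_neq0 ?pnatr_eq0// mulr0 !powR0 ?gt_eqF// divr_gt0.
        rewrite /t -powRD ?Bk ?implybT// -powRrM; congr (_ `^ _).
        by rewrite -{1}conjE; field.
      apply: ge0_lerP; rewrite ?(ltW r_gt0) ?mulr_ge0 ?powR_ge0//.
      by rewrite ler_wpM2l ?powR_ge0.
    exact: (sum_trunc_le I n (fun k => powR_ge0 (B k) _)).
  have : S <= `|f| * S `^ r^-1.
    rewrite -{1}fa; apply: le_trans (ler_norm _) _.
    by apply: le_trans (dual_norm_ge f a) _; rewrite ler_wpM2l.
  have [->|Sn0] := eqVneq S 0; first by rewrite powR_ge0.
  have Sp : 0 < S by rewrite lt_def Sn0.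
  rewrite -ler_pdivrMr ?powR_gt0// => h.
  (* Dividing by S^(1/r) leaves S^(1/q), since 1 - 1/r = 1/q. *)
  have -> : S = (S / S `^ r^-1) `^ q.
    rewrite -[X in X / _](powRr1 S0) -powRN -powRD ?Sn0 ?implybT//.
    by rewrite -qr addrK -powRrM mulVf ?gt_eqF// powRr1.
  by apply: ge0_lerP; rewrite ?(ltW q_gt0) ?divr_ge0 ?powR_ge0.
- move=> f I N; rewrite big1 ?sqr_ge0// => i _.
  by rewrite expr0n mul0r.
Qed.

End lp_sum_dual.

(** * The retraction for both ranges of p *)

Section main.
Context {R : realType} (P : probability (cube R) R) (hP : product_lebesgue P).

Lemma sum_Dpw_retract (p : R) (p1 : 1 <= p) (p2 : 2 < p) (v w : nat -> R) :
  (forall n, 0 < v n) -> (forall n, 0 < w n <= 1) -> condition_star p w ->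
  retract (lp_sum p1 (ell2 R) * Xpw p1 v)%type (Dpw P p1 w).
Proof.
move=> v0 w01 w_star; apply: retract_trans (mixed_retract p1 v) _.
have u0 j : 0 < mixed_weights v j.
  by rewrite /mixed_weights; case: ifP => // _; rewrite invr_gt0 exprn_gt0.
have w0 n : 0 < w n by have /andP[] := w01 n.
exact: retract_trans (XH_weights_retract p2 w0 w_star p1 u0) (Dpw_retract hP p1 p2 w01).
Qed.

(** For p < 2 the conjugate exponent exceeds 2 and the retract found there is dualised. X_p is a
    dual by definition, while l^p(l2) enters as a retract of the dual of the sum for the conjugate
    exponent. *)
Lemma sum_space_retract (p : R) (p1 : 1 < p) (v w : nat -> R) : p != 2 ->
  (forall n, 0 < v n) -> (forall n, 0 < w n <= 1) ->
  condition_star (exponent_ge2 p) w ->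
  retract (lp_sum (ltW p1) (ell2 R) * X_space p1 v)%type (D_space P p1 w).
Proof.
move=> p2 v0 w01; rewrite /exponent_ge2 /X_space /D_space.
case: ltrP => [p_lt2 w_star|p_ge2]; last first.
  by apply: sum_Dpw_retract => //; rewrite lt_def p2.
have p0 : p != 0 by rewrite gt_eqF// (lt_trans ltr01).
have p10 : 0 < p - 1 by rewrite subr_gt0.
set r1 := ltW (conjugate_gt1 p1).
have r2 : 2 < conjugate p.
  by rewrite /conjugate ltr_pdivlMr//; lra.
have pr : p^-1 + (conjugate p)^-1 = 1.
  by rewrite /conjugate; field; rewrite p0 gt_eqF.
have J1 := lp_sum_dual_retract r1 (ltW p1) p1 pr.
have J2 : retract (dual_space (Xpw r1 v)) (dual_space (Xpw r1 v)).
  by apply: (retract_intro (j := id) (k := id)) => //; exists 1 => x; rewrite mul1r.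
apply: retract_trans (retract_prod J1 J2) _.
apply: retract_trans (retract_dual_prod _ _) _.
exact/retract_dual/sum_Dpw_retract.
Qed.

End main.

Theorem proposition4p17 (R : realType) (P : probability (cube R) R)
    (hP : product_lebesgue P) (p : R) (p1 : 1 < p) (p2 : p <> 2)
    (v w : nat -> R)
    (v_gt0 : forall n, 0 < v n) (v_star : condition_star (exponent_ge2 p) v)
    (w01 : forall n, 0 < w n <= 1)
    (w_star : condition_star (exponent_ge2 p) w) :
  [/\ complemented_embeds (X_space p1 v) (D_space P p1 w),
      complemented_embeds (lp_sum (ltW p1) (ell2 R)) (D_space P p1 w) &
      complemented_embeds (lp_sum (ltW p1) (ell2 R) * X_space p1 v)%type
        (D_space P p1 w)].
Proof.
have /eqP p2' := p2.
have H := sum_space_retract hP p1 p2' v_gt0 w01 w_star.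
(* Parts (a) and (b) follow from (c), each factor being a retract of the product. *)
split; apply: retract_complemented => //.
  exact: retract_trans (retract_snd _ _) H.
exact: retract_trans (retract_fst _ _) H.
Qed.
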